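(* For every $d\in\mathbb{N}$ and $q\in(-1,1)$ there exists a compactly supported probability measure $\mu_{d;q}$ on $\mathbb{R}$ such that $$\int_{\mathbb{R}}x^n\,d\mu_{d;q}(x)=\widetilde{P}_n(d,q),\qquad\forall\,n\in\mathbb{N}.$$ Moreover, $\mu_{d;q}$ can be taken to be the distribution, with respect to the state $\varphi_{\mathrm{vac}}\otimes\varphi_{\mathrm{vac}}$ on $B(\mathcal{T}_{d;q})\otimes B(\mathcal{T}_{d;q})$, of the selfadjoint operator $X_{d;q}=\bigl(\sum_{i=1}^d(L_{i;q}+L_{i;q}^* )\otimes(L_{i;q}+L_{i;q}^* )\bigr)^2$.
   Context: $\mathbb{N}=\{1,2,3,\dots\}$; inner products are linear in the first variable; $0^0=1$. The distribution of a bounded selfadjoint operator $X$ with respect to a state $\varphi$ is the unique compactly supported probability measure $\mu$ on $\mathbb{R}$ with $\int x^n d\mu=\varphi(X^n)$ for all $n\in\mathbb{N}$ (scalar spectral measure). $q$-Fock space. For $n\in\mathbb{N}$, equip $(\mathbb{C}^d)^{\otimes n}$ with the inner product determined by $\langle v_1\otimes\cdots\otimes v_n, w_1\otimes\cdots\otimes w_n\rangle_q=\sum_{\tau\in S_n} q^{\iota(\tau)}\prod_{i=1}^n\langle v_i,w_{\tau(i)}\rangle$, where $\iota(\tau)=|\{(i,j): 1\le i<j\le n,\ \tau(i)>\tau(j)\}|$ (this is known to be an inner product). $\mathcal{T}_{d;q}$ is the Hilbert space orthogonal direct sum $\mathbb{C}\oplus\bigoplus_{n\ge1}(\mathbb{C}^d)^{\otimes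 n}$; the vector $1\in\mathbb{C}$ is the vacuum vector $\xi_{\mathrm{vac}}$, and $\varphi_{\mathrm{vac}}(X)=\langle X\xi_{\mathrm{vac}},\xi_{\mathrm{vac}}\rangle$ for $X\in B(\mathcal{T}_{d;q})$. $\varphi_{\mathrm{vac}}\otimes\varphi_{\mathrm{vac}}$ is the tensor product state, i.e. the vector state of $\xi_{\mathrm{vac}}\otimes\xi_{\mathrm{vac}}$ when $B(\mathcal{T}_{d;q})\otimes B(\mathcal{T}_{d;q})$ acts on the Hilbert space tensor product $\mathcal{T}_{d;q}\otimes\mathcal{T}_{d;q}$. With $e_1,\dots,e_d$ the standard orthonormal basis of $\mathbb{C}^d$, $L_{i;q}\in B(\mathcal{T}_{d;q})$ is the (bounded) operator determined by $L_{i;q}\xi_{\mathrm{vac}}=e_i$, $L_{i;q}(v_1\otimes\cdots\otimes v_n)=e_i\otimes v_1\otimes\cdots\otimes v_n$; $^*$ denotes the adjoint. Polynomials. $\mathcal{P}_2(2n)$ is the set of pair-partitions of $\{1,\dots,2n\}$ (partitions into $n$ blocks of size 2). Two distinct blocks of $\pi\in\mathcal{P}_2(2n)$ cross if, writing their union as $\{a<b<c<d\}$, one block is $\{a,c\}$ and the other $\{b,d\}$; $\mathrm{cr}(\pi)$ is the number of unordered pairs of crossing blocks. $\pi\vee\sigma$ is the join in the lattice of all partitions of $\{1,\dots,2n\}$ under reverse refinement order (the finest partition of which both $\pi,\sigma$ are refinements), and $|\cdot|$ is the number of blocks. A self-intersecting meandric system of order $n$ is a pair $(\pi,\sigma)\in\mathcal{P}_2(2n)^2$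 ($\pi$ drawn above and $\sigma$ below a horizontal line); its number of crossings is $\mathrm{cr}(\pi)+\mathrm{cr}(\sigma)$ and its number of closed curves is $|\pi\vee\sigma|$. Let $m_n^{(k,\ell)}$ be the number of such systems having exactly $k$ closed curves and $\ell$ crossings, and $\widetilde{P}_n(t,u)=\sum_{k=1}^n\sum_{\ell=0}^{n^2-n}m_n^{(k,\ell)}t^ku^\ell$. Equivalently, $\widetilde{P}_n(t,u)=\sum_{\pi,\sigma\in\mathcal{P}_2(2n)}t^{|\pi\vee\sigma|}u^{\mathrm{cr}(\pi)+\mathrm{cr}(\sigma)}$. *)

(* Defs.v *)
From HB Require Import structures.
From mathcomp Require Import all_boot all_order all_algebra all_fingroup.

Set Implicit Arguments.
Unset Strict Implicit.
Unset Printing Implicit Defensive.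

Section Meandric.
Local Open Scope nat_scope.

Section Partitions.
Variable T : finType.
Implicit Types P Q J : {set {set T}}.

Definition refines P Q := [forall A in P, exists B in Q, A \subset B].

Definition is_join P Q J :=
  [&& partition J [set: T], refines P J, refines Q J &
      [forall J', [&& partition J' [set: T], refines P J' & refines Q J']
                  ==> refines J J']].

(* The finest partition of [T] refined by both [P] and [Q]; the default [set0]
   is never used, as the finest one exists. *)
Definition part_join P Q := odflt set0 [pick J | is_join P Q J].
End Partitions.

Definition pair_partition n (P : {set {set 'I_n}}) :=
  partition P [set: 'I_n] && [forall A in P, #|A| == 2].

Definition crossing n (A B : {set 'I_n}) :=
  [exists a : 'I_n, exists b : 'I_n, exists c : 'I_n, exists e : 'I_n,
    [&& a < b, b < c, c < e &
      (A == [set a; c]) && (B == [set b; e]) ||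
      (A == [set b; e]) && (B == [set a; c])]].

(* [D] ranges over the unordered pairs of blocks. *)
Definition cr n (P : {set {set 'I_n}}) :=
  #|[set D : {set {set 'I_n}} |
      [exists A in P, exists B in P, (D == [set A; B]) && crossing A B]]|.

Definition meandric_count (n k l : nat) :=
  #|[set S : {set {set 'I_(2 * n)}} * {set {set 'I_(2 * n)}} |
      [&& pair_partition S.1, pair_partition S.2,
          #|part_join S.1 S.2| == k & cr S.1 + cr S.2 == l]]|.
End Meandric.

Definition inversions (n : nat) (t : 'S_n) : nat :=
  #|[set p : 'I_n * 'I_n | (p.1 < p.2)%N && (t p.2 < t p.1)%N]|.

From mathcomp Require Import all_classical all_reals all_analysis.
From mathcomp Require Import complex ring.
Import Order.TTheory GRing.Theory Num.Theory.
Import numFieldNormedType.Exports.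

Local Open Scope ring_scope.
Local Open Scope complex_scope.

Section GramSum.
Variable R : realType.
Local Notation C := R[i].

Lemma conjcM : {morph @conjc R : x y / x * y}.
Proof. exact: rmorphM. Qed.

Lemma conjc_sum (I : finType) (F : I -> C) : conjc (\sum_i F i) = \sum_i conjc (F i).
Proof. exact: (rmorph_sum (@conjc R)). Qed.

(* The inner product of two vectors given by their coordinates in a basis
   indexed by [T] with real Gram matrix [G], linear in the first variable. *)
Definition gram_sum (T : finType) (G : T -> T -> R) (f g : T -> C) : C :=
  \sum_u \sum_v f u * conjc (g v) * (G u v)%:C.

Lemma gram_sum_linear (T : finType) (G : T -> T -> R) a (f g h : T -> C) :
  gram_sum G (fun u => a * f u + g u) h = a * gram_sum G f h + gram_sum G g h.
Proof.
rewrite /gram_sum mulr_sumr -big_split /=; apply: eq_bigr => u _.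
rewrite mulr_sumr -big_split /=; apply: eq_bigr => v _.
by rewrite !mulrDl !mulrA.
Qed.

Lemma gram_sum_conj (T : finType) (G : T -> T -> R) (f g : T -> C) :
  (forall u v, G u v = G v u) -> gram_sum G g f = conjc (gram_sum G f g).
Proof.
move=> Gsym; rewrite /gram_sum exchange_big /= conjc_sum; apply: eq_bigr => u _.
rewrite conjc_sum; apply: eq_bigr => v _.
by rewrite !conjcM conjcK conjc_real Gsym [g v * _]mulrC.
Qed.

Definition factorizable (T : finType) (G : T -> T -> R) :=
  exists (Z : finType) (A : Z -> T -> R), forall u v, G u v = \sum_z A z u * A z v.

Lemma factorizable_sym (T : finType) (G : T -> T -> R) :
  factorizable G -> forall u v, G u v = G v u.
Proof.
by move=> [Z [A GA]] u v; rewrite !GA; apply: eq_bigr => z _; rewrite mulrC.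
Qed.

Lemma gram_sum_ge0 (T : finType) (G : T -> T -> R) (f : T -> C) :
  factorizable G -> 0 <= gram_sum G f f.
Proof.
move=> [Z [A GA]].
have -> : gram_sum G f f =
    \sum_z (\sum_u f u * (A z u)%:C) * conjc (\sum_u f u * (A z u)%:C).
  under [RHS]eq_bigr => z _ do rewrite conjc_sum mulr_suml.
  rewrite exchange_big /=; apply: eq_bigr => u _.
  under [RHS]eq_bigr => z _ do rewrite mulr_sumr.
  rewrite exchange_big /=; apply: eq_bigr => v _.
  rewrite GA rmorph_sum mulr_sumr; apply: eq_bigr => z _.
  by rewrite rmorphM conjcM conjc_real mulrACA.
by apply: sumr_ge0 => z _; rewrite mulcJ_ge0.
Qed.

Lemma factorizable_prod (T T' : finType) (G : T -> T -> R) (G' : T' -> T' -> R) :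
  factorizable G -> factorizable G' ->
  factorizable (fun u v : T * T' => G u.1 v.1 * G' u.2 v.2).
Proof.
move=> [Z [A GA]] [Z' [A' GA']].
exists (Z * Z')%type, (fun z u => A z.1 u.1 * A' z.2 u.2) => u v.
rewrite GA GA' big_distrlr /= pair_bigA /=.
by apply: eq_bigr => z _; rewrite mulrACA.
Qed.

End GramSum.

Section QGram.
Variables (R : realType) (d : nat) (q : R).

(* The [q]-inner product of the basis tensors e_(u 1) (x) ... (x) e_(u n) and
   e_(v 1) (x) ... (x) e_(v n); see [gram_sum_pure] for arbitrary elementary
   tensors. *)
Definition qgram (n : nat) (u v : n.-tuple 'I_d) : R :=
  \sum_(t : 'S_n) q ^+ inversions t * \prod_i (tnth u i == tnth v (t i))%:R.

Lemma ltn_flip n (a b : 'I_n) : a != b -> (b < a)%N = ~~ (a < b)%N.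
Proof. by rewrite -val_eqE /=; case: ltngtP. Qed.

Lemma inversions_mul n (s t : 'S_n) :
  inversions (s^-1 * t)%g =
  #|[set p : 'I_n * 'I_n | (p.1 < p.2)%N &&
      ((s p.1 < s p.2)%N != (t p.1 < t p.2)%N)]|.
Proof.
set r := (s^-1 * t)%g.
pose D := [set p : 'I_n * 'I_n | ((s p.1 < s p.2)%N != (t p.1 < t p.2)%N)].
pose E := [set p : 'I_n * 'I_n | ((p.1 < p.2)%N != (r p.1 < r p.2)%N)].
have rE i : r (s i) = t i by rewrite permM permK.
have DE : #|D| = #|E|.
  pose h (p : 'I_n * 'I_n) := (s p.1, s p.2).
  have hinj : injective h by move=> [a b] [a' b'] [] /perm_inj-> /perm_inj->.
  rewrite -(card_imset _ hinj); apply: eq_card => -[a b].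
  rewrite [RHS]inE /=; apply/imsetP/idP => [[[x y]]|H].
    by rewrite !inE /= => Hxy [-> ->]; rewrite -/(r _) !rE.
  exists (s^-1 a, s^-1 b)%g; last by rewrite /h /= !permKV.
  by rewrite inE /= !permKV -!rE !permKV.
have sw_inj : injective (fun p : 'I_n * 'I_n => (p.2, p.1)).
  by move=> [a b] [a' b'] [-> ->].
have half (f g : 'S_n) (F : {set 'I_n * 'I_n}) :
    F = [set p : 'I_n * 'I_n | ((f p.1 < f p.2)%N != (g p.1 < g p.2)%N)] ->
    #|F| = (2 * #|[set p in F | (p.1 < p.2)%N]|)%N.
  move=> FE; rewrite mul2n -addnn -(cardsID [set p : 'I_n * 'I_n | (p.1 < p.2)%N] F).
  congr addn; first by apply: eq_card => p; rewrite !inE.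
  rewrite -[in RHS](card_imset _ sw_inj); apply: eq_card => -[a b].
  rewrite FE !inE /=; apply/idP/imsetP => [/andP[ab H]|[[x y]]].
    exists (b, a) => //; rewrite !inE /=.
    have nab : a != b by apply: contraTneq H => ->; rewrite !ltnn.
    rewrite (ltn_flip nab) ab andbT (@ltn_flip _ (f a)) ?(inj_eq perm_inj) //.
    by rewrite (@ltn_flip _ (g a)) ?(inj_eq perm_inj) // (inj_eq negb_inj).
  rewrite !inE /= => /andP[H xy] [-> ->].
  have nxy : x != y by apply: contraTneq xy => ->; rewrite ltnn.
  rewrite (ltn_flip nxy) xy /= (@ltn_flip _ (f x)) ?(inj_eq perm_inj) //.
  by rewrite (@ltn_flip _ (g x)) ?(inj_eq perm_inj) // (inj_eq negb_inj).
have hD := half s t D erefl.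
have hE : #|E| = (2 * #|[set p in E | (p.1 < p.2)%N]|)%N.
  by apply: (half 1%g r E); apply/setP => p; rewrite !inE !perm1.
have /eqP := DE; rewrite hD hE eqn_pmul2l // => /eqP eDE.
have -> : #|[set p : 'I_n * 'I_n | (p.1 < p.2)%N &&
      ((s p.1 < s p.2)%N != (t p.1 < t p.2)%N)]| = #|[set p in D | (p.1 < p.2)%N]|.
  by apply: eq_card => p; rewrite !inE andbC.
rewrite eDE /inversions; apply: eq_card => -[a b]; rewrite !inE /=.
rewrite [RHS]andbC; case: (ltnP a b) => //= ab.
have nab : a != b by apply: contraTneq ab => ->; rewrite ltnn.
by rewrite (@ltn_flip _ (r a)) ?(inj_eq perm_inj) //; case: ltnP.
Qed.

Hypothesis hq : -1 < q < 1.

(* Positivity of the [q]-inner product: (s, t) |-> q ^ inversions (s^-1 t) is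
   the restriction, along the map sending a permutation to its inversion set,
   of a tensor power of the positive definite kernel ((1, q), (q, 1)). *)
Lemma qgram_factorizable n : factorizable (@qgram n).
Proof.
pose P := ('I_n * 'I_n)%type.
pose x (s : 'S_n) (p : P) : bool := (s p.1 < s p.2)%N.
pose B (z y : bool) : R :=
  if z then (if y then Num.sqrt (1 - q ^+ 2) else 0) else (if y then q else 1).
have q21 : 0 <= 1 - q ^+ 2.
  rewrite subr_ge0 -real_normK ?num_real // expr_le1 // ltW // ltr_norml hq //.
have BE y y' : \sum_z B z y * B z y' = if y != y' then q else 1.
  rewrite big_bool /B; case: y; case: y' => /=; rewrite ?(mulr0, mul0r, mulr1, mul1r, add0r) //.
  by rewrite -expr2 sqr_sqrtr // -expr2 subrK.
pose Q := {p : 'I_n * 'I_n | (p.1 < p.2)%N}.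
pose K (s t : 'S_n) : R := q ^+ inversions (s^-1 * t)%g.
have [Z [b KE]] : exists (Z : finType) (b : Z -> 'S_n -> R),
    forall s t, K s t = \sum_z b z s * b z t.
  exists {ffun Q -> bool}.
  exists (fun (z : {ffun Q -> bool}) s => \prod_(p : Q) B (z p) (x s (val p))) => s t.
  under eq_bigr => z _ do rewrite -big_split /=.
  rewrite -(bigA_distr_bigA (fun (p : Q) z => B z (x s (val p)) * B z (x t (val p)))) /=.
  under eq_bigr => p _ do rewrite BE.
  rewrite /K inversions_mul -big_mkcond /= prodr_const; congr (_ ^+ _).
  rewrite -(card_imset _ val_inj); apply: eq_card => p; rewrite !inE.
  apply/idP/imsetP => [/andP[pp H]|[[y yy]]]; first by exists (Sub p pp).
  by rewrite unfold_in /x /= => H ->; rewrite /= yy H.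
pose act (u : n.-tuple 'I_d) (s : 'S_n) : n.-tuple 'I_d := [tuple tnth u (s i) | i < n].
have Kact u v : qgram u v = (n`!%:R)^-1 *
   \sum_s \sum_t K s t * (act u s == act v t)%:R.
  have E s : \sum_t K s t * (act u s == act v t)%:R = qgram u v.
    rewrite (reindex_inj (mulgI s)) /=; apply: eq_bigr => t _.
    rewrite /K mulKg; congr (_ * _).
    have [/eqP e|ne] := boolP (act u s == act v (s * t)%g).
      rewrite big1 // => i _; apply/eqP; rewrite pnatr_eq1 eqb1.
      have := congr1 (fun w => tnth w (s^-1 i)%g) e.
      by rewrite !tnth_mktuple permM permKV => ->.
    apply/esym/eqP/prodf_eq0; have [i Hi] : exists i, tnth u i != tnth v (t i).
      apply/existsP; apply: contraNT ne; rewrite negb_exists => /forallP H.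
      apply/eqP/eq_from_tnth => i; rewrite !tnth_mktuple permM.
      by have := H (s i); rewrite negbK => /eqP.
    by exists i => //; rewrite (negbTE Hi).
  under eq_bigr => s _ do rewrite E.
  rewrite sumr_const card_Sn -[qgram u v *+ _]mulr_natl mulKf //.
exists (n.-tuple 'I_d * Z)%type,
  (fun z u => Num.sqrt (n`!%:R)^-1 * \sum_s b z.2 s * (act u s == z.1)%:R) => u v.
rewrite Kact.
under [RHS]eq_bigr => z _ do rewrite mulrACA -expr2 sqr_sqrtr ?invr_ge0 ?ler0n //.
rewrite -mulr_sumr; congr (_ * _).
rewrite -(pair_bigA _ (fun w z => (\sum_s b z s * (act u s == w)%:R) *
   (\sum_s b z s * (act v s == w)%:R))) /=.
under [RHS]eq_bigr => w _ do under eq_bigr => z _ do rewrite mulr_suml.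
under [RHS]eq_bigr => w _ do rewrite exchange_big.
rewrite [RHS]exchange_big /=; apply: eq_bigr => s _.
under [RHS]eq_bigr => w _ do under eq_bigr => z _ do rewrite mulr_sumr.
under [RHS]eq_bigr => w _ do rewrite exchange_big.
rewrite [RHS]exchange_big /=; apply: eq_bigr => t _.
rewrite KE (bigD1 (act v t)) //= [X in _ = _ + X]big1 ?addr0; last first.
  move=> w wv; apply: big1 => z _.
  by rewrite [act v t == w]eq_sym (negbTE wv) !mulr0.
by rewrite mulr_suml; apply: eq_bigr => z _; rewrite eqxx mulr1 mulrAC.
Qed.

End QGram.

Section GradedHilbertSum.
Variable R : realType.
Local Notation C := R[i].

(* An orthogonal direct sum of finite-dimensional inner product spaces, given
   in coordinates: [gform N f g] is the inner product of the components of [f]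
   and [g] in the [N]-th member of an exhausting increasing sequence of finite
   partial sums.  Only the properties making the square-summable families a
   vector space are recorded; orthogonality and exhaustion hold for the two
   instances below. *)
Record graded_form (W : Type) := GradedForm {
  gform :> nat -> (W -> C) -> (W -> C) -> C;
  gform_linear : forall N a f g h,
    gform N (a *: f + g) h = a * gform N f h + gform N g h;
  gform_conj : forall N f g, gform N g f = conjc (gform N f g);
  gform_ge0 : forall N f, 0 <= gform N f f }.

Variables (W : Type) (K : graded_form W).

Lemma gformDl N f g h : K N (f + g) h = K N f h + K N g h.
Proof. by rewrite -[f in LHS]scale1r gform_linear mul1r. Qed.

Lemma gform0l N h : K N 0 h = 0.
Proof. by apply: (addIr (K N 0 h)); rewrite -gformDl !add0r. Qed.

Lemma gformZl N a f h : K N (a *: f) h = a * K N f h.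
Proof. by rewrite -[a *: f]addr0 gform_linear gform0l addr0. Qed.

Lemma gformDr N f g h : K N h (f + g) = K N h f + K N h g.
Proof.
by rewrite gform_conj gformDl [RHS]addrC (gform_conj _ _ f) (gform_conj _ _ g)
  addrC -raddfD.
Qed.

Lemma gformZr N a f h : K N h (a *: f) = conjc a * K N h f.
Proof. by rewrite gform_conj gformZl conjcM -gform_conj. Qed.

Lemma gform_parallelogram N f g :
  K N (f + g) (f + g) <= (K N f f + K N g g) *+ 2.
Proof.
have -> : (K N f f + K N g g) *+ 2 =
    K N (f + g) (f + g) + K N (f - g) (f - g).
  rewrite -scaleN1r !gformDl !gformDr !gformZl !gformZr.
  have -> : conjc (-1 : C) = -1 by apply/eqP; rewrite eq_complex /= !oppr0 !eqxx.
  rewrite !mulN1r opprK mulr2n !addrA; ring.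
by rewrite lerDl gform_ge0.
Qed.

(* The Hilbert space direct sum: the families whose norms are
   square-summable. *)
Definition square_summable : {pred W -> C} :=
  fun f => `[< exists M : R, forall N, K N f f <= M%:C >].

Lemma square_summable_submod_closed : GRing.submod_closed square_summable.
Proof.
split=> [|a f g /asboolP[M HM] /asboolP[M' HM']].
  by apply/asboolP; exists 0 => N; rewrite gform0l.
apply/asboolP; exists (((complex.Re (a * conjc a)) * M + M') *+ 2) => N.
have aE : (complex.Re (a * conjc a))%:C = a * conjc a.
  by rewrite RRe_real // ger0_real // mulcJ_ge0.
apply: (le_trans (gform_parallelogram _ _ _)).
rewrite rmorphMn lerMn2r orbC rmorphD lerD //.
by rewrite rmorphM [X in _ <= X * _]aE gformZl gformZr mulrA ler_wpM2l // mulcJ_ge0.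
Qed.

HB.instance Definition _ := GRing.isSubmodClosed.Build C (W -> C)
  square_summable square_summable_submod_closed.

Record hilbert_sum := HilbertSum {
  coords :> W -> C;
  coords_summable : coords \in square_summable }.

HB.instance Definition _ := [isSub for coords].
HB.instance Definition _ := [Choice of hilbert_sum by <:].
HB.instance Definition _ := [SubChoice_isSubLmodule of hilbert_sum by <:].

(* The limit is taken on real and imaginary parts, as R[i] does not carry the
   topology needed by [limn]. *)
Definition inner (x y : hilbert_sum) : C :=
  Complex (limn (fun N => complex.Re (K N x y)))
          (limn (fun N => complex.Im (K N x y))).

Definition hnorm (x : hilbert_sum) : R := Num.sqrt (complex.Re (inner x x)).

End GradedHilbertSum.

Section Operators.
Variables (R : realType) (W : Type) (K : graded_form R W).
Local Notation H := (hilbert_sum K).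

(* Operators are plain functions.  The adjoint, the creation operators and the
   tensor products of operators below are each selected as the bounded operator
   determined by its defining property; [fun=> 0] is a junk default. *)
Definition bounded_operator (A : H -> H) : Prop :=
  linear A /\ exists M : R, forall x, hnorm (A x) <= M * hnorm x.

Definition is_adjoint (A B : H -> H) : Prop :=
  forall x y, inner (A x) y = inner x (B y).

Definition adjoint (A : H -> H) : H -> H :=
  xget (fun=> 0) [set B | bounded_operator B /\ is_adjoint A B]%classic.

Definition vector_state (x : H) (A : H -> H) : R[i] := inner (A x) x.

Definition compactly_supported (mu : probability R R) : Prop :=
  exists2 S : set R, compact S & mu (~` S)%classic = 0%E.

Definition is_distribution (phi : (H -> H) -> R[i]) (X : H -> H)
    (mu : probability R R) : Prop :=
  [/\ bounded_operator X, is_adjoint X X, compactly_supported mu &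
    forall n, (0 < n)%N -> (\int[mu]_x (x ^+ n))%:C = phi (iter n X)].

End Operators.

Section QFock.
Variables (R : realType) (d : nat) (q : R) (hq : -1 < q < 1).
Local Notation C := R[i].
Local Notation word := (seq 'I_d).

(* A word [w] stands for the basis tensor e_(w 1) (x) ... (x) e_(w n) of the
   [n]-th tensor power of C^d, with [n = size w]; the empty word is the vacuum. *)
Definition fock_partial (N : nat) (f g : word -> C) : C :=
  \sum_(n < N) gram_sum (@qgram _ _ q n)
    (fun u : n.-tuple 'I_d => f u) (fun v : n.-tuple 'I_d => g v).

(* The Hilbert space tensor square of the Fock space, as the orthogonal direct
   sum over (n, m) of the tensor products of the [n]-th and [m]-th summands; the
   inner product of elementary tensors is computed in [fock2_partial_tensor]. *)
Definition fock2_partial (N : nat) (f g : word * word -> C) : C :=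
  \sum_(n < N) \sum_(m < N)
    gram_sum (fun u v : n.-tuple 'I_d * m.-tuple 'I_d =>
        qgram q u.1 v.1 * qgram q u.2 v.2)
      (fun u => f (tval u.1, tval u.2)) (fun v => g (tval v.1, tval v.2)).

Fact fock_partial_linear N a f g h :
  fock_partial N (a *: f + g) h = a * fock_partial N f h + fock_partial N g h.
Proof.
rewrite /fock_partial mulr_sumr -big_split; apply: eq_bigr => n _ /=.
exact: gram_sum_linear.
Qed.

Fact fock_partial_conj N f g : fock_partial N g f = conjc (fock_partial N f g).
Proof.
rewrite /fock_partial conjc_sum; apply: eq_bigr => n _.
exact/gram_sum_conj/factorizable_sym/qgram_factorizable.
Qed.

Fact fock_partial_ge0 N f : 0 <= fock_partial N f f.
Proof.
by apply: sumr_ge0 => n _; apply/gram_sum_ge0/qgram_factorizable.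
Qed.

Fact fock2_partial_linear N a f g h : fock2_partial N (a *: f + g) h =
  a * fock2_partial N f h + fock2_partial N g h.
Proof.
rewrite /fock2_partial mulr_sumr -big_split; apply: eq_bigr => n _ /=.
rewrite mulr_sumr -big_split; apply: eq_bigr => m _ /=.
exact: gram_sum_linear.
Qed.

Fact fock2_partial_conj N f g :
  fock2_partial N g f = conjc (fock2_partial N f g).
Proof.
rewrite /fock2_partial conjc_sum; apply: eq_bigr => n _.
rewrite conjc_sum; apply: eq_bigr => m _.
by apply/gram_sum_conj/factorizable_sym/factorizable_prod;
  apply: qgram_factorizable.
Qed.

Fact fock2_partial_ge0 N f : 0 <= fock2_partial N f f.
Proof.
apply: sumr_ge0 => n _; apply: sumr_ge0 => m _; apply/gram_sum_ge0.
by apply/factorizable_prod; apply: qgram_factorizable.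
Qed.

Definition fock_form :=
  GradedForm fock_partial_linear fock_partial_conj fock_partial_ge0.
Definition fock2_form :=
  GradedForm fock2_partial_linear fock2_partial_conj fock2_partial_ge0.

Definition qfock := hilbert_sum fock_form.
Definition qfock2 := hilbert_sum fock2_form.

(* The coordinates of v_1 (x) ... (x) v_n, for [s = [:: v_1; ...; v_n]]. *)
Fixpoint pure_coords (s : seq 'rV[C]_d) (w : word) : C :=
  match s, w with
  | [::], [::] => 1
  | v :: s', j :: w' => v 0 j * pure_coords s' w'
  | _, _ => 0
  end.

Lemma pure_coords0 s w : size s != size w -> pure_coords s w = 0.
Proof.
by elim: s w => [|v s IH] [|j w] //= /IH ->; rewrite mulr0.
Qed.

Lemma pure_coords_prod n (s : n.-tuple 'rV[C]_d) (w : n.-tuple 'I_d) :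
  pure_coords s w = \prod_i tnth s i 0 (tnth w i).
Proof.
elim: n s w => [|n IH] s w; first by rewrite tuple0 (tuple0 w) big_ord0.
case/tupleP: s => v s; case/tupleP: w => j w.
rewrite big_ord_recl !tnth0 /= IH; congr (_ * _).
by apply: eq_bigr => i _; rewrite !tnthS.
Qed.

Lemma gram_sum_pure n (v w : n.-tuple 'rV[C]_d) :
  gram_sum (@qgram _ _ q n) (fun u => pure_coords v u) (fun u => pure_coords w u)
  = \sum_(t : 'S_n) (q ^+ inversions t)%:C *
      \prod_i \sum_(j < d) tnth v i 0 j * conjc (tnth w (t i) 0 j).
Proof.
rewrite /gram_sum exchange_big /=.
under eq_bigr => u' _ do under eq_bigr => u _ do
  rewrite /qgram (rmorph_sum (real_complex R)) mulr_sumr.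
under eq_bigr => u' _ do rewrite exchange_big /=.
rewrite exchange_big /=; apply: eq_bigr => t _.
rewrite bigA_distr_bigA /= mulr_sumr.
pose F (f : {ffun 'I_n -> 'I_d}) : n.-tuple 'I_d := [tuple f (t^-1 i)%g | i < n].
rewrite (reindex F) /=; last first.
  exists (fun u : n.-tuple 'I_d => [ffun i => tnth u (t i)]) => [f _|u _].
    by apply/ffunP => i; rewrite ffunE tnth_mktuple permK.
  by apply: eq_from_tnth => i; rewrite tnth_mktuple ffunE permKV.
apply: eq_bigr => f _.
rewrite (bigD1 [tuple f i | i < n]) //= [X in _ + X]big1 ?addr0; last first.
  move=> u uf; suff -> : \prod_i (tnth u i == tnth (F f) (t i))%:R = 0 :> R.
    by rewrite mulr0 mulr0.
  apply/eqP/prodf_eq0; have [i Hi] : exists i, tnth u i != f i.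
    apply/existsP; apply: contraNT uf; rewrite negb_exists => /forallP H.
    apply/eqP/eq_from_tnth => i; rewrite tnth_mktuple.
    by have := H i; rewrite negbK => /eqP.
  by exists i => //; rewrite tnth_mktuple permK (negbTE Hi).
rewrite [X in _ * (_ * X)%:C]big1 ?mulr1; last first.
  by move=> i _; rewrite !tnth_mktuple permK eqxx.
rewrite mulrC (pure_coords_prod v [tuple f i | i < n]) (pure_coords_prod w (F f)).
congr (_ * _).
rewrite (rmorph_prod (@conjc R)) [X in _ * X](reindex_inj (@perm_inj _ t)) /=.
rewrite -big_split /=; apply: eq_bigr => i _.
by rewrite !tnth_mktuple permK.
Qed.

Fact pure_summable s : pure_coords s \in square_summable fock_form.
Proof.
pose F n := gram_sum (@qgram _ _ q n)
   (fun u : n.-tuple 'I_d => pure_coords s u) (fun u => pure_coords s u).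
apply/asboolP; exists (complex.Re (F (size s))) => N.
have F0 n : n != size s -> F n = 0.
  move=> ns; rewrite /F /gram_sum big1 // => u _; rewrite big1 // => v _.
  by rewrite pure_coords0 ?mul0r // size_tuple eq_sym.
have FR : (complex.Re (F (size s)))%:C = F (size s).
  rewrite RRe_real // ger0_real //.
  exact/gram_sum_ge0/qgram_factorizable.
rewrite FR /= /fock_partial -/F; case: (ltnP (size s) N) => sN.
  by rewrite (bigD1 (Ordinal sN)) //= big1 ?addr0 // => n nE; apply: F0.
rewrite big1; first exact/gram_sum_ge0/qgram_factorizable.
by move=> n _; apply: F0; rewrite ltn_eqF // (leq_trans (ltn_ord n)).
Qed.

Definition pure (s : seq 'rV[C]_d) : qfock := HilbertSum (pure_summable s).

Lemma fock2_partial_tensor N (x y x' y' : word -> C) :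
  fock2_partial N (fun w => x w.1 * y w.2) (fun w => x' w.1 * y' w.2) =
  fock_partial N x x' * fock_partial N y y'.
Proof.
rewrite /fock2_partial /fock_partial big_distrlr /=; apply: eq_bigr => n _.
apply: eq_bigr => m _; rewrite /gram_sum big_distrlr /= [RHS]pair_bigA /=.
apply: eq_bigr => u _; rewrite big_distrlr /= [RHS]pair_bigA /=.
apply: eq_bigr => v _; rewrite conjcM rmorphM /=; ring.
Qed.

Fact tensor_summable (x y : qfock) :
  (fun w : word * word => x w.1 * y w.2) \in square_summable fock2_form.
Proof.
have /asboolP[M HM] := coords_summable x; have /asboolP[M' HM'] := coords_summable y.
apply/asboolP; exists (M * M') => N /=; rewrite fock2_partial_tensor rmorphM.
by rewrite ler_pM // fock_partial_ge0.
Qed.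

Definition tensor (x y : qfock) : qfock2 := HilbertSum (tensor_summable x y).

Definition tensor_operator (A B : qfock -> qfock) : qfock2 -> qfock2 :=
  xget (fun=> 0) [set Z | bounded_operator Z /\
    forall x y, Z (tensor x y) = tensor (A x) (B y)]%classic.

Definition vacuum : qfock := pure [::].

(* [s = [::]] is the condition L_i xi_vac = e_i. *)
Definition creation (i : 'I_d) : qfock -> qfock :=
  xget (fun=> 0) [set A | bounded_operator A /\
    forall s, A (pure s) = pure (delta_mx 0 i :: s)]%classic.

Definition field_op (i : 'I_d) : qfock -> qfock :=
  creation i + adjoint (creation i).

Definition X_sum : qfock2 -> qfock2 :=
  \sum_(i < d) tensor_operator (field_op i) (field_op i).

Definition X_operator : qfock2 -> qfock2 := X_sum \o X_sum.

Definition vacuum_state2 := vector_state (tensor vacuum vacuum).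

End QFock.

Definition Ptilde (R : realType) (n : nat) (t u : R) : R :=
  \sum_(1 <= k < n.+1) \sum_(0 <= l < (n ^ 2 - n).+1)
    (meandric_count n k l)%:R * t ^+ k * u ^+ l.

(* Main.v *)
(* The operator X is the square of S = sum_i Y_i (x) Y_i with Y_i = L_i + L_i^*,
   so its n-th moment is a sum, over the words i_1 ... i_2n, of the squares of the
   vacuum moments <Y_(i_1) ... Y_(i_2n) xi, xi>.  By the q-Wick formula each of
   these is the sum of q^cr(pi) over the pair partitions pi along which the word
   is constant; expanding the squares and counting the words constant on the
   blocks of both pi and sigma, namely d^|pi \/ sigma|, gives the polynomial.

   In coordinates indexed by words, (L_i^* f)(w) is the sum over k of q^k times
   the value of f at w with the letter i inserted at position k.  The relation
   L_i^* L_i = 1 + q L_i L_i^* bounds the norm of L_i on each summand, and the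
   strict positivity of the kernel q^inversions(s^-1 t) makes bounded operators on
   the Fock space determined by their values on elementary tensors; this
   identifies the operators of the statement.

   The measure comes from the Hausdorff moment problem: for T = X/M with
   0 <= T <= 1 the numbers <T^k (1 - T)^j xi, xi> are nonnegative, hence the
   masses C(n,k) <T^k (1 - T)^(n-k) xi, xi> at k/n are probability measures whose
   moments converge to those of T; their distribution functions converge along
   an ultrafilter, and the right-continuous regularization of the limit defines
   a Lebesgue-Stieltjes measure. *)
Require Import Defs.
From HB Require Import structures.
From mathcomp Require Import all_boot all_order all_algebra all_fingroup.
From mathcomp Require Import zify reals.
Set Implicit Arguments.
Unset Strict Implicit.
Unset Printing Implicit Defensive.
Import GRing.Theory.

(** * Pairings and the q-Wick formula *)

(** Operators act on arbitrary functions of words, square-summable or not. [field_step] makes sense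
    over any commutative ring, so the q-Wick formula is pure combinatorics, and analysis enters
    through bounds on the finite partial forms, which turn coordinate maps into bounded operators.
    As the operators of the statement are selected by [xget], each needs an existence proof, by an
    explicit coordinate map, and a uniqueness proof.

    In the Wick formula the obstacle is that a partial product of field operators leaves letters
    uncontracted. Partial pairings are therefore encoded as involutions whose fixed points are the
    uncontracted letters, and crossings are extended to them so that each contraction multiplies the
    weight by exactly its own power of q.

    For the measure the obstacle is the positivity of the mixed moments of T and 1 - T. It needs
    neither a spectral theorem nor a square root of 1 - T, because X is the square of a selfadjoint
    operator commuting with 1 - T: half of its factors can be moved to the other side of the inner
    product. *)

Section InvolutionCrossings.
Local Open Scope nat_scope.
Variable m : nat.
Implicit Types (f : 'S_m) (k b x : 'I_m).

(* A fixed point [x] stands for a strand that is still open and leaves to the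
   left, so that it meets every arc (a, f a) with a < x < f a. *)
Definition crossing_pairs f := [set p : 'I_m * 'I_m |
  [&& p.1 < p.2, p.2 < f p.1 & (f p.2 == p.2) || (f p.1 < f p.2)]].

Definition involution_from (n : nat) f :=
  [forall x, (f (f x) == x) && ((x < n) ==> (f x == x))].

Lemma involution_fromP n f :
  reflect ((forall x, f (f x) = x) /\ (forall x, x < n -> f x = x))
    (involution_from n f).
Proof.
apply: (iffP forallP) => [H|[H1 H2] x]; last first.
  by rewrite H1 eqxx; apply/implyP => /H2 ->.
by split=> x; have /andP[/eqP H1 /implyP H2] := H x => // /H2/eqP.
Qed.

Lemma mul_tpermE k b f x : f k = k -> f b = b ->
  (tperm k b * f)%g x = if x == k then b else if x == b then k else f x.
Proof.
move=> fk fb; rewrite permM; case: tpermP => [->|->|].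
- by rewrite eqxx.
- by rewrite eqxx fk; case: eqVneq.
- by move=> /eqP/negPf -> /eqP/negPf ->.
Qed.

(** The new arc joins [k], left of every arc of [f], to the open strand [b]. A crossing (a, b) of an
    arc with that strand becomes the crossing (k, a) with the new arc, which is what [g] records;
    the only further crossings are with the strands still open between [k] and [b], listed by
    [h]. *)
Lemma card_crossing_pairs_tperm k b f : k < b ->
  involution_from k.+1 f -> f b = b ->
  #|crossing_pairs (tperm k b * f)| =
    #|crossing_pairs f| + #|[set x : 'I_m | (k < x < b) && (f x == x)]|.
Proof.
move=> kb /involution_fromP[ff fle] fb.
have fk : f k = k by apply: fle.
pose g (p : 'I_m * 'I_m) := if p.2 == b then (k, p.1) else p.
pose h (x : 'I_m) := (k, x).
have E (x : 'I_m) := mul_tpermE x fk fb.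
have fgt (x y : 'I_m) : y < f x -> x <= y -> k < x.
  by move=> yx xy; rewrite ltnNge; apply/negP => /fle fx; move: yx; rewrite fx; lia.
have nk (x : 'I_m) : (k < x) -> (x == k) = false by rewrite -val_eqE /=; lia.
have gi : {in crossing_pairs f &, injective g}.
  move=> [a x] [a' x']; rewrite !inE /= => /and3P[ax xa _] /and3P[ax' xa' _].
  have ka := fgt _ _ xa (ltnW ax); have ka' := fgt _ _ xa' (ltnW ax').
  rewrite /g /=; case: eqP => [->|_]; case: eqP => [->|_] //.
  - by move=> [] ->.
  - by move=> [] E1 _; move: ka'; rewrite -E1; lia.
  - by move=> [] E1 _; move: ka; rewrite E1; lia.
have hi : injective h by move=> x y [].
rewrite -(card_in_imset gi) -(card_imset _ hi) -cardsUI.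
rewrite [X in _ = _ + #|pred_of_set X|](_ : _ = set0) ?cards0 ?addn0; last first.
  apply/setP => p; rewrite in_setI in_set0; apply/negP => /andP[/imsetP[[a x]]].
  rewrite inE /= => /and3P[ax xa H] -> /imsetP[y]; rewrite inE => /andP[/andP[ky yb] /eqP fy].
  have ka := fgt _ _ xa (ltnW ax).
  rewrite /g /h /=; case: eqP => [xb [] ay|xb [] ak _].
    by move: xa; rewrite ay fy; rewrite xb; lia.
  by move: ka; rewrite ak; lia.
congr #|pred_of_set _|; apply/setP => -[a x]; rewrite inE /= in_setU; apply/idP/orP.
  move=> /and3P[ax]; rewrite !E.
  have [ak|ak] := eqVneq a k.
    subst a; have xk := nk x ax; rewrite xk => xb.
    have xbF : (x == b) = false by rewrite -val_eqE /=; lia.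
    rewrite xbF => /orP[fx|fx].
      by right; apply/imsetP; exists x; rewrite ?inE ?ax ?xb.
    left; apply/imsetP; exists (x, b); last by rewrite /g /= eqxx.
    by rewrite !inE /= xb fx fb eqxx.
  have [ab|ab] := eqVneq a b.
    by subst a; move=> xk; lia.
  move=> xa; have ka := fgt _ _ xa (ltnW ax).
  have xk : (x == k) = false by apply: nk; lia.
  rewrite xk; have [xb|xb] := eqVneq x b.
    subst x; case/orP => [|H]; last by lia.
    by rewrite -val_eqE /=; lia.
  move=> H; left; apply/imsetP; exists (a, x); rewrite ?inE /= ?ax ?xa ?H //.
  by rewrite /g /= (negPf xb).
case=> /imsetP[].
  move=> [a' x']; rewrite !inE /= => /and3P[ax xa H].
  have ka := fgt _ _ xa (ltnW ax).
  rewrite /g /=; case: eqP => [xb|xb] [-> ->].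
    subst x'; rewrite !E eqxx (nk _ ka).
    have abF : (a' == b) = false by rewrite -val_eqE /=; lia.
    by rewrite abF ka ax xa orbT.
  have abF : (a' == b) = false.
    by apply/negP => /eqP ab; move: xa; rewrite ab fb; move: ax; rewrite ab; lia.
  have xk : (x' == k) = false by apply: nk; lia.
  rewrite !E abF xk (nk _ ka); move/eqP: xb => /negPf ->.
  by rewrite ax xa H.
move=> y; rewrite inE => /andP[/andP[ky yb] /eqP fy] [-> ->].
have yk := nk _ ky; have ybF : (y == b) = false by rewrite -val_eqE /=; lia.
by rewrite !E eqxx yk ybF ky yb fy eqxx.
Qed.

(** Drawing or erasing the arc (k, b) is the bijection behind the recursion on partial pairings. *)
Lemma involution_from_tperm k b f : k < b ->
  (involution_from k (tperm k b * f) && ((tperm k b * f)%g k == b)) =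
  (involution_from k.+1 f && (f b == b)).
Proof.
move=> kb; have nbk : (b == k) = false by rewrite -val_eqE /=; lia.
apply/andP/andP => -[/involution_fromP[ff fle] /eqP fb].
  move: fb; rewrite permM tpermL => fb.
  have fk : f k = k.
    by have := ff k; rewrite !permM tpermL fb tpermR.
  rewrite fb eqxx; split=> //; apply/involution_fromP; split=> x.
    have [->|xk] := eqVneq x k; first by rewrite !fk.
    have [->|xb] := eqVneq x b; first by rewrite !fb.
    have := ff x; rewrite !mul_tpermE // (negPf xk) (negPf xb).
    case: eqVneq => [_ E|_]; first by rewrite E eqxx in xb.
    by case: eqVneq => // _ E; rewrite E eqxx in xk.
  rewrite ltnS leq_eqVlt => /orP[/eqP xk|xk].
    by have -> : x = k by apply/val_inj.
  have := fle x xk; rewrite mul_tpermE //.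
  have -> : (x == k) = false by rewrite -val_eqE /=; lia.
  by have -> : (x == b) = false by rewrite -val_eqE /=; lia.
have fk : f k = k by apply: fle.
rewrite mul_tpermE // eqxx; split=> //; apply/involution_fromP; split=> x.
  rewrite !mul_tpermE //; have [->|xk] := eqVneq x k; first by rewrite nbk eqxx.
  have [->|xb] := eqVneq x b; first by rewrite eqxx.
  have -> : (f x == k) = false by rewrite -[k]fk (inj_eq perm_inj) (negPf xk).
  by have -> : (f x == b) = false by rewrite -[b]fb (inj_eq perm_inj) (negPf xb).
move=> xk; rewrite mul_tpermE //.
have -> : (x == k) = false by rewrite -val_eqE /=; lia.
have -> : (x == b) = false by rewrite -val_eqE /=; lia.
by apply: fle; lia.
Qed.

End InvolutionCrossings.

(** * Field operators on words and the expansion over partial pairings *)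

Section QWick.
Local Open Scope ring_scope.
Variables (R : comNzRingType) (q : R).

Definition insert_at (T : Type) (k : nat) (x : T) (s : seq T) : seq T :=
  take k s ++ x :: drop k s.

Section Steps.
Variable T : eqType.
Implicit Types (i : T) (v : seq T -> R) (w : seq T).

Definition create i v w : R :=
  if w is j :: w' then (j == i)%:R * v w' else 0.

(* Contracting [e_i] with the [k]-th tensor factor costs [q ^+ k]. *)
Definition annihilate i v w : R :=
  \sum_(k < (size w).+1) q ^+ k * v (insert_at k i w).

Definition field_step i v w : R := create i v w + annihilate i v w.

(** Contracting [i] at position [k] amounts to removing the [k]-th open strand: [insert_at k i w]
    spells the letters of [o] exactly when that strand carries [i] and the others spell [w]. If the
    lengths do not match, both sides vanish. *)
Lemma map_rem_index (U : eqType) (s : U -> T) i (o : seq U) w : uniq o ->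
  \sum_(b <- o) q ^+ index b o *
     ((s b == i) && ([seq s x | x <- rem b o] == w))%:R =
  \sum_(k < (size w).+1) q ^+ k * ([seq s x | x <- o] == insert_at k i w)%:R.
Proof.
move=> uo; case: o uo => [|b0 o'].
  rewrite big_nil => _; rewrite big1 // => k _.
  by rewrite /insert_at; case: (take k w) => [|? ?]; rewrite mulr0.
set o := b0 :: o' => uo.
rewrite (big_nth b0) big_mkord.
have sz b : (b < size o)%N -> size (rem (nth b0 o b) o) = (size o).-1.
  by move=> bo; rewrite size_rem ?mem_nth.
have [ow|ow] := eqVneq (size o) (size w).+1; last first.
  rewrite [LHS]big1 => [|b _]; last first.
    rewrite (_ : _ && _ = false) ?mulr0 //; apply/andP => -[_ /eqP E].
    by move: ow; rewrite -E size_map sz // eqxx.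
  rewrite big1 // => b _; rewrite (_ : _ == _ = false) ?mulr0 //.
  apply/negP => /eqP /(congr1 size); rewrite size_map size_cat /= addnS -size_cat cat_take_drop.
  by move/eqP; rewrite (negPf ow).
rewrite ow; apply: eq_bigr => b _.
have bo : (b < size o)%N by rewrite ow.
rewrite index_uniq //; congr (_ * (nat_of_bool _)%:R).
rewrite remE index_uniq // /insert_at map_cat.
have oE : [seq s x | x <- o] = [seq s x | x <- take b o] ++
    s (nth b0 o b) :: [seq s x | x <- drop b.+1 o].
  by rewrite -[in LHS](cat_take_drop b o) map_cat (drop_nth b0).
have st : size [seq s x | x <- take b o] = size (take b w).
  by rewrite size_map !size_take ow ltn_ord; case: ltnP => //; have := ltn_ord b; lia.
rewrite [in RHS]oE eqseq_cat // eqseq_cons andbCA; congr (_ && _).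
by rewrite -(eqseq_cat _ _ st) cat_take_drop.
Qed.

End Steps.

Definition wick_vacuum (T : Type) (w : seq T) : R := (nilp w)%:R.

Variables (m : nat) (T : eqType) (s : 'I_m -> T).
Implicit Types (f : 'S_m) (k b x : 'I_m) (n : nat).

Definition opens n f : seq 'I_m :=
  [seq x : 'I_m <- enum 'I_m | (n <= x)%N && (f x == x)].

Definition compatible f := [forall x, s (f x) == s x].

Lemma opens_uniq n f : uniq (opens n f).
Proof. exact/filter_uniq/enum_uniq. Qed.

Lemma mem_opens n f x : (x \in opens n f) = (n <= x)%N && (f x == x).
Proof. by rewrite mem_filter mem_enum andbT. Qed.

Lemma opens_sorted n f : sorted (relpre val ltn) (opens n f).
Proof.
apply: sorted_filter => [x y z|]; first exact: ltn_trans.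
by rewrite -sorted_map val_enum_ord iota_ltn_sorted.
Qed.

Lemma opensS k f : f k = k -> opens k f = k :: opens k.+1 f.
Proof.
move=> fk; apply: (@irr_sorted_eq _ (relpre val ltn)) => [x y z|x||/=|x].
- exact: ltn_trans.
- exact: ltnn.
- exact: opens_sorted.
- rewrite path_min_sorted ?opens_sorted //; apply/allP => x.
  by rewrite mem_opens => /andP[].
- rewrite inE !mem_opens leq_eqVlt eq_sym.
  by have [->|] := eqVneq x k; rewrite ?fk ?eqxx // -val_eqE => /negPf ->.
Qed.

Lemma opens_tperm k b f : (k < b)%N -> involution_from k.+1 f -> f b = b ->
  opens k (tperm k b * f) = rem b (opens k.+1 f).
Proof.
move=> kb /involution_fromP[_ fle] fb; rewrite rem_filter ?opens_uniq //.
rewrite -filter_predI; apply: eq_filter => x /=.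
rewrite mul_tpermE ?(fle k) //.
have bk : (b == k) = false by rewrite -val_eqE /=; lia.
have [->|xk] := eqVneq x k; first by rewrite bk ltnn !andbF.
have [->|xb] := eqVneq x b; first by rewrite eq_sym bk andbF.
by rewrite /=; congr (_ && _); move: xk; rewrite -val_eqE /=; lia.
Qed.

Lemma index_sorted_ord (o : seq 'I_m) b : sorted (relpre val ltn) o ->
  b \in o -> index b o = size [seq x : 'I_m <- o | (x < b)%N].
Proof.
move=> srt bo; have ltT : transitive (relpre (@nat_of_ord m) ltn).
  by move=> ? ? ?; apply: ltn_trans.
have oE : o = [seq x : 'I_m <- o | (x < b)%N] ++
    b :: [seq x : 'I_m <- o | (b < x)%N].
  apply: (@irr_sorted_eq _ (relpre val ltn)) => [|x|||x] //.
  - exact: ltnn.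
  - rewrite sorted_pairwise // pairwise_cat /= -!sorted_pairwise //.
    have so P : sorted (relpre (@nat_of_ord m) ltn) [seq x <- o | P x].
      by apply: sorted_filter.
    rewrite !so andbT /=.
    apply/andP; split; last by apply/allP => x; rewrite mem_filter => /andP[].
    apply/allrelP => x y; rewrite inE !mem_filter => /andP[xb _].
    by case/orP => [/eqP -> //|/andP[yb _]]; apply: ltn_trans yb.
  - rewrite mem_cat inE !mem_filter; have [->|] := eqVneq x b.
      by rewrite bo orbT.
    by rewrite -val_eqE /=; case: ltngtP => //=; rewrite orbF.
by rewrite [in LHS]oE index_cat mem_filter ltnn /= eqxx addn0.
Qed.

(** The position of [b] among the open strands is the number of strands the new arc has to cross, so
    the factor [q ^+ k] of [annihilate] agrees with the count in [card_crossing_pairs_tperm]. *)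
Lemma index_opens k b f : (k < b)%N -> f b = b ->
  index b (opens k.+1 f) = #|[set x : 'I_m | (k < x < b)%N && (f x == x)]|.
Proof.
move=> kb fb; rewrite index_sorted_ord ?opens_sorted //; last first.
  by rewrite mem_opens kb fb eqxx.
rewrite /opens cardE /enum_mem -!filter_predI; congr size; apply: eq_filter => x.
by rewrite [RHS]inE /= andbT; case: (x < b)%N; rewrite ?andbT ?andbF.
Qed.

Lemma compatible_tperm k b f : f k = k -> f b = b ->
  compatible (tperm k b * f) = compatible f && (s b == s k).
Proof.
move=> fk fb; apply/forallP/andP => [H|[/forallP H /eqP sbk] x]; last first.
  rewrite mul_tpermE //; have [->|_] := eqVneq x k; first by rewrite sbk.
  by have [->|_] := eqVneq x b; rewrite ?sbk.
split; last by have := H k; rewrite mul_tpermE // eqxx.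
apply/forallP => x; have := H x; rewrite mul_tpermE //.
have [->|_] := eqVneq x k; first by rewrite fk.
by have [->|_ //] := eqVneq x b; rewrite fb.
Qed.

(** Coordinates of Y_(s n) ... Y_(s (m-1)) applied to the vacuum. *)
Definition suffix_vector n : seq T -> R :=
  foldr (@field_step T) (@wick_vacuum T) [seq s x | x <- drop n (enum 'I_m)].

Definition pairing_weight n f w : R :=
  q ^+ #|crossing_pairs f| * (compatible f && ([seq s x | x <- opens n f] == w))%:R.

(** Induction from the right end of the word. The letter at [k] is either created, so that [k]
    becomes an open strand, or contracted with one of the open strands [b] to its right. *)
Lemma suffix_vectorE n w : (n <= m)%N ->
  suffix_vector n w = \sum_(f | involution_from n f) pairing_weight n f w.
Proof.
move=> nm; rewrite -(subKn nm); elim: (m - n)%N (leq_subr n m) w => {n nm}[_ w|j IH jm w].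
  rewrite subn0 /suffix_vector drop_oversize ?size_enum_ord //= (big_pred1 1%g) => [|f].
    have c1 : crossing_pairs (1%g : 'S_m) = finset.set0.
      by apply/setP => p; rewrite !inE perm1; case: ltngtP; rewrite ?andbF.
    have o1 : opens m 1 = [::].
      apply/eqP; rewrite -size_eq0 size_filter -leqn0 leqNgt -has_count.
      by apply/hasPn => x _; rewrite negb_and -ltnNge ltn_ord.
    have s1 : compatible 1 by apply/forallP => x; rewrite perm1.
    by rewrite /pairing_weight c1 o1 s1 cards0 expr0 mul1r; case: w.
  apply/involution_fromP/eqP => [[_ H]|->]; last by split=> x *; rewrite !perm1.
  by apply/permP => x; rewrite perm1 H.
have jm' : (j <= m)%N by apply: ltnW.
have nm : (m - j.+1 < m)%N by lia.
pose k := Ordinal nm; have nE : (m - j = k.+1)%N by rewrite /=; lia.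
rewrite -[(m - j.+1)%N]/(val k); move: k nE => k nE {nm}.
have V u := IH jm' u; rewrite nE in V.
have -> : suffix_vector k w = field_step (s k) (suffix_vector k.+1) w.
  by rewrite /suffix_vector (drop_nth k) ?size_enum_ord // nth_ord_enum.
rewrite /field_step (bigID (fun f : 'S_m => f k == k)) /=; congr (_ + _).
  rewrite (eq_bigl (involution_from k.+1)) => [|f]; last first.
    apply/andP/involution_fromP => [[/involution_fromP[ff fle] /eqP fk]|[ff fle]].
      split=> // x; rewrite ltnS leq_eqVlt => /orP[/eqP xk|/fle //].
      by rewrite (_ : x = k) //; apply/val_inj.
    split; last by rewrite fle.
    by apply/involution_fromP; split=> // x xk; apply: fle; apply: ltnW.
  case: w => [|i w] /=.
    rewrite big1 // => f /involution_fromP[_ fle].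
    by rewrite /pairing_weight opensS ?fle //= andbF mulr0.
  rewrite V mulr_sumr; apply: eq_bigr => f /involution_fromP[_ fle].
  rewrite /pairing_weight opensS ?fle //= eqseq_cons eq_sym.
  by rewrite mulrCA -natrM mulnb andbCA.
rewrite (partition_big (fun f : 'S_m => f k) (fun b => k < b)%N) => [|f] /=; last first.
  case/andP => /involution_fromP[ff fle] fk; rewrite ltnNge leq_eqVlt.
  apply/negP => /orP[/eqP/val_inj|/fle]; first by move/eqP; rewrite (negPf fk).
  by move/perm_inj/eqP; rewrite (negPf fk).
pose F f b := q ^+ #|crossing_pairs f| * (compatible f)%:R * (q ^+ index b (opens k.+1 f) *
  ((s b == s k) && ([seq s x | x <- rem b (opens k.+1 f)] == w))%:R).
transitivity (\sum_(b : 'I_m | (k < b)%N)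
    \sum_(f | involution_from k.+1 f && (f b == b)) F f b); last first.
  (* Composing with the transposition erases the arc (k, b): involutions pairing [k] with [b] become
     those fixing both. *)
  apply: eq_bigr => b kb; rewrite [RHS](reindex_inj (mulgI (tperm k b))) /=.
  apply: eq_big => [f|f /andP[If /eqP fb]].
    rewrite -involution_from_tperm // -andbA; congr (_ && _).
    have [->|_] := eqVneq ((tperm k b * f)%g k) b; rewrite ?andbF //.
    by rewrite -val_eqE /= andbT gtn_eqF.
  have fk : f k = k by case/involution_fromP: If => _; apply.
  rewrite /F /pairing_weight card_crossing_pairs_tperm // opens_tperm //.
  rewrite compatible_tperm // index_opens // exprD -!mulnb !natrM.
  by rewrite !mulrA; congr (_ * _ * _); rewrite mulrAC.
rewrite (exchange_big_dep (involution_from k.+1)) /=; last by move=> ? ? _ /andP[].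
rewrite /annihilate.
have -> : \sum_(l < (size w).+1) q ^+ l * suffix_vector k.+1 (insert_at l (s k) w) =
    \sum_(l < (size w).+1) \sum_(f | involution_from k.+1 f)
      q ^+ l * pairing_weight k.+1 f (insert_at l (s k) w).
  by apply: eq_bigr => l _; rewrite V mulr_sumr.
rewrite exchange_big /=; apply: eq_bigr => f If.
transitivity (\sum_(b <- opens k.+1 f) F f b); last first.
  by rewrite big_filter big_enum_cond /=; apply: eq_bigl => b; rewrite If.
rewrite -mulr_sumr map_rem_index ?opens_uniq // mulr_sumr.
apply: eq_bigr => l _; rewrite /pairing_weight -mulnb natrM.
by rewrite mulrCA -[RHS]mulrA; congr (_ * _); apply: mulrCA.
Qed.

(** The coordinate at the empty word keeps only the pairings without open strands. *)
Theorem q_wick :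
  suffix_vector 0 [::] =
  \sum_(f | involution_from 0 f && [forall x, f x != x])
     q ^+ #|crossing_pairs f| * (compatible f)%:R.
Proof.
rewrite suffix_vectorE // big_mkcondr /=; apply: eq_bigr => f _.
rewrite /pairing_weight (_ : _ == [::] = [forall x, f x != x]).
  by case: ifP; rewrite ?andbT ?andbF ?mulr0.
rewrite -size_eq0 size_map size_filter -leqn0 leqNgt -has_count.
by apply/hasPn/forallP => [H x|H x _]; [apply: (H x); rewrite mem_enum | apply: H].
Qed.

End QWick.

(** * Pair partitions and meandric polynomials *)

Definition constant_on_blocks (T : finType) (C : eqType) (A : {set {set T}})
    (s : T -> C) :=
  [forall B in A, forall x in B, forall y in B, s x == s y].

Section PairPartitionInvolutions.
Variable m : nat.
Implicit Types (f g : 'S_m) (P : {set {set 'I_m}}).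

Definition fixfree_involution f :=
  involution_from 0 f && [forall x, f x != x].

Lemma fixfree_involutionP f :
  reflect (involutive f /\ forall x, f x != x) (fixfree_involution f).
Proof.
apply: (iffP andP) => [[/involution_fromP[ff _] /forallP fn]|[ff fn]] //.
by split; [apply/involution_fromP | apply/forallP].
Qed.

Definition involution_blocks f := [set [set x; f x] | x in 'I_m].

Lemma in_involution_blocks f x : [set x; f x] \in involution_blocks f.
Proof. by apply/imsetP; exists x. Qed.

Lemma set2_eq (T : finType) (a b c : T) : [set a; b] = [set a; c] -> b != a -> b = c.
Proof.
move=> E ba; have : b \in [set a; c] by rewrite -E !inE eqxx orbT.
by rewrite !inE (negPf ba) => /eqP.
Qed.

Lemma mem_involution_blocks f a b : involutive f ->
  [set a; b] \in involution_blocks f -> b != a -> f a = b.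
Proof.
move=> ff /imsetP[y _ E] ba.
have : a \in [set y; f y] by rewrite -E !inE eqxx.
rewrite !inE => /orP[] /eqP ay; subst a; first by rewrite (set2_eq E ba).
by rewrite ff; apply/esym/(set2_eq _ ba); rewrite E setUC.
Qed.

Lemma pair_partition_blocks f : fixfree_involution f ->
  pair_partition (involution_blocks f).
Proof.
move=> /fixfree_involutionP[ff fn]; apply/andP; split; last first.
  by apply/forall_inP => A /imsetP[x _ ->]; rewrite cards2 (eq_sym x) fn.
apply/and3P; split.
- rewrite eqEsubset subsetT; apply/subsetP => x _; apply/bigcupP.
  by exists [set x; f x]; [apply: in_involution_blocks | apply: set21].
- apply/trivIsetP => A B /imsetP[x _ ->] /imsetP[y _ ->] xy.
  apply/pred0P => z /=; apply/negP => /andP[]; rewrite !inE.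
  move=> zx zy; move/eqP: xy; apply.
  by case/orP: zx => /eqP zx; case/orP: zy => /eqP zy; subst z;
    [rewrite zy | rewrite zy ff setUC | rewrite -zy ff setUC | rewrite (perm_inj zy)].
- by apply/imsetP => -[x _ /setP/(_ x)]; rewrite !inE eqxx.
Qed.

Lemma involution_blocks_inj : {in fixfree_involution &, injective involution_blocks}.
Proof.
move=> f g /fixfree_involutionP[ff fn] /fixfree_involutionP[gg gn] E.
apply/permP => x; apply/esym/mem_involution_blocks => //.
by rewrite -E in_involution_blocks.
Qed.

Lemma involution_blocks_surj P : pair_partition P ->
  exists2 f, fixfree_involution f & involution_blocks f = P.
Proof.
case/andP => /and3P[/eqP cP tP _] /forall_inP P2.
have eqblock A B x : A \in P -> B \in P -> x \in A -> x \in B -> A = B.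
  by move=> AP BP xA xB; rewrite -(def_pblock tP AP xA) (def_pblock tP BP xB).
have [g gP] : exists g : 'I_m -> 'I_m, forall x, g x != x /\ [set x; g x] \in P.
  apply: (@fin_all_exists _ (fun=> 'I_m) (fun x y => y != x /\ [set x; y] \in P)) => x.
  have /bigcupP[A AP xA] : x \in cover P by rewrite cP inE.
  have /cards2P[a [b [ab AE]]] := P2 A AP; rewrite AE in AP xA.
  move: xA; rewrite !inE => /orP[] /eqP ->; first by exists b; rewrite eq_sym.
  by exists a; rewrite setUC.
have gg : involutive g.
  move=> x; have [gx xP] := gP x; have [ggx gxP] := gP (g x).
  apply/esym/(@set2_eq _ (g x)); last by rewrite eq_sym.
  by rewrite setUC; apply: (eqblock _ _ (g x)); rewrite // !inE eqxx ?orbT.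
have gE x : perm (inv_inj gg) x = g x by rewrite permE.
exists (perm (inv_inj gg)).
  apply/fixfree_involutionP; split=> x; rewrite !gE ?gg //; first by case: (gP x).
apply/setP => A; apply/imsetP/idP => [[x _ ->]|AP].
  by rewrite gE; case: (gP x).
have /cards2P[a [b [ab AE]]] := P2 A AP; exists a => //.
rewrite gE; apply: (eqblock _ _ a) => //; first by case: (gP a).
  by rewrite AE !inE eqxx.
by rewrite !inE eqxx.
Qed.

Lemma sum_pair_partition (R : nmodType) (G : {set {set 'I_m}} -> R) :
  (\sum_(P | pair_partition P) G P =
   \sum_(f | fixfree_involution f) G (involution_blocks f))%R.
Proof.
rewrite (eq_bigl (mem (involution_blocks @: [set f | fixfree_involution f]))).
  rewrite big_imset => [|f g /=]; first by apply: eq_bigl => f; rewrite inE.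
  by rewrite !inE; apply: involution_blocks_inj.
move=> P /=; apply/idP/imsetP => [/involution_blocks_surj[f ff fP]|[f]].
  by exists f; rewrite ?inE.
by rewrite inE => ff ->; apply: pair_partition_blocks.
Qed.

(** Two crossing blocks are recovered from their left endpoints in increasing order. Without fixed
    points the clause of [crossing_pairs] about open strands is void. *)
Lemma cr_involution_blocks f : fixfree_involution f ->
  cr (involution_blocks f) = #|crossing_pairs f|.
Proof.
move=> /fixfree_involutionP[ff fn].
pose g (p : 'I_m * 'I_m) := [set [set p.1; f p.1]; [set p.2; f p.2]].
have min2 (x y : 'I_m) : (x < f x)%N -> (y < f y)%N -> [set x; f x] = [set y; f y] -> x = y.
  move=> xf yf E; have : x \in [set y; f y] by rewrite -E !inE eqxx.
  rewrite !inE => /orP[/eqP //|/eqP xy].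
  by move: xf; rewrite xy ff; lia.
have cP p : p \in crossing_pairs f ->
    [/\ (p.1 < p.2)%N, (p.2 < f p.1)%N & (f p.1 < f p.2)%N].
  by rewrite inE (negPf (fn _)) => /and3P[].
have gi : {in crossing_pairs f &, injective g}.
  move=> [a x] [b y] /cP[/= ax xa afx] /cP[/= ay yb bfy] E.
  have af : (a < f a)%N := ltn_trans ax xa.
  have xf : (x < f x)%N := ltn_trans xa afx.
  have bf : (b < f b)%N := ltn_trans ay yb.
  have yf : (y < f y)%N := ltn_trans yb bfy.
  have yg : [set y; f y] \in g (a, x) by rewrite E !inE eqxx orbT.
  have bg : [set b; f b] \in g (a, x) by rewrite E !inE eqxx.
  have mg (z : 'I_m) : (z < f z)%N -> [set z; f z] \in g (a, x) -> z = a \/ z = x.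
    move=> zf; rewrite !inE => /orP[] /eqP zE; [left | right]; exact: (min2 _ _ zf _ zE).
  have [bE|bE] := mg b bf bg; have [yE|yE] := mg y yf yg;
    subst b y => //; lia.
rewrite -(card_in_imset gi) /cr; congr #|pred_of_set _|.
apply/setP => D; rewrite inE; apply/exists_inP/imsetP => [[A AP]|[[a x] /cP/= [ax xa afx] ->]].
  case/exists_inP => B BP /andP[/eqP ->].
  case/existsP => a /existsP[b /existsP[c /existsP[e /and4P[ab bc ce]]]].
  have [ca eb] : c != a /\ e != b by rewrite -!val_eqE /=; lia.
  case/orP => /andP[/eqP AE /eqP BE]; subst A B.
    move: (mem_involution_blocks ff AP ca) (mem_involution_blocks ff BP eb) => fa fb.
    exists (a, b); last by rewrite /g /= fa fb.
    by rewrite inE /= fa fb ab bc ce orbT.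
  move: (mem_involution_blocks ff BP ca) (mem_involution_blocks ff AP eb) => fa fb.
  exists (a, b); last by rewrite /g /= fa fb setUC.
  by rewrite inE /= fa fb ab bc ce orbT.
exists [set a; f a]; first exact: in_involution_blocks.
apply/exists_inP; exists [set x; f x]; first exact: in_involution_blocks.
rewrite eqxx /=; apply/existsP; exists a; apply/existsP; exists x.
apply/existsP; exists (f a); apply/existsP; exists (f x).
by rewrite ax xa afx !eqxx.
Qed.

Lemma compatible_constant (T : eqType) (s : 'I_m -> T) f :
  compatible s f = constant_on_blocks (involution_blocks f) s.
Proof.
apply/forallP/forall_inP => [H A /imsetP[x _ ->]|H x].
  apply/forall_inP => y; rewrite !inE => /orP[] /eqP ->;
  apply/forall_inP => z; rewrite !inE => /orP[] /eqP ->; rewrite // ?(eqP (H _)) //.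
have /forall_inP := H _ (in_involution_blocks f x).
by move=> /(_ _ (set22 _ _))/forall_inP/(_ _ (set21 _ _)).
Qed.

End PairPartitionInvolutions.

(** * Joins of partitions and functions constant on blocks *)

Section PartitionJoin.
Variables (T : finType) (P Q : {set {set T}}).
Hypotheses (partP : partition P [set: T]) (partQ : partition Q [set: T]).

Lemma refines_trans (A B C : {set {set T}}) :
  refines A B -> refines B C -> refines A C.
Proof.
move=> /forall_inP AB /forall_inP BC; apply/forall_inP => X /AB/exists_inP[Y YB XY].
by have /exists_inP[Z ZC YZ] := BC Y YB; apply/exists_inP; exists Z; rewrite // (subset_trans XY).
Qed.

Lemma refines_pblock (A J : {set {set T}}) : partition A [set: T] -> partition J [set: T] ->
  reflect (forall x y, y \in pblock A x -> y \in pblock J x) (refines A J).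
Proof.
move=> /and3P[/eqP cA tA nA] /and3P[/eqP cJ tJ nJ].
apply: (iffP forall_inP) => [H x y yx|H X XA].
  have xA : pblock A x \in A by rewrite pblock_mem // cA inE.
  have /exists_inP[B BJ AB] := H _ xA.
  have xB : x \in B by rewrite (subsetP AB) // mem_pblock cA inE.
  by rewrite (def_pblock tJ BJ xB) (subsetP AB).
have [X0|[x xX]] := set_0Vmem X; first by move: nA; rewrite -X0 XA.
apply/exists_inP; exists (pblock J x); first by rewrite pblock_mem // cJ inE.
by apply/subsetP => y yX; apply: H; rewrite (def_pblock tA XA xX).
Qed.

(** The default of [part_join] never occurs: the connected components of the relation of sharing a
    block of [P] or of [Q] form a join. Any common coarsening has blocks closed under this relation,
    which gives minimality. *)
Lemma is_join_part_join : is_join P Q (part_join P Q).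
Proof.
rewrite /part_join; case: pickP => [J //|/= nJ]; exfalso.
pose e x y := (y \in pblock P x) || (y \in pblock Q x).
have sym (A : {set {set T}}) : partition A [set: T] ->
    forall x y, (y \in pblock A x) = (x \in pblock A y).
  move=> /and3P[/eqP cA tA _] x y.
  have m z : z \in cover A by rewrite cA inE.
  by rewrite -!eq_pblock // eq_sym.
have esym : connect_sym e.
  by apply: sym_connect_sym => x y; rewrite /e sym // (sym Q).
pose J := equivalence_partition (connect e) [set: T].
have Jeq : {in [set: T] & &, equivalence_rel (connect e)}.
  move=> x y z _ _ _; split; first exact: connect0.
  by move=> xy; apply/(same_connect esym).
have partJ : partition J [set: T] := equivalence_partitionP Jeq.
have Jmem x y : (y \in pblock J x) = connect e x y.
  by rewrite (pblock_equivalence_partition Jeq) ?inE.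
have := nJ J; rewrite /is_join partJ /=.
have -> : refines P J.
  by apply/(refines_pblock partP partJ) => x y xy; rewrite Jmem connect1 // /e xy.
have -> : refines Q J.
  by apply/(refines_pblock partQ partJ) => x y xy; rewrite Jmem connect1 // /e xy orbT.
move/negP; apply; apply/forallP => J'; apply/implyP => /and3P[partJ' PJ' QJ'].
apply/(refines_pblock partJ partJ') => x y; rewrite Jmem => xy.
have xx : x \in pblock J' x.
  by case/and3P: partJ' => /eqP cJ' _ _; rewrite mem_pblock cJ' inE.
rewrite -(closed_connect _ xy) // => u v uv; case/and3P: (partJ') => /eqP cJ' tJ' _.
have cv z : z \in cover J' by rewrite cJ' inE.
rewrite -!eq_pblock //; suff -> : pblock J' u = pblock J' v by [].
apply/eqP; rewrite eq_pblock //; case/orP: uv.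
  exact/(refines_pblock partP partJ').
exact/(refines_pblock partQ partJ').
Qed.

Lemma partition_part_join : partition (part_join P Q) [set: T].
Proof. by case/and4P: is_join_part_join. Qed.

Lemma constant_on_blocksP (C : eqType) (A : {set {set T}}) (s : T -> C) :
  partition A [set: T] ->
  reflect (forall x y, y \in pblock A x -> s x = s y) (constant_on_blocks A s).
Proof.
move=> /and3P[/eqP cA tA _]; have cv z : z \in cover A by rewrite cA inE.
apply: (iffP forall_inP) => [H x y xy|H B BA].
  have /H/forall_inP/(_ x)/[!mem_pblock]/(_ (cv x))/forall_inP : pblock A x \in A.
    by rewrite pblock_mem.
  by move=> /(_ y xy)/eqP.
apply/forall_inP => x xB; apply/forall_inP => y yB; apply/eqP/H.
by rewrite (def_pblock tA BA xB).
Qed.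

(* The level sets of [s] form a partition, and [s] is constant on the blocks of
   [A] exactly when [A] refines it. *)
Lemma constant_on_part_join (C : finType) (s : {ffun T -> C}) :
  constant_on_blocks (part_join P Q) s =
  constant_on_blocks P s && constant_on_blocks Q s.
Proof.
have /and4P[partJ PJ QJ /forallP minJ] := is_join_part_join.
have partS : partition (preim_partition s [set: T]) [set: T] := preim_partitionP _ _.
have cE A (partA : partition A [set: T]) :
    constant_on_blocks A s = refines A (preim_partition s [set: T]).
  apply/(constant_on_blocksP _ partA)/(refines_pblock partA partS) => H x y /H.
    by move=> sxy; rewrite pblock_equivalence_partition ?inE ?sxy //;
      split=> // /eqP ->.
  by rewrite pblock_equivalence_partition ?inE // => [/eqP //|? ? ? _ _ _]; split=> // /eqP ->.
rewrite !cE //; apply/idP/andP => [JS|[PS QS]].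
  by split; apply: refines_trans JS.
by have := minJ (preim_partition s [set: T]); rewrite partS PS QS.
Qed.

Lemma card_constant_on_blocks (C : finType) (A : {set {set T}}) : partition A [set: T] ->
  #|[set s : {ffun T -> C} | constant_on_blocks A s]| = #|C| ^ #|A|.
Proof.
move=> partA; have /and3P[/eqP cA tA nA] := partA.
have mA x : pblock A x \in A by rewrite pblock_mem // cA inE.
pose F (t : {ffun {B | B \in A} -> C}) : {ffun T -> C} :=
  [ffun x => t (exist _ (pblock A x) (mA x))].
have /fin_all_exists[r rP] (B : {B | B \in A}) : exists x, x \in val B.
  have [B0|[x xB]] := set_0Vmem (val B); last by exists x.
  by move: nA; rewrite -B0 (valP B).
have rE B : exist (fun B => B \in A) (pblock A (r B)) (mA (r B)) = B.
  by apply/val_inj => /=; rewrite (def_pblock tA (valP B) (rP B)).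
have Fi : injective F.
  by move=> t u /ffunP E; apply/ffunP => B; have := E (r B); rewrite !ffunE rE.
have -> : [set s : {ffun T -> C} | constant_on_blocks A s] = F @: setT.
  apply/setP => s; rewrite inE; apply/(constant_on_blocksP _ partA)/imsetP => [sc|[t _ ->] x y xy].
    exists [ffun B => s (r B)] => //; apply/ffunP => x; rewrite !ffunE.
    by apply: sc; apply: rP.
  rewrite !ffunE; congr (t _); apply/val_inj => /=; apply/eqP.
  by rewrite eq_pblock // cA inE.
by rewrite card_imset // cardsT card_ffun card_sig.
Qed.

End PartitionJoin.

(** * Sums over words and over meandric systems *)

Section MeandricSums.
Local Open Scope ring_scope.

Lemma pair_partition_partition m (P : {set {set 'I_m}}) :
  pair_partition P -> partition P [set: 'I_m].
Proof. by case/andP. Qed.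

Lemma sum_square_q_wick (R : comNzRingType) (q : R) (m : nat) (C : finType) :
  \sum_(s : {ffun 'I_m -> C}) suffix_vector q s 0 [::] ^+ 2 =
  \sum_(P | pair_partition P) \sum_(Q | pair_partition (n := m) Q)
    #|C|%:R ^+ #|part_join P Q| * q ^+ (cr P + cr Q).
Proof.
have W s : suffix_vector q s 0 [::] = \sum_(P | pair_partition P)
    q ^+ cr P * (constant_on_blocks (C := C) P s)%:R.
  rewrite q_wick sum_pair_partition; apply: eq_bigr => f ff.
  by rewrite cr_involution_blocks // -compatible_constant.
under eq_bigr => s _ do rewrite W expr2 big_distrlr /=.
rewrite exchange_big /=; apply: eq_bigr => P pP.
rewrite exchange_big /=; apply: eq_bigr => Q pQ.
have partP := pair_partition_partition pP; have partQ := pair_partition_partition pQ.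
rewrite -natrX -(card_constant_on_blocks _ (partition_part_join partP partQ)).
rewrite -sum1dep_card natr_sum mulr_suml [RHS]big_mkcond /=; apply: eq_bigr => s _.
rewrite constant_on_part_join // exprD mulrACA -natrM mulnb.
by case: (_ && _); rewrite ?mulr1 ?mul1r ?mulr0.
Qed.

Lemma card_pair_partition n (P : {set {set 'I_(2 * n)}}) :
  pair_partition P -> #|P| = n.
Proof.
case/andP => partP /forall_inP P2.
have := card_uniform_partition (fun A AP => eqP (P2 A AP)) partP.
by rewrite cardsT card_ord; lia.
Qed.

(** Crossing pairs are two-element sets of blocks, so there are at most ['C(n, 2)] of them; two pair
    partitions together stay within the range n^2 - n of [Ptilde]. *)
Lemma cr_leq n (P : {set {set 'I_(2 * n)}}) :
  pair_partition P -> (2 * cr P <= n ^ 2 - n)%N.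
Proof.
move=> pP; have -> : (n ^ 2 - n = 2 * 'C(n, 2))%N.
  by have := bin_ffact n 2; rewrite ffactnS ffactn1 (_ : 2`! = 2%N) //; case: (n) => /=; nia.
rewrite leq_mul2l /= -[in X in (_ <= X)%N](card_pair_partition pP) -cards_draws.
apply/subset_leq_card/subsetP => D; rewrite !inE.
case/exists_inP => A AP /exists_inP[B BP /andP[/eqP -> cAB]].
rewrite cards2; apply/andP; split.
  by apply/subsetP => X; rewrite !inE => /orP[] /eqP ->.
suff -> : A != B by [].
apply/eqP => AB; subst B; move: cAB.
case/existsP => a /existsP[b /existsP[c /existsP[e /and4P[ab bc ce]]]].
have [ba bcF] : a != b /\ a != e by rewrite -!val_eqE /=; lia.
by case/orP => /andP[/eqP ->] /eqP/setP/(_ a); rewrite !inE eqxx (negPf ba) (negPf bcF).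
Qed.

(** Sending each of the n blocks of [P] to the block of the join that contains it is onto. *)
Lemma part_join_bounds n (P Q : {set {set 'I_(2 * n)}}) : (0 < n)%N ->
  pair_partition P -> pair_partition Q -> (0 < #|part_join P Q| < n.+1)%N.
Proof.
move=> n0 pP pQ; have partP := pair_partition_partition pP.
have partQ := pair_partition_partition pQ.
have /and4P[partJ /forall_inP PJ _ _] := is_join_part_join partP partQ.
have /and3P[/eqP cJ tJ nJ] := partJ; have /and3P[/eqP cP tP nP] := partP.
have n2 : (0 < 2 * n)%N by rewrite muln_gt0.
apply/andP; split.
  apply/card_gt0P; exists (pblock (part_join P Q) (Ordinal n2)).
  by rewrite pblock_mem // cJ inE.
rewrite ltnS -[in X in (_ <= X)%N](card_pair_partition pP).
pose g (A : {set 'I_(2 * n)}) := odflt set0 [pick B in part_join P Q | A \subset B].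
apply: leq_trans (leq_imset_card g P).
apply/subset_leq_card/subsetP => B BJ; apply/imsetP.
have [B0|[x xB]] := set_0Vmem B; first by move: nJ; rewrite -B0 BJ.
have xP : pblock P x \in P by rewrite pblock_mem // cP inE.
exists (pblock P x) => //; rewrite /g.
case: pickP => [B' /andP[B'J xB']|/= nB]; last first.
  by have /exists_inP[B' B'J xB'] := PJ _ xP; have := nB B'; rewrite B'J xB'.
rewrite /= -(def_pblock tJ BJ xB); apply: def_pblock => //.
by rewrite (subsetP xB') // mem_pblock cP inE.
Qed.

(** By the two bounds each pair is counted at exactly one (k, l) in range. At n = 0 the sum over k
    is empty while the pair of empty partitions contributes 1, hence [0 < n]. *)
Lemma PtildeE (R : realType) n (t u : R) : (0 < n)%N ->
  Ptilde n t u = \sum_(P | pair_partition P) \sum_(Q | pair_partition Q)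
    t ^+ #|part_join P Q| * u ^+ (cr P + cr (n := 2 * n) Q).
Proof.
move=> n0; rewrite pair_big /=.
pose b (S : {set {set 'I_(2 * n)}} * {set {set 'I_(2 * n)}}) k l :=
  (#|part_join S.1 S.2| == k) && (cr S.1 + cr S.2 == l)%N.
rewrite /Ptilde; transitivity (\sum_(1 <= k < n.+1) \sum_(0 <= l < (n ^ 2 - n).+1)
    \sum_(S | pair_partition S.1 && pair_partition S.2) (b S k l)%:R * t ^+ k * u ^+ l).
  apply: eq_bigr => k _; apply: eq_bigr => l _.
  rewrite -!mulr_suml -natr_sum; congr (_%:R * _ * _).
  rewrite -big_mkcondr /= sum1dep_card /meandric_count.
  by apply: eq_card => S; rewrite !inE andbA.
under [LHS]eq_bigr => k _ do rewrite exchange_big /=.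
rewrite exchange_big /=; apply: eq_bigr => -[P Q] /= /andP[pP pQ].
have jb := part_join_bounds n0 pP pQ.
have cb : (cr P + cr Q < (n ^ 2 - n).+1)%N.
  by have := cr_leq pP; have := cr_leq pQ; lia.
rewrite (bigD1_seq #|part_join P Q|) ?iota_uniq ?mem_index_iota //=.
rewrite (bigD1_seq (cr P + cr Q)%N) ?iota_uniq ?mem_index_iota //=.
rewrite /b /= !eqxx mul1r !big1 ?addr0 // => [k kJ|l lc].
  by rewrite big1 // => l _; rewrite eq_sym (negPf kJ) !mul0r.
by rewrite (eq_sym _ l) (negPf lc) !mul0r.
Qed.

End MeandricSums.

From mathcomp Require Import all_classical all_reals all_analysis.
From mathcomp Require Import measurable_realfun complex ring lra.
Import Order.TTheory GRing.Theory Num.Theory.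
Import numFieldNormedType.Exports.
Local Open Scope ring_scope.
Local Open Scope complex_scope.

(** * Strict positivity of the q-inner product *)

Section DefiniteGram.
Variable R : realType.
Local Notation C := R[i].

Definition definite_gram (T : finType) (G : T -> T -> R) :=
  forall f : T -> C, gram_sum G f f = 0 -> forall u, f u = 0.

Lemma mulcJ_eq0 (z : C) : (z * conjc z == 0) = (z == 0).
Proof. by rewrite mulf_eq0 conjc_eq0 orbb. Qed.

Lemma gram_sum_factor (T Z : finType) (G : T -> T -> R) (A : Z -> T -> R) (f : T -> C) :
  (forall u v, G u v = \sum_z A z u * A z v) ->
  gram_sum G f f =
  \sum_z (\sum_u f u * (A z u)%:C) * conjc (\sum_u f u * (A z u)%:C).
Proof.
move=> GA; under [RHS]eq_bigr => z _ do rewrite conjc_sum mulr_suml.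
rewrite exchange_big /=; apply: eq_bigr => u _.
under [RHS]eq_bigr => z _ do rewrite mulr_sumr.
rewrite exchange_big /=; apply: eq_bigr => v _.
rewrite GA rmorph_sum mulr_sumr; apply: eq_bigr => z _.
by rewrite rmorphM conjcM conjc_real mulrACA.
Qed.

Lemma gram_sum_factor_eq0 (T Z : finType) (G : T -> T -> R) (A : Z -> T -> R) (f : T -> C) :
  (forall u v, G u v = \sum_z A z u * A z v) ->
  gram_sum G f f = 0 <-> forall z, \sum_u f u * (A z u)%:C = 0.
Proof.
move=> GA; rewrite (gram_sum_factor f GA); split=> [/eqP|H].
  rewrite psumr_eq0 => [/allP H z|z _]; last exact: mulcJ_ge0.
  by apply/eqP; rewrite -mulcJ_eq0; apply: H; rewrite mem_index_enum.
by rewrite big1 // => z _; rewrite H mul0r.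
Qed.

(** A null vector is orthogonal to all products of rows of [A] and [A']. Fixing the row of [A'] and
    contracting the second variable leaves a null vector of [G], hence zero; then [G'] is applied at
    each fixed first variable. *)
Lemma definite_gram_prod (T T' : finType) (G : T -> T -> R) (G' : T' -> T' -> R) :
  factorizable G -> factorizable G' -> definite_gram G -> definite_gram G' ->
  definite_gram (fun u v : T * T' => G u.1 v.1 * G' u.2 v.2).
Proof.
move=> [Z [A GA]] [Z' [A' GA']] dG dG' f.
have GG u v : G u.1 v.1 * G' u.2 v.2 =
    \sum_(z : Z * Z') (A z.1 u.1 * A' z.2 u.2) * (A z.1 v.1 * A' z.2 v.2).
  rewrite GA GA' big_distrlr /= pair_bigA /=.
  by apply: eq_bigr => z _; rewrite mulrACA.
move=> /(gram_sum_factor_eq0 _ GG) f0 [u u'].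
apply: (dG' (fun u' => f (u, u'))); apply/(gram_sum_factor_eq0 _ GA') => z'.
apply: (dG (fun u => \sum_u' f (u, u') * (A' z' u')%:C)).
apply/(gram_sum_factor_eq0 _ GA) => z; rewrite -[RHS](f0 (z, z')) /=.
rewrite [RHS](eq_bigr (fun p => f (p.1, p.2) * (A z p.1 * A' z' p.2)%:C)); last by case.
rewrite -(pair_bigA _ (fun u u' => f (u, u') * (A z u * A' z' u')%:C)) /=.
apply: eq_bigr => v _; rewrite mulr_suml; apply: eq_bigr => v' _.
by rewrite rmorphM mulrA mulrAC.
Qed.

End DefiniteGram.

Section QGramDefinite.
Variables (R : realType) (d : nat) (q : R) (hq : -1 < q < 1).
Local Notation C := R[i].

Lemma inversions_eq0 n (r : 'S_n) : inversions r = 0%N -> r = 1%g.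
Proof.
move=> /eqP; rewrite cards_eq0 => /eqP r0.
have rlt (a b : 'I_n) : (a < b)%N -> (r a < r b)%N.
  move=> ab; have /setP/(_ (a, b)) := r0; rewrite !inE /= ab /= => /negbT.
  rewrite -leqNgt leq_eqVlt => /orP[/eqP/val_inj/perm_inj E|//].
  by move: ab; rewrite E ltnn.
have E : [seq r i | i <- enum 'I_n] = enum 'I_n.
  apply: (@irr_sorted_eq _ (relpre (@nat_of_ord n) ltn)) => [x y z|x|||x].
  - exact: ltn_trans.
  - exact: ltnn.
  - rewrite sorted_map; apply: (@sub_sorted _ (relpre (@nat_of_ord n) ltn)) => [x y|].
      exact: rlt.
    by rewrite -sorted_map val_enum_ord iota_ltn_sorted.
  - by rewrite -sorted_map val_enum_ord iota_ltn_sorted.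
  - rewrite mem_enum; apply/mapP; exists (r^-1 x)%g; rewrite ?mem_enum //.
    by rewrite permKV.
apply/permP => i; rewrite perm1.
have := congr1 (fun s => nth i s i) E.
by rewrite (nth_map i) ?size_enum_ord // nth_ord_enum.
Qed.

(* (s, t) |-> q ^ inversions (s^-1 t) is the restriction, along the injection
   of a permutation into its inversion set, of a tensor power of the strictly
   positive kernel ((1, q), (q, 1)). *)
Lemma perm_gram_factor n : exists (Z : finType) (b : Z -> 'S_n -> R),
  (forall s t : 'S_n, q ^+ inversions (s^-1 * t)%g = \sum_z b z s * b z t) /\
  forall f : 'S_n -> C, (forall z, \sum_s f s * (b z s)%:C = 0) -> forall s, f s = 0.
Proof.
pose x (s : 'S_n) (p : 'I_n * 'I_n) : bool := (s p.1 < s p.2)%N.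
have q21 : 0 < 1 - q ^+ 2.
  rewrite subr_gt0 -real_normK ?num_real // exprn_ilt1 // ltr_norml hq //.
pose r : R := Num.sqrt (1 - q ^+ 2).
have r0 : r != 0 by rewrite gt_eqF // sqrtr_gt0.
(* [B] is the Cholesky factor of ((1, q), (q, 1)) and [Bi] its inverse, which exists because 1 - q^2
   > 0. *)
pose B (z y : bool) : R := if z then (if y then r else 0) else (if y then q else 1).
pose Bi (y z : bool) : R :=
  if z then (if y then r^-1 else - q / r) else (if y then 0 else 1).
have BE y y' : \sum_z B z y * B z y' = if y != y' then q else 1.
  rewrite big_bool /B; case: y; case: y' => /=; rewrite ?(mulr0, mul0r, mulr1, mul1r, add0r) //.
  by rewrite -expr2 sqr_sqrtr ?ltW // -expr2 subrK.
have BiE y y' : \sum_z Bi y z * B z y' = (y == y')%:R.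
  rewrite big_bool /B /Bi; case: y; case: y' => /=;
    by rewrite ?(mulr0, mul0r, mulr1, mul1r, add0r, addr0) ?mulVf ?mulfVK ?addNr.
pose Q := {p : 'I_n * 'I_n | (p.1 < p.2)%N}.
pose b (z : {ffun Q -> bool}) s := \prod_(p : Q) B (z p) (x s (val p)).
have KE (s t : 'S_n) : q ^+ inversions (s^-1 * t)%g = \sum_z b z s * b z t.
  under eq_bigr => z _ do rewrite -big_split /=.
  rewrite -(bigA_distr_bigA (fun (p : Q) z => B z (x s (val p)) * B z (x t (val p)))) /=.
  under eq_bigr => p _ do rewrite BE.
  rewrite inversions_mul -big_mkcond /= prodr_const; congr (_ ^+ _).
  rewrite -(card_imset _ val_inj); apply: eq_card => p; rewrite !inE.
  apply/idP/imsetP => [/andP[pp H]|[[y yy]]]; first by exists (Sub p pp).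
  by rewrite unfold_in /x /= => H ->; rewrite /= yy H.
have xinj (s t : 'S_n) : (forall p : Q, x s (val p) = x t (val p)) -> s = t.
  move=> st; suff /inversions_eq0 H : inversions (s^-1 * t)%g = 0%N.
    by apply/esym/eqP; rewrite -[t]mul1g -(mulgV s) -mulgA H mulg1.
  apply/eqP; rewrite inversions_mul cards_eq0; apply/eqP/setP => p; rewrite !inE.
  apply/negP => /andP[pp]; apply/negP; rewrite negbK.
  by apply/eqP; apply: (st (Sub p pp)).
exists {ffun Q -> bool}, b; split=> // f f0 s.
(* Pairing with the tensor power of [Bi] isolates [f s]: the resulting product of Kronecker deltas
   vanishes once [s] and [t] order some pair differently. *)
have : \sum_(z : {ffun Q -> bool}) (\prod_(p : Q) Bi (x s (val p)) (z p))%:C *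
    \sum_t f t * (b z t)%:C = 0.
  by rewrite big1 // => z _; rewrite f0 mulr0.
under eq_bigr => z _ do rewrite mulr_sumr.
rewrite exchange_big /= (bigD1 s) //= [X in _ + X]big1 ?addr0 => [|t ts]; last first.
  under eq_bigr => z _ do rewrite mulrCA -rmorphM -big_split /=.
  rewrite -mulr_sumr -rmorph_sum.
  rewrite -(bigA_distr_bigA (fun (p : Q) z => Bi (x s (val p)) z * B z (x t (val p)))) /=.
  rewrite [X in X%:C](_ : _ = 0) ?mulr0 //; apply/eqP/prodf_eq0.
  have [p Hp] : exists p : Q, x s (val p) != x t (val p).
    apply/existsP; apply: contraNT ts; rewrite negb_exists => /forallP H.
    by apply/eqP/esym/xinj => p; have := H p; rewrite negbK => /eqP.
  by exists p => //; rewrite BiE (negPf Hp).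
under eq_bigr => z _ do rewrite mulrCA -rmorphM -big_split /=.
rewrite -mulr_sumr -rmorph_sum.
rewrite -(bigA_distr_bigA (fun (p : Q) z => Bi (x s (val p)) z * B z (x s (val p)))) /=.
by rewrite big1 ?mulr1 // => p _; rewrite BiE eqxx.
Qed.

Definition act_tuple n (u : n.-tuple 'I_d) (s : 'S_n) : n.-tuple 'I_d :=
  [tuple tnth u (s i) | i < n].

Lemma act_tupleM n (u : n.-tuple 'I_d) s t :
  act_tuple u (s * t) = act_tuple (act_tuple u t) s.
Proof. by apply: eq_from_tnth => i; rewrite !tnth_mktuple permM. Qed.

Lemma act_tuple1 n (u : n.-tuple 'I_d) : act_tuple u 1 = u.
Proof. by apply: eq_from_tnth => i; rewrite !tnth_mktuple perm1. Qed.

Lemma act_tuple_inj n (s : 'S_n) : injective (fun u : n.-tuple 'I_d => act_tuple u s).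
Proof.
apply: (can_inj (g := fun u => act_tuple u s^-1%g)) => u.
by rewrite -act_tupleM mulVg act_tuple1.
Qed.

Lemma qgramE n (u v : n.-tuple 'I_d) :
  qgram q u v = \sum_(t : 'S_n) q ^+ inversions t * (u == act_tuple v t)%:R.
Proof.
apply: eq_bigr => t _; congr (_ * _).
have [->|ne] := eqVneq u (act_tuple v t).
  by rewrite big1 // => i _; rewrite tnth_mktuple eqxx.
apply/eqP/prodf_eq0; have [i Hi] : exists i, tnth u i != tnth v (t i).
  apply/existsP; apply: contraNT ne; rewrite negb_exists => /forallP H.
  apply/eqP/eq_from_tnth => i; rewrite !tnth_mktuple.
  by have := H i; rewrite negbK => /eqP.
by exists i => //; rewrite (negPf Hi).
Qed.

(** For each tuple [v] the function [phi v] lists the values of [f] along the orbit of [v]. By [E],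
    the forms of all [phi v] under the permutation kernel add up to n! copies of the given form,
    hence to 0; being nonnegative they all vanish, and strict positivity of the kernel gives
    [phi v = 0], in particular f v = 0. *)
Lemma qgram_definite n : definite_gram (@qgram R d q n).
Proof.
move=> f f0.
have E (s : 'S_n) : \sum_v \sum_(r : 'S_n) f (act_tuple v r^-1) *
    conjc (f (act_tuple v s^-1)) * (q ^+ inversions (r^-1 * s)%g)%:C = 0.
  rewrite -[RHS]f0 /gram_sum [RHS]exchange_big /= [RHS](reindex_inj (@act_tuple_inj n s^-1)).
  apply: eq_bigr => v _.
  rewrite (reindex (fun t : 'S_n => (s * t^-1)%g)) /=; last first.
    by exists (fun r => (r^-1 * s)%g) => r _;
      rewrite invMg ?invgK ?mulgKV ?mulgA ?mulgV ?mul1g // ?mulKVg.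
  under [RHS]eq_bigr => u _ do rewrite qgramE rmorph_sum mulr_sumr.
  rewrite [RHS]exchange_big /=; apply: eq_bigr => t _.
  rewrite (bigD1 (act_tuple (act_tuple v s^-1) t)) //= eqxx mulr1 big1 ?addr0 => [|u ut].
    by rewrite -act_tupleM invMg invgK mulgKV.
  by rewrite (negPf ut) mulr0 mulr0.
pose phi v (s : 'S_n) := f (act_tuple v s^-1).
have [Z [b [KE binj]]] := perm_gram_factor n.
pose K (s t : 'S_n) := q ^+ inversions (s^-1 * t)%g.
have /eqP : \sum_v gram_sum K (phi v) (phi v) = 0.
  under eq_bigr => v _ do rewrite /gram_sum exchange_big /=.
  by rewrite exchange_big big1 // => s _; apply: E.
rewrite psumr_eq0 => [/allP H u|v _]; last by apply: gram_sum_ge0; exists Z, b.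
have /H/eqP := mem_index_enum u.
move=> /(gram_sum_factor_eq0 _ KE)/binj/(_ 1%g).
by rewrite /phi invg1 act_tuple1.
Qed.

End QGramDefinite.

(** * The coordinate formula for the adjoint of creation *)

Section QGramRecursion.
Variables (R : realType) (d : nat) (q : R).
Local Notation C := R[i].
Local Notation word := (seq 'I_d).

Lemma inversions_sum n (t : 'S_n) :
  inversions t = (\sum_(i < n) \sum_(j < n) ((i < j) && (t j < t i)))%N.
Proof.
rewrite /inversions -sum1dep_card pair_big /= big_mkcond.
by apply: eq_bigr => p _; case: (_ && _).
Qed.

(** The first entry has value [k] and is inverted with exactly the [k] smaller values, all of which
    come later. *)
Lemma inversions_lift_perm n (k : 'I_n.+1) (s : 'S_n) :
  inversions (lift_perm ord0 k s) = (k + inversions s)%N.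
Proof.
rewrite !inversions_sum big_ord_recl; congr addn.
  rewrite big_ord_recl ltnn /= add0n.
  under eq_bigr => j _ do rewrite lift_perm_id lift_perm_lift.
  transitivity (\sum_(j < n) (s j < k))%N.
    apply: eq_bigr => j _; congr nat_of_bool; rewrite /= /bump.
    by case: (leqP k (s j)); lia.
  transitivity (\sum_(j < n) (j < k))%N; first by rewrite [RHS](reindex_inj (@perm_inj _ s)).
  rewrite -[RHS](card_ord k) -sum1_card.
  rewrite (big_ord_widen n (fun=> 1%N) (leq_ord k)) [RHS]big_mkcond.
  by apply: eq_bigr => j _; case: ltnP.
apply: eq_bigr => i _; rewrite big_ord_recl ltn0 /= add0n.
apply: eq_bigr => j _; rewrite !lift_perm_lift /= /bump !leq0n ltnS.
congr (nat_of_bool (_ && _)); rewrite /= /bump.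
by case: (leqP k (s i)); case: (leqP k (s j)); rewrite ?ltnS //; lia.
Qed.

Definition delete_tnth n (k : 'I_n.+1) (v : n.+1.-tuple 'I_d) : n.-tuple 'I_d :=
  [tuple tnth v (lift k j) | j < n].

Definition insert_tnth n (k : 'I_n.+1) (i : 'I_d) (w : n.-tuple 'I_d) : n.+1.-tuple 'I_d :=
  [tuple (if unlift k j is Some j' then tnth w j' else i) | j < n.+1].

Lemma tnth_insert n (k : 'I_n.+1) i (w : n.-tuple 'I_d) : tnth (insert_tnth k i w) k = i.
Proof. by rewrite tnth_mktuple unlift_none. Qed.

Lemma insert_tnthK n (k : 'I_n.+1) i : cancel (insert_tnth (n := n) k i) (delete_tnth k).
Proof. by move=> w; apply: eq_from_tnth => j; rewrite !tnth_mktuple liftK. Qed.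

Lemma delete_tnthK n (k : 'I_n.+1) (v : n.+1.-tuple 'I_d) :
  insert_tnth k (tnth v k) (delete_tnth k v) = v.
Proof.
apply: eq_from_tnth => j; rewrite tnth_mktuple.
by case: unliftP => [j'|] ->; rewrite ?tnth_mktuple.
Qed.

Lemma val_insert_tnth n (k : 'I_n.+1) i (w : n.-tuple 'I_d) :
  insert_tnth k i w = insert_at k i w :> seq _.
Proof.
have sk : size (take k w) = k by rewrite size_takel // size_tuple -ltnS.
apply: (@eq_from_nth _ i) => [|j].
  by rewrite size_tuple size_cat /= addnS -size_cat cat_take_drop size_tuple.
rewrite size_tuple => jn; rewrite -(tnth_nth i _ (Ordinal jn)) tnth_mktuple nth_cat sk.
case: unliftP => [j'|] /(congr1 val) /= ->; last by rewrite ltnn subnn.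
rewrite (tnth_nth i) /bump; case: (leqP k j') => kj /=.
  by rewrite add1n ltnNge (leqW kj) /= subSn //= nth_drop subnKC.
by rewrite add0n kj nth_take.
Qed.

(** Permutations are sorted by the image [k] of the first position; [h] is bijective since it is
    injective and (n + 1) n! = (n + 1)!. *)
Lemma qgram_cons n i (u : n.-tuple 'I_d) (v : n.+1.-tuple 'I_d) :
  qgram q [tuple of i :: u] v =
  \sum_(k < n.+1) q ^+ k * (tnth v k == i)%:R * qgram q u (delete_tnth k v).
Proof.
pose h (p : 'I_n.+1 * 'S_n) := lift_perm ord0 p.1 p.2.
have hinj : injective h.
  move=> [k s] [k' s'] /permP /= E.
  have kk : k = k' by have := E ord0; rewrite !lift_perm_id.
  subst k'; congr (_, _); apply/permP => j; apply: (@lift_inj _ k).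
  by rewrite -!(lift_perm_lift ord0) E.
have [g hK gK] : bijective h.
  by apply: inj_card_bij; rewrite // card_prod card_ord !card_Sn factS.
rewrite /qgram (reindex h) /=; last by exists g => x _; [apply: hK | apply: gK].
under [RHS]eq_bigr => k _ do rewrite mulr_sumr.
rewrite [RHS]pair_bigA /=; apply: eq_bigr => -[k s] _ /=.
rewrite inversions_lift_perm big_ord_recl lift_perm_id tnth0 exprD -!mulrA eq_sym.
congr (_ * _); rewrite mulrCA; congr (_ * (_ * _)); apply: eq_bigr => j _.
by rewrite tnthS lift_perm_lift tnth_mktuple.
Qed.

Lemma sum_tuple_cons (V : nmodType) (T : finType) n (F : n.+1.-tuple T -> V) :
  \sum_u F u = \sum_i \sum_(w : n.-tuple T) F [tuple of i :: w].
Proof.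
rewrite pair_bigA /= (reindex (fun p : T * n.-tuple T => [tuple of p.1 :: p.2])) //=.
exists (fun u => (thead u, [tuple of behead u])) => [[j w] _|u _].
  by congr (_, _); apply/val_inj.
by rewrite [RHS]tuple_eta.
Qed.

(** The origin of [annihilate]: in [qgram_cons] the words with letter [i] at position [k] are
    exactly the insertions of [i] at [k], each weighted by q^k. *)
Lemma gram_sum_create n i (f g : word -> C) :
  gram_sum (@qgram R d q n.+1) (fun u => create i f u) (fun v => g v) =
  gram_sum (@qgram R d q n) (fun u => f u) (fun v => annihilate q%:C i g v).
Proof.
rewrite /gram_sum sum_tuple_cons (bigD1 i) //= [X in _ + X]big1 ?addr0 => [|j ji]; last first.
  by rewrite big1 // => w _; rewrite big1 // => v _; rewrite (negPf ji) !mul0r.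
apply: eq_bigr => u _; rewrite eqxx.
under eq_bigr => v _ do rewrite mul1r qgram_cons rmorph_sum mulr_sumr.
under [RHS]eq_bigr => v _ do
  rewrite /annihilate conjc_sum mulr_sumr mulr_suml size_tuple.
rewrite exchange_big [RHS]exchange_big /=; apply: eq_bigr => k _.
rewrite (bigID (fun v => tnth v k == i)) /= [X in _ + X]big1 ?addr0; last first.
  by move=> v /negPf ->; rewrite mulr0 mul0r mulr0.
rewrite (reindex (insert_tnth k i)) /=; last first.
  by exists (delete_tnth k) => [w _|v /eqP <-]; [apply: insert_tnthK | apply: delete_tnthK].
apply: eq_big => [w|w _]; first by rewrite tnth_insert eqxx.
rewrite tnth_insert eqxx mulr1 insert_tnthK val_insert_tnth conjcM.
rewrite -rmorphXn conjc_real rmorphM /=; ring.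
Qed.

End QGramRecursion.

(** * Bounded operators on graded Hilbert sums *)

Section ComplexLimits.
Variable R : realType.
Local Notation C := R[i].
Implicit Types (u v : nat -> C) (a b l : C).

Definition ccvg u l := ((fun n => complex.Re (u n)) @ \oo --> complex.Re l)%classic /\
  ((fun n => complex.Im (u n)) @ \oo --> complex.Im l)%classic.

Lemma ReD a b : complex.Re (a + b) = complex.Re a + complex.Re b.
Proof. by case: a b => [? ?] []. Qed.

Lemma ImD a b : complex.Im (a + b) = complex.Im a + complex.Im b.
Proof. by case: a b => [? ?] []. Qed.

Lemma ReM a b : complex.Re (a * b) =
  complex.Re a * complex.Re b - complex.Im a * complex.Im b.
Proof. by case: a b => [? ?] []. Qed.

Lemma ImM a b : complex.Im (a * b) =
  complex.Re a * complex.Im b + complex.Im a * complex.Re b.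
Proof. by case: a b => [? ?] []. Qed.

Lemma Re_realM (r : R) a : complex.Re (r%:C * a) = r * complex.Re a.
Proof. by rewrite ReM mul0r subr0. Qed.

Lemma complex_eqP a b : complex.Re a = complex.Re b -> complex.Im a = complex.Im b -> a = b.
Proof. by case: a b => [? ?] [? ?] /= -> ->. Qed.

Lemma ccvg_unique u l l' : ccvg u l -> ccvg u l' -> l = l'.
Proof.
move=> [H1 H2] [H1' H2']; apply: complex_eqP.
  by rewrite -(cvg_lim (@Rhausdorff R) H1) (cvg_lim (@Rhausdorff R) H1').
by rewrite -(cvg_lim (@Rhausdorff R) H2) (cvg_lim (@Rhausdorff R) H2').
Qed.

Lemma ccvgD u v l l' : ccvg u l -> ccvg v l' -> ccvg (fun n => u n + v n) (l + l').
Proof.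
move=> [H1 H2] [H1' H2']; split.
  under eq_fun do rewrite ReD; rewrite ReD; exact: cvgD.
under eq_fun do rewrite ImD; rewrite ImD; exact: cvgD.
Qed.

Lemma ccvgM u v l l' : ccvg u l -> ccvg v l' -> ccvg (fun n => u n * v n) (l * l').
Proof.
move=> [H1 H2] [H1' H2']; split.
  under eq_fun do rewrite ReM; rewrite ReM; apply: cvgB; exact: cvgM.
under eq_fun do rewrite ImM; rewrite ImM; apply: cvgD; exact: cvgM.
Qed.

Lemma ccvg_cst l : ccvg (fun=> l) l.
Proof. by split; exact: cvg_cst. Qed.

Lemma ccvg_conj u l : ccvg u l -> ccvg (fun n => conjc (u n)) (conjc l).
Proof.
have ReJ a : complex.Re (conjc a) = complex.Re a by case: a.
have ImJ a : complex.Im (conjc a) = - complex.Im a by case: a.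
move=> [H1 H2]; split.
  by under eq_fun do rewrite ReJ; rewrite ReJ.
by under eq_fun do rewrite ImJ; rewrite ImJ; exact: cvgN.
Qed.

Lemma ccvg_shift u l k : ccvg (fun n => u (n + k)%N) l -> ccvg u l.
Proof. by move=> [H1 H2]; split; rewrite -(cvg_shiftn k). Qed.

Lemma ccvg_subseq u l k : ccvg u l -> ccvg (fun n => u (n + k)%N) l.
Proof. by move=> [H1 H2]; rewrite -(cvg_shiftn k) in H1; rewrite -(cvg_shiftn k) in H2. Qed.

Lemma ge0_Im a : 0 <= a -> complex.Im a = 0.
Proof. by case: a => a b; rewrite lecE /= => /andP[/eqP ->]. Qed.

Lemma ge0_Re a : 0 <= a -> 0 <= complex.Re a.
Proof. by case: a => a b; rewrite lecE /= => /andP[]. Qed.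

Lemma le_Re a b : a <= b -> complex.Re a <= complex.Re b.
Proof. by case: a b => [a a'] [b b']; rewrite lecE /= => /andP[]. Qed.

End ComplexLimits.

Section CoordinateSystem.
Variables (R : realType) (W : Type) (K : graded_form R W).
Local Notation C := R[i].

(* The [N]-th finite partial sum is cut out by the coordinate projection along
   [cut N], and is spanned by finitely many basis vectors. *)
Record coordinate_system := CoordinateSystem {
  cut : nat -> W -> bool;
  trunc N (f : W -> C) : W -> C := fun w => if cut N w then f w else 0;
  gform_trunc : forall N n f g, (N <= n)%N -> K n (trunc N f) g = K N f g;
  gform_definite : forall f, (forall N, K N f f = 0) -> forall w, f w = 0;
  basis_vector : W -> hilbert_sum K;
  trunc_span : forall N f, exists s : seq W,
    forall w, trunc N f w = \sum_(v <- s) f v * basis_vector v w }.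

End CoordinateSystem.

(** * Inner product, density of finite vectors, and bounded operators *)

Section HilbertSumTheory.
Variables (R : realType) (W : Type) (K : graded_form R W).
Local Notation C := R[i].
Local Notation H := (hilbert_sum K).
Implicit Types (x y z : H) (f g : W -> C) (N n : nat).

Lemma coords_inj x y : x =1 y -> x = y.
Proof. by move=> xy; apply/val_inj/funext. Qed.

Lemma gformBl N f g h : K N (f - g) h = K N f h - K N g h.
Proof. by rewrite -scaleN1r gformDl gformZl mulN1r. Qed.

Lemma gformBr N f g h : K N h (f - g) = K N h f - K N h g.
Proof. by rewrite gform_conj gformBl rmorphB /= -!gform_conj. Qed.

Variable E : coordinate_system K.
Local Notation trunc := (trunc E).

Lemma gform_sub_trunc N n f : (N <= n)%N ->
  K n (f - trunc N f) (f - trunc N f) = K n f f - K N f f.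
Proof.
move=> Nn; rewrite !gformBl !gformBr [K n f (trunc _ _)]gform_conj !(gform_trunc E) //.
rewrite [K N f (trunc _ _)]gform_conj (gform_trunc E) // -gform_conj subrr subr0.
by congr (_ - _).
Qed.

Lemma gform_mono N n f : (N <= n)%N -> K N f f <= K n f f.
Proof. by move=> Nn; rewrite -subr_ge0 -gform_sub_trunc // gform_ge0. Qed.

Lemma gform_cvg_self x : cvgn (fun N => complex.Re (K N x x)).
Proof.
apply: nondecreasing_is_cvgn => [N n Nn|].
  exact/le_Re/gform_mono.
have /asboolP[M HM] := coords_summable x.
by exists M => _ [N _ <-]; apply: (le_Re (HM N)).
Qed.

(** The diagonal forms increase with N and are bounded by square-summability; polarization reduces
    the real part to them, and the imaginary part is the real part at [- 'i *: x]. The [limn] in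
    [inner] is thus a genuine limit, on which all its algebra rests. *)
Lemma inner_ccvg x y : ccvg (fun N => K N x y) (inner x y).
Proof.
have cvgRe x' y' : cvgn (fun N => complex.Re (K N x' y')).
  have -> : (fun N => complex.Re (K N x' y')) = (fun N => 4^-1 *
      (complex.Re (K N (x' + y') (x' + y')) - complex.Re (K N (x' - y') (x' - y')))).
    apply/funext => N.
    have -> : coords (x' + y') = coords x' + coords y' by [].
    have -> : coords (x' - y') = coords x' - coords y' by [].
    rewrite !(gformBl, gformBr) !(gformDl, gformDr) (gform_conj K N x' y').
    by case: (K N x' y') (K N x' x') (K N y' y') => [a b] [c c'] [e e'] /=; lra.
  apply: is_cvgM; first exact: is_cvg_cst.
  by apply: is_cvgB; apply: gform_cvg_self.
split => /=; first exact: cvgRe.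
have -> : (fun N => complex.Im (K N x y)) = (fun N => complex.Re (K N (- 'i *: x) y)).
  apply/funext => N; have -> : coords (- 'i *: x) = - 'i *: coords x by [].
  by rewrite gformZl ReM /=; lra.
exact: cvgRe.
Qed.

Lemma inner_eq x y l : ccvg (fun N => K N x y) l -> inner x y = l.
Proof. exact/ccvg_unique/inner_ccvg. Qed.

Lemma innerDl x y z : inner (x + y) z = inner x z + inner y z.
Proof.
apply: inner_eq; have -> : coords (x + y) = coords x + coords y by [].
under eq_fun do rewrite gformDl; apply: ccvgD; exact: inner_ccvg.
Qed.

Lemma innerZl a x z : inner (a *: x) z = a * inner x z.
Proof.
apply: inner_eq; have -> : coords (a *: x) = a *: coords x by [].
under eq_fun do rewrite gformZl; apply: ccvgM; [exact: ccvg_cst | exact: inner_ccvg].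
Qed.

Lemma inner_conj x y : inner y x = conjc (inner x y).
Proof.
apply: inner_eq; under eq_fun do rewrite gform_conj; apply: ccvg_conj.
exact: inner_ccvg.
Qed.

Lemma innerDr x y z : inner z (x + y) = inner z x + inner z y.
Proof. by rewrite (inner_conj _ z) innerDl (inner_conj x z) (inner_conj y z); apply: rmorphD. Qed.

Lemma innerZr a x z : inner z (a *: x) = conjc a * inner z x.
Proof. by rewrite (inner_conj _ z) innerZl (inner_conj x z); apply: rmorphM. Qed.

Lemma innerBl x y z : inner (x - y) z = inner x z - inner y z.
Proof. by rewrite innerDl -scaleN1r innerZl mulN1r. Qed.

Lemma innerBr x y z : inner z (x - y) = inner z x - inner z y.
Proof. by rewrite (inner_conj _ z) innerBl (inner_conj x z) (inner_conj y z); apply: rmorphB. Qed.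

Lemma inner0l z : inner 0 z = 0.
Proof. by rewrite -(scale0r 0) innerZl mul0r. Qed.

Lemma inner_suml (I : Type) (r : seq I) (F : I -> H) z :
  inner (\sum_(i <- r) F i) z = \sum_(i <- r) inner (F i) z.
Proof.
by elim: r => [|i r IH]; rewrite ?big_nil ?inner0l // !big_cons innerDl IH.
Qed.

Lemma inner_sumr (I : Type) (r : seq I) (F : I -> H) z :
  inner z (\sum_(i <- r) F i) = \sum_(i <- r) inner z (F i).
Proof.
rewrite (inner_conj _ z) inner_suml [LHS](rmorph_sum (@conjc R)).
by apply: eq_bigr => i _; rewrite (inner_conj _ z).
Qed.

Lemma gform_le_inner N x : K N x x <= inner x x.
Proof.
have Re_le : complex.Re (K N x x) <= complex.Re (inner x x).
  apply: (nondecreasing_cvgn_le _ (@gform_cvg_self x)) => ? ? ?.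
  exact/le_Re/gform_mono.
have Im0 n : complex.Im (K n x x) = 0 := ge0_Im (gform_ge0 K n x).
rewrite lecE Re_le andbT Im0 /=; apply/eqP; under eq_fun do rewrite Im0.
exact: (cvg_lim (@Rhausdorff R) (cvg_cst _)).
Qed.

Lemma inner_ge0 x : 0 <= inner x x.
Proof. exact: le_trans (gform_ge0 K 0 x) (gform_le_inner 0 x). Qed.

Lemma inner_eq0 x : inner x x = 0 -> x = 0.
Proof.
move=> x0; apply: coords_inj => w; apply: (gform_definite E) => N.
by apply/le_anti; rewrite gform_ge0 -[in X in _ <= X]x0 gform_le_inner.
Qed.

Lemma hnorm_ge0 x : 0 <= hnorm x. Proof. exact: sqrtr_ge0. Qed.

Lemma sqr_hnorm x : hnorm x ^+ 2 = complex.Re (inner x x).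
Proof. by rewrite sqr_sqrtr // ge0_Re // inner_ge0. Qed.

Lemma innerxx x : inner x x = (hnorm x ^+ 2)%:C.
Proof. by rewrite sqr_hnorm RRe_real // ger0_real // inner_ge0. Qed.

Lemma hnorm_eq0 x : hnorm x = 0 -> x = 0.
Proof. by move=> x0; apply: inner_eq0; rewrite innerxx x0 expr0n. Qed.

Lemma sqr_hnormD x y : hnorm (x + y) ^+ 2 =
  hnorm x ^+ 2 + hnorm y ^+ 2 + 2 * complex.Re (inner x y).
Proof.
rewrite !sqr_hnorm innerDl !innerDr (inner_conj x y).
by case: (inner x y) (inner x x) (inner y y) => [a b] [c c'] [e e'] /=; lra.
Qed.

Lemma hnormZ a x : hnorm (a%:C *: x) = `|a| * hnorm x.
Proof.
apply/eqP; rewrite -(eqrXn2 (n := 2)) ?mulr_ge0 ?hnorm_ge0 //; apply/eqP.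
rewrite sqr_hnorm innerZl innerZr exprMn sqr_hnorm real_normK ?num_real //.
by case: (inner x x) => [c c'] /=; rewrite !(mul0r, mulr0, subr0, oppr0, addr0); ring.
Qed.

Lemma cauchy_schwarz x y : `|complex.Re (inner x y)| <= hnorm x * hnorm y.
Proof.
have [y0|y0] := eqVneq (hnorm y) 0.
  by rewrite (hnorm_eq0 y0) inner_conj inner0l rmorph0 normr0 mulr_ge0 ?hnorm_ge0.
have yp : 0 < hnorm y by rewrite lt_neqAle eq_sym y0 hnorm_ge0.
set b := complex.Re (inner x y).
(* Up to the cleared denominator [hnorm y ^+ 2], this is the component of [x] orthogonal to [y] for
   the real part of the inner product. *)
have := sqr_ge0 (hnorm ((hnorm y ^+ 2)%:C *: x + (- b)%:C *: y)).
rewrite sqr_hnormD !hnormZ innerZl innerZr !exprMn !real_normK ?num_real //.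
have -> : complex.Re ((hnorm y ^+ 2)%:C * (conjc (- b)%:C * inner x y)) = - hnorm y ^+ 2 * b ^+ 2.
  rewrite /b; case: (inner x y) => c c' /=.
  by rewrite !(mul0r, mulr0, subr0, oppr0, addr0); ring.
have -> : (hnorm y ^+ 2) ^+ 2 * hnorm x ^+ 2 + (- b) ^+ 2 * hnorm y ^+ 2 +
    2 * (- hnorm y ^+ 2 * b ^+ 2) = hnorm y ^+ 2 * ((hnorm x * hnorm y) ^+ 2 - b ^+ 2) by ring.
rewrite pmulr_rge0 ?exprn_gt0 // subr_ge0 -[b ^+ 2]real_normK ?num_real //.
by rewrite ler_pXn2r // ?nnegrE ?mulr_ge0 ?hnorm_ge0.
Qed.

Lemma ler_hnormD x y : hnorm (x + y) <= hnorm x + hnorm y.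
Proof.
rewrite -(ler_pXn2r (n := 2)) // ?nnegrE ?addr_ge0 ?hnorm_ge0 // sqr_hnormD.
have := le_trans (ler_norm _) (cauchy_schwarz x y).
by rewrite sqrrD; lra.
Qed.

Lemma trunc_summable N x : trunc N x \in square_summable K.
Proof.
have /asboolP[M HM] := coords_summable x; apply/asboolP; exists M => n.
have NN : K (maxn N n) (trunc N x) (trunc N x) = K N x x.
  rewrite (gform_trunc E) ?leq_maxl // gform_conj (gform_trunc E) //.
  by rewrite -gform_conj.
by apply: le_trans (HM N); rewrite -NN gform_mono ?leq_maxr.
Qed.

Definition cut_vector N x : H := HilbertSum (trunc_summable N x).

Lemma sqr_hnorm_cut N x : hnorm (x - cut_vector N x) ^+ 2 =
  hnorm x ^+ 2 - complex.Re (K N x x).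
Proof.
have : ccvg (fun n => K n (x - cut_vector N x) (x - cut_vector N x)) (inner x x - K N x x).
  apply: (@ccvg_shift _ _ _ N).
  have -> : (fun n => K (n + N) (x - cut_vector N x) (x - cut_vector N x)) =
      (fun n => K (n + N) x x + - K N x x).
    by apply/funext => n; rewrite -[RHS]gform_sub_trunc ?leq_addl.
  apply: ccvgD; last exact: ccvg_cst.
  exact: (ccvg_subseq N (inner_ccvg x x)).
by move=> /inner_eq xx; rewrite !sqr_hnorm xx; case: (inner x x) (K N x x) => ? ? [].
Qed.

Lemma cut_vector_span N x : exists s : seq W,
  cut_vector N x = \sum_(v <- s) x v *: basis_vector E v.
Proof.
have [s sE] := trunc_span E N x; exists s; apply: coords_inj => w.
rewrite /= sE; elim: {sE}s => [|v s IH]; rewrite ?big_nil // !big_cons.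
by rewrite IH.
Qed.

(** Truncations are finite combinations of basis vectors and converge in norm. [F] is merely
    additive because it will be the real part of a complex form; this is why it must vanish on all
    complex multiples of basis vectors. *)
Lemma dense_functional_eq0 (F : H -> R) (M : R) :
  {morph F : x y / x + y} -> (forall x, `|F x| <= M * hnorm x) ->
  (forall a w, F (a *: basis_vector E w) = 0) -> forall x, F x = 0.
Proof.
move=> FD FM Fb x.
have F0 : F 0 = 0 by apply: (addrI (F 0)); rewrite -FD !addr0.
have Fcut N : F (cut_vector N x) = 0.
  have [s ->] := cut_vector_span N x.
  by elim: s => [|v s IH]; rewrite ?big_nil // big_cons FD Fb IH addr0.
have FN N : F x ^+ 2 <= M ^+ 2 * (hnorm x ^+ 2 - complex.Re (K N x x)).
  have -> : F x = F (x - cut_vector N x).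
    by have := FD (x - cut_vector N x) (cut_vector N x); rewrite subrK Fcut addr0.
  rewrite -sqr_hnorm_cut -exprMn -real_normK ?num_real //.
  by rewrite ler_pXn2r ?nnegrE // (le_trans _ (FM _)).
have : F x ^+ 2 <= M ^+ 2 * (hnorm x ^+ 2 - hnorm x ^+ 2).
  have /cvg_lim <- // : ((fun N => M ^+ 2 * (hnorm x ^+ 2 - complex.Re (K N x x))) @ \oo
      --> M ^+ 2 * (hnorm x ^+ 2 - hnorm x ^+ 2))%classic.
    apply: cvgM; first exact: cvg_cst; apply: cvgB; first exact: cvg_cst.
    by rewrite sqr_hnorm; have [] := inner_ccvg x x.
  apply: limr_ge; last by apply: nearW.
  apply: is_cvgM; first exact: is_cvg_cst.
  by apply: is_cvgB; [exact: is_cvg_cst | exact: gform_cvg_self].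
by rewrite subrr mulr0 => Fx; apply/eqP; rewrite -sqrf_eq0 eq_le Fx sqr_ge0.
Qed.

Implicit Types A B : H -> H.

Lemma bounded_operatorD A x y : bounded_operator A -> A (x + y) = A x + A y.
Proof. by move=> [Al _]; have := Al 1 x y; rewrite !scale1r. Qed.

Lemma bounded_operator0 A : bounded_operator A -> A 0 = 0.
Proof. by move=> bA; apply: (addrI (A 0)); rewrite -(bounded_operatorD 0 0 bA) !addr0. Qed.

Lemma bounded_operatorZ A a x : bounded_operator A -> A (a *: x) = a *: A x.
Proof.
by move=> bA; have [Al _] := bA; have := Al a x 0; rewrite (bounded_operator0 bA) !addr0.
Qed.

Lemma bounded_operator_ge0 A : bounded_operator A ->
  exists2 M : R, 0 <= M & forall x, hnorm (A x) <= M * hnorm x.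
Proof.
move=> [_ [M AM]]; exists `|M| => // x; apply: le_trans (AM x) _.
by rewrite ler_wpM2r ?hnorm_ge0 // ler_norm.
Qed.

Lemma bounded_operator_comp A B :
  bounded_operator A -> bounded_operator B -> bounded_operator (A \o B).
Proof.
move=> bA bB; split=> [a x y /=|].
  rewrite (bounded_operatorD _ _ bB) (bounded_operatorZ _ _ bB).
  by rewrite bounded_operatorD // bounded_operatorZ.
have [M M0 AM] := bounded_operator_ge0 bA; have [_ [M' BM]] := bB.
by exists (M * M') => x /=; rewrite -mulrA (le_trans (AM _)) // ler_wpM2l.
Qed.

Lemma bounded_operator_add A B :
  bounded_operator A -> bounded_operator B -> bounded_operator (A + B).
Proof.
move=> bA bB; split=> [a x y /=|].
  rewrite !fctE (bounded_operatorD _ _ bA) (bounded_operatorD _ _ bB)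
    (bounded_operatorZ _ _ bA) (bounded_operatorZ _ _ bB) scalerDr.
  by rewrite addrACA.
have [_ [M AM]] := bA; have [_ [M' BM]] := bB.
exists (M + M') => x; rewrite mulrDl fctE (le_trans (ler_hnormD _ _)) //.
exact: lerD.
Qed.

Lemma bounded_operator_zero : bounded_operator (0 : H -> H).
Proof.
have zE x : (0 : H -> H) x = 0 by [].
split=> [a x y|]; first by rewrite !zE scaler0 addr0.
by exists 0 => x; rewrite zE mul0r /hnorm inner0l sqrtr0.
Qed.

Lemma bounded_operator_sum (I : Type) (r : seq I) (F : I -> H -> H) :
  (forall i, bounded_operator (F i)) -> bounded_operator (\sum_(i <- r) F i).
Proof.
move=> bF; elim: r => [|i r IH]; first by rewrite big_nil; apply: bounded_operator_zero.
by rewrite big_cons; apply: bounded_operator_add.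
Qed.

(** Tested against the fixed vector z = A x - B x, the difference of the operators is a bounded
    functional vanishing on the basis. This identifies the creation and tensor operators chosen by
    [xget] with explicit coordinate maps. *)
Lemma bounded_operator_eq A B : bounded_operator A -> bounded_operator B ->
  (forall w, A (basis_vector E w) = B (basis_vector E w)) -> A =1 B.
Proof.
move=> bA bB AB x.
have [M _ AM] := bounded_operator_ge0 bA; have [M' _ BM] := bounded_operator_ge0 bB.
pose z := A x - B x; suff z0 : hnorm z ^+ 2 = 0.
  by apply/eqP; rewrite -subr_eq0; apply/eqP/hnorm_eq0/eqP; rewrite -sqrf_eq0 z0.
rewrite sqr_hnorm.
apply: (@dense_functional_eq0 (fun x => complex.Re (inner (A x - B x) z))
    ((M + M') * hnorm z)) => [u v|u|a w].
- by rewrite (bounded_operatorD _ _ bA) (bounded_operatorD _ _ bB) opprD addrACA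
    (innerDl (A u - B u)) ReD.
- apply: le_trans (cauchy_schwarz _ _) _; rewrite mulrAC ler_wpM2r ?hnorm_ge0 //.
  apply: le_trans (ler_hnormD _ _) _; rewrite mulrDl lerD //.
  suff -> : hnorm (- B u) = hnorm (B u) by [].
  by rewrite -scaleN1r -[-1](rmorphN1 (real_complex R)) hnormZ normrN1 mul1r.
- by rewrite (bounded_operatorZ _ _ bA) (bounded_operatorZ _ _ bB) AB subrr inner0l.
Qed.

Lemma adjoint_unique A B B' : is_adjoint A B -> is_adjoint A B' -> B =1 B'.
Proof.
move=> AB AB' y; apply/eqP; rewrite -subr_eq0; apply/eqP/inner_eq0.
by rewrite innerBr -AB -AB' subrr.
Qed.

(** Density is applied in each variable in turn, to the real part only; the imaginary part is the
    real part at [- 'i *: x]. *)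
Lemma is_adjoint_basis A B : bounded_operator A -> bounded_operator B ->
  (forall v w, inner (A (basis_vector E v)) (basis_vector E w) =
               inner (basis_vector E v) (B (basis_vector E w))) ->
  is_adjoint A B.
Proof.
move=> bA bB AB.
have [M _ AM] := bounded_operator_ge0 bA; have [M' _ BM] := bounded_operator_ge0 bB.
pose F x y := complex.Re (inner (A x) y - inner x (B y)).
have FM x y : `|F x y| <= (M + M') * hnorm x * hnorm y.
  rewrite /F -mulrA mulrDl ReD -[- inner _ _]mulN1r -innerZl.
  apply: le_trans (ler_normD _ _) _; apply: lerD; apply: le_trans (cauchy_schwarz _ _) _.
    by rewrite mulrA ler_wpM2r ?hnorm_ge0.
  rewrite -[-1](rmorphN1 (real_complex R)) hnormZ normrN1 mul1r mulrCA.
  by rewrite ler_wpM2l ?hnorm_ge0.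
have F0 v y a : F (a *: basis_vector E v) y = 0.
  move: y; apply: (@dense_functional_eq0 _
    ((M + M') * hnorm (a *: basis_vector E v))) => [y z|y|b w].
  - by rewrite /F (bounded_operatorD _ _ bB) !innerDr opprD addrACA ReD.
  - exact: FM.
  - rewrite /F (bounded_operatorZ _ _ bA) (bounded_operatorZ _ _ bB) !innerZl !innerZr.
    by rewrite AB mulrCA subrr.
have FF x y : F x y = 0.
  move: x; apply: (@dense_functional_eq0 _ ((M + M') * hnorm y)) => [x z|x|a v].
  - by rewrite /F (bounded_operatorD _ _ bA) !innerDl opprD addrACA ReD.
  - by rewrite mulrAC.
  - exact: F0.
move=> x y; apply/eqP; rewrite -subr_eq0; apply/eqP/complex_eqP; first exact: FF.
have := FF (- 'i *: x) y; rewrite /F (bounded_operatorZ _ _ bA) !innerZl -mulrBr.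
by case: (_ - _) => a b /=; lra.
Qed.

Section LiftOperator.
Variables (T : (W -> C) -> W -> C) (M : R) (k : nat).
Hypothesis M_ge0 : 0 <= M.
Hypothesis T_bound : forall N f, K N (T f) (T f) <= M%:C * K (N + k) f f.

(** [T] may lower degrees by up to [k], so the partial form of the image at N is compared with that
    of the argument at N + k; in the limit both become full inner products. *)
Fact lift_summable x : T x \in square_summable K.
Proof.
have /asboolP[M' HM'] := coords_summable x; apply/asboolP; exists (M * M') => N.
by rewrite (le_trans (T_bound N x)) // rmorphM ler_wpM2l // lecR.
Qed.

Definition lift_operator x : H := HilbertSum (lift_summable x).

Lemma bounded_lift_operator :
  (forall a f g, T (a *: f + g) = a *: T f + T g) -> bounded_operator lift_operator.
Proof.
move=> Tlin; split=> [a x y|]; first by apply: coords_inj => w; rewrite /= Tlin.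
exists (Num.sqrt M) => x.
rewrite -(ler_pXn2r (n := 2)) // ?nnegrE ?mulr_ge0 ?sqrtr_ge0 // exprMn (sqr_sqrtr M_ge0).
rewrite !sqr_hnorm; apply: limr_le; first exact: (@gform_cvg_self (lift_operator x)).
apply: nearW => N; have -> : M * complex.Re (inner x x) = complex.Re (M%:C * inner x x).
  by rewrite ReM /= mul0r subr0.
apply: le_Re; apply: le_trans (T_bound N x) _.
by rewrite ler_wpM2l ?lecR // gform_le_inner.
Qed.

End LiftOperator.

End HilbertSumTheory.

(** * Creation, annihilation and field operators *)

Section FockCoordinates.
Variables (R : realType) (d : nat) (q : R) (hq : -1 < q < 1).
Local Notation C := R[i].
Local Notation word := (seq 'I_d).
Implicit Types (f g : word -> C) (h : word * word -> C).

Definition basis_word (w : word) : qfock d hq := pure hq [seq delta_mx 0 i | i <- w].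

Lemma basis_wordE w v : basis_word w v = (w == v)%:R.
Proof.
rewrite /=; elim: w v => [|i w IH] [|j v] //=.
by rewrite IH mxE eqxx /= eqseq_cons eq_sym -natrM mulnb.
Qed.

Definition short (N : nat) (w : word) := (size w < N)%N.

Lemma short_words N : exists2 s : seq word, uniq s & forall w, (w \in s) = short N w.
Proof.
elim: N => [|N [s us sE]]; first by exists [::].
exists (s ++ [seq tval t | t <- enum {: N.-tuple 'I_d}]) => [|w].
  rewrite cat_uniq us map_inj_uniq ?enum_uniq ?andbT; last exact: val_inj.
  apply/hasPn => _ /mapP[t _ ->]; rewrite /= sE /short size_tuple ltnn //.
rewrite mem_cat sE /short ltnS [RHS]leq_eqVlt orbC; congr (_ || _).
apply/mapP/eqP => [[t _ ->]|/eqP wN]; first by rewrite size_tuple.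
by exists (Tuple wN); rewrite ?mem_enum.
Qed.

Lemma fock_trunc N n f g : (N <= n)%N ->
  fock_partial q n (fun w => if short N w then f w else 0) g = fock_partial q N f g.
Proof.
move=> Nn; rewrite /fock_partial.
rewrite (big_ord_widen n (fun k => gram_sum (@qgram _ _ q k) (fun u => f u) (fun v => g v)) Nn).
rewrite [RHS]big_mkcond; apply: eq_bigr => k _; rewrite /gram_sum /short.
case: ifP => kN.
  by apply: eq_bigr => u _; apply: eq_bigr => v _; rewrite size_tuple kN.
by rewrite big1 // => u _; rewrite big1 // => v _; rewrite size_tuple kN !mul0r.
Qed.

Lemma fock_definite f : (forall N, fock_partial q N f f = 0) -> forall w, f w = 0.
Proof.
move=> f0 w; have := f0 (size w).+1; rewrite /fock_partial big_ord_recr /= => /eqP.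
rewrite paddr_eq0 ?fock_partial_ge0 //; last exact/gram_sum_ge0/qgram_factorizable.
by move=> /andP[_ /eqP/(qgram_definite hq)/(_ (in_tuple w))].
Qed.

Lemma fock_span N f : exists s : seq word, forall w,
  (if short N w then f w else 0) = \sum_(v <- s) f v * basis_word v w.
Proof.
have [s us sE] := short_words N; exists s => w.
under eq_bigr => v _ do rewrite basis_wordE.
case: ifP => wN; rewrite -sE in wN.
  rewrite (bigD1_seq w) //= eqxx mulr1 big1 ?addr0 // => v /negPf ->.
  by rewrite mulr0.
rewrite big_seq big1 // => v vs; case: eqP => [vw|_]; last by rewrite mulr0.
by rewrite -vw vs in wN.
Qed.

Definition fock_coordinates : coordinate_system (fock_form d hq) :=
  @CoordinateSystem R word (fock_form d hq) short fock_trunc fock_definite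
    basis_word fock_span.

(* [fock2_partial] sums over squares; operators acting on one tensor factor
   only are controlled through sums over rectangles. *)
Definition fock2_rect N M (h h' : word * word -> C) : C :=
  \sum_(n < N) \sum_(m < M)
    gram_sum (fun u v : n.-tuple 'I_d * m.-tuple 'I_d =>
        qgram q u.1 v.1 * qgram q u.2 v.2)
      (fun u => h (tval u.1, tval u.2)) (fun v => h' (tval v.1, tval v.2)).

Lemma fock2_gram_ge0 n m h : 0 <=
  gram_sum (fun u v : n.-tuple 'I_d * m.-tuple 'I_d =>
      qgram q u.1 v.1 * qgram q u.2 v.2)
    (fun u => h (tval u.1, tval u.2)) (fun v => h (tval v.1, tval v.2)).
Proof.
by apply/gram_sum_ge0/factorizable_prod; apply: qgram_factorizable.
Qed.

Definition short2 N (w : word * word) := short N w.1 && short N w.2.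

Lemma fock2_trunc N n h h' : (N <= n)%N ->
  fock2_partial q n (fun w => if short2 N w then h w else 0) h' = fock2_partial q N h h'.
Proof.
move=> Nn; rewrite /fock2_partial.
pose G k l := gram_sum (fun u v : k.-tuple 'I_d * l.-tuple 'I_d =>
        qgram q u.1 v.1 * qgram q u.2 v.2)
      (fun u => h (tval u.1, tval u.2)) (fun v => h' (tval v.1, tval v.2)).
rewrite (big_ord_widen n (fun k => \sum_(l < N) G k l) Nn).
rewrite [RHS]big_mkcond; apply: eq_bigr => k _.
transitivity (\sum_(l < n) if (k < N)%N && (l < N)%N then G k l else 0).
  apply: eq_bigr => l _; rewrite /gram_sum /short2 /short /=; case: ifP => kN.
    by apply: eq_bigr => u _; apply: eq_bigr => v _; rewrite !size_tuple kN.
  by rewrite big1 // => u _; rewrite big1 // => v _; rewrite !size_tuple kN !mul0r.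
case: ifP => kN; last by rewrite big1.
by rewrite (big_ord_widen n (G k) Nn) [RHS]big_mkcond.
Qed.

Lemma fock2_definite h : (forall N, fock2_partial q N h h = 0) -> forall w, h w = 0.
Proof.
move=> h0 [w w']; have := h0 (maxn (size w) (size w')).+1.
have wm : (size w < (maxn (size w) (size w')).+1)%N by rewrite ltnS leq_maxl.
have wm' : (size w' < (maxn (size w) (size w')).+1)%N by rewrite ltnS leq_maxr.
move=> /eqP; rewrite psumr_eq0 =>
  [/allP/(_ (Ordinal wm))/[!mem_index_enum]/(_ isT)/=|n _]; last first.
  by apply: sumr_ge0 => m _; apply: fock2_gram_ge0.
rewrite psumr_eq0 =>
  [/allP/(_ (Ordinal wm'))/[!mem_index_enum]/(_ isT)/=/eqP H|m _]; last first.
  exact: fock2_gram_ge0.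
have D n : definite_gram (@qgram R d q n) by apply: qgram_definite.
have F n : factorizable (@qgram R d q n) by apply: qgram_factorizable.
exact: (definite_gram_prod (F _) (F _) (D _) (D _) H (in_tuple w, in_tuple w')).
Qed.

Definition basis_word2 (w : word * word) : qfock2 d hq :=
  tensor (basis_word w.1) (basis_word w.2).

Lemma basis_word2E w v : basis_word2 w v = (w == v)%:R.
Proof.
case: w v => [w w'] [v v'].
have -> : basis_word2 (w, w') (v, v') = basis_word w v * basis_word w' v' by [].
by rewrite !basis_wordE -natrM mulnb xpair_eqE.
Qed.

Lemma fock2_span N h : exists s : seq (word * word), forall w,
  (if short2 N w then h w else 0) = \sum_(v <- s) h v * basis_word2 v w.
Proof.
have [s us sE] := short_words N.
pose s2 := [seq (u, v) | u <- s, v <- s]; exists s2 => w.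
have us2 : uniq s2 by apply: allpairs_uniq => // -[? ?] [? ?].
have s2E v : (v \in s2) = short2 N v.
  rewrite /short2 -!sE; apply/allpairsP/andP => [[p [ps ps' ->]] //|[vs vs']].
  by exists v; split=> //; case: (v).
under eq_bigr => v _ do rewrite basis_word2E.
case: ifP => wN; rewrite -s2E in wN.
  rewrite (bigD1_seq w) //= eqxx mulr1 big1 ?addr0 // => v /negPf ->.
  by rewrite mulr0.
rewrite big_seq big1 // => v vs; case: eqP => [vw|_]; last by rewrite mulr0.
by rewrite -vw vs in wN.
Qed.

Definition fock2_coordinates : coordinate_system (fock2_form d hq) :=
  @CoordinateSystem R (word * word) (fock2_form d hq) short2 fock2_trunc fock2_definite
    basis_word2 fock2_span.

End FockCoordinates.

Section FockOperators.
Variables (R : realType) (d : nat) (q : R) (hq : -1 < q < 1).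
Local Notation C := R[i].
Local Notation word := (seq 'I_d).
Local Notation Q := (q%:C : C).
Implicit Types (f g : word -> C) (i : 'I_d).

Lemma create_linear i a f g :
  create i (a *: f + g) = a *: (create i f : word -> C) + create i g.
Proof.
apply/funext => -[|j w] /=; rewrite !fctE /= ?scaler0 ?addr0 //.
by rewrite mulrDr; congr (_ + _); apply: mulrCA.
Qed.

Lemma annihilate_linear i a f g :
  annihilate Q i (a *: f + g) = a *: (annihilate Q i f) + annihilate Q i g.
Proof.
apply/funext => w; rewrite !fctE /= /annihilate scaler_sumr -big_split /=.
by apply: eq_bigr => k _; rewrite mulrDr; congr (_ + _); apply: mulrCA.
Qed.

Lemma field_step_linear i a f g :
  field_step Q i (a *: f + g) = a *: (field_step Q i f) + field_step Q i g.
Proof.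
apply/funext => w.
have := congr1 (fun u => u w) (create_linear i a f g).
have := congr1 (fun u => u w) (annihilate_linear i a f g).
by rewrite !fctE /field_step => -> ->; rewrite scalerDr addrACA.
Qed.

(** Position 0 removes the letter just created; every later position has to pass it, which costs one
    factor q. *)
Lemma annihilate_create i f :
  annihilate Q i (create i f) = f + Q *: create i (annihilate Q i f).
Proof.
apply/funext => w; rewrite !fctE /annihilate big_ord_recl expr0 mul1r.
rewrite /insert_at take0 drop0 /= eqxx mul1r; congr (_ + _).
case: w => [|j w] /=; first by rewrite big_ord0 scaler0.
rewrite mulr_sumr scaler_sumr; apply: eq_bigr => k _.
by rewrite exprS /insert_at /= -mulrA; congr (_ * _); apply: mulrCA.
Qed.

Lemma fock_partial_create N i f g :
  fock_partial q N.+1 (create i f) g = fock_partial q N f (annihilate Q i g).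
Proof.
rewrite /fock_partial big_ord_recl [X in X + _](_ : _ = 0) ?add0r.
  by apply: eq_bigr => n _; apply: gram_sum_create.
rewrite /gram_sum big1 // => u _; rewrite big1 // => v _.
by rewrite tuple0 /= !mul0r.
Qed.

Local Notation K := (fock_form d hq).

Lemma fock_create i N f g : K N.+1 (create i f) g = K N f (annihilate Q i g).
Proof. exact: fock_partial_create. Qed.

(** The solution of 1 + |q| c = c, the equation on which the induction in [create_bound] closes. *)
Let c := (1 - `|q|)^-1.

Lemma create_bound_gt0 : 0 < c.
Proof. by rewrite invr_gt0 subr_gt0 ltr_norml. Qed.

(* Positivity of [c f - L_i a_i f] for the partial form. *)
Lemma annihilate_bound_step i N :
  (forall f, K N.+1 (create i f) (create i f) <= c%:C * K N f f) ->
  forall f, K N (annihilate Q i f) (annihilate Q i f) <= c%:C * K N.+1 f f.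
Proof.
move=> IH f; set y := annihilate Q i f.
have c0 : 0 < c%:C :> C by rewrite ltcR create_bound_gt0.
have yE : K N.+1 (create i y) f = K N y y by rewrite fock_create.
have yE' : K N.+1 f (create i y) = K N y y.
  by rewrite gform_conj yE -gform_conj.
have := gform_ge0 K N.+1 (c%:C *: f - create i y).
rewrite !gformBl !gformBr !gformZl !gformZr conjc_real yE yE'.
move=> H; rewrite -(ler_pM2l c0) -subr_ge0.
apply: le_trans H _; rewrite -subr_ge0.
rewrite [X in 0 <= X](_ : _ = c%:C * K N y y - K N.+1 (create i y) (create i y)).
  by rewrite subr_ge0 IH.
by ring.
Qed.

(** The bounds for creation and annihilation are proved alternately. Creation at N controls
    annihilation at N, which through the q-commutation relation controls creation at N + 1 with
    constant 1 + |q| c. *)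
Lemma create_bound i N f : K N.+1 (create i f) (create i f) <= c%:C * K N f f.
Proof.
elim: N f => [|N IH] f.
  by rewrite fock_create /= /fock_partial !big_ord0 mulr0.
rewrite fock_create annihilate_create gformDr gformZr conjc_real.
rewrite (gform_conj K N.+1 (create i (annihilate Q i f)) f) fock_create.
rewrite -gform_conj.
have H := annihilate_bound_step IH f.
apply: (@le_trans _ _ (K N.+1 f f + `|q|%:C * (c%:C * K N.+1 f f))).
  rewrite lerD2l; apply: (@le_trans _ _ (`|q|%:C * K N (annihilate Q i f) (annihilate Q i f))).
    by rewrite ler_wpM2r ?gform_ge0 // lecR ler_norm.
  by rewrite ler_wpM2l // lecR.
rewrite mulrA -[X in X + _]mul1r -mulrDl.
rewrite [X in X * _](_ : _ = c%:C) // -rmorphM -(rmorph1 (real_complex R)) -rmorphD; congr (_%:C).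
have : 1 - `|q| != 0 by rewrite subr_eq0 eq_sym lt_eqF // ltr_norml.
by rewrite /c => ?; field.
Qed.

Lemma annihilate_bound i N f :
  K N (annihilate Q i f) (annihilate Q i f) <= c%:C * K N.+1 f f.
Proof. by apply: annihilate_bound_step => g; apply: create_bound. Qed.

Local Notation E := (fock_coordinates d hq).

Lemma create_bound1 i N f : K N (create i f) (create i f) <= c%:C * K (N + 1)%N f f.
Proof.
apply: le_trans (gform_mono E _ (leqnSn N)) _.
apply: le_trans (create_bound i N f) _.
by rewrite ler_wpM2l ?lecR ?(ltW create_bound_gt0) // (gform_mono E) // leq_addr.
Qed.

Lemma annihilate_bound1 i N f :
  K N (annihilate Q i f) (annihilate Q i f) <= c%:C * K (N + 1)%N f f.
Proof. by rewrite addn1; apply: annihilate_bound. Qed.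

Lemma field_step_bound i N f :
  K N (field_step Q i f) (field_step Q i f) <= (4 * c)%:C * K (N + 1)%N f f.
Proof.
have -> : field_step Q i f = create i f + annihilate Q i f by apply/funext.
(* The constant is 2 (c + c) = 4 c. *)
apply: le_trans (gform_parallelogram _ _ _ _) _.
rewrite [X in _ <= X](_ : _ = (c%:C * K (N + 1)%N f f + c%:C * K (N + 1)%N f f) *+ 2).
  by rewrite lerMn2r lerD ?create_bound1 ?annihilate_bound1.
by rewrite (rmorphM (real_complex R)) /= (rmorph_nat (real_complex R)); ring.
Qed.

Let c_ge0 : 0 <= c := ltW create_bound_gt0.

Definition creation_op i := lift_operator c_ge0 (create_bound1 i).
Definition annihilation_op i := lift_operator c_ge0 (annihilate_bound1 i).

Lemma creation_op_pure i s :
  creation_op i (pure hq s) = pure hq (delta_mx 0 i :: s).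
Proof. by apply: coords_inj => -[|j w] //=; rewrite mxE eqxx. Qed.

Lemma creationE i : creation (hq := hq) i = creation_op i.
Proof.
have bL : bounded_operator (creation_op i).
  exact/(bounded_lift_operator E)/create_linear.
have : [set A | bounded_operator A /\
    forall s, A (pure hq s) = pure hq (delta_mx 0 i :: s)]%classic (creation (hq := hq) i).
  by apply: xgetPex; exists (creation_op i); split=> // s; apply: creation_op_pure.
move=> [bC CE]; apply/funext; apply: (bounded_operator_eq (E := E) bC bL) => w.
by rewrite CE creation_op_pure.
Qed.

Lemma annihilation_op_adjoint i : is_adjoint (creation_op i) (annihilation_op i).
Proof.
move=> x y; apply: (inner_eq E); apply: (@ccvg_shift _ _ _ 1).
under eq_fun do rewrite addn1 [K _ _ _]fock_create.
exact: (inner_ccvg E x (annihilation_op i y)).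
Qed.

Lemma adjoint_creationE i : adjoint (creation (hq := hq) i) = annihilation_op i.
Proof.
have bA : bounded_operator (annihilation_op i).
  exact/(bounded_lift_operator E)/annihilate_linear.
have : [set B | bounded_operator B /\ is_adjoint (creation (hq := hq) i) B]%classic
    (adjoint (creation (hq := hq) i)).
  apply: xgetPex; exists (annihilation_op i); split=> //.
  by rewrite creationE; apply: annihilation_op_adjoint.
move=> [_ adj]; apply/funext; apply: (adjoint_unique E adj).
by rewrite creationE; apply: annihilation_op_adjoint.
Qed.

Lemma field_opE i (x : qfock d hq) : field_op (hq := hq) i x = field_step Q i x :> (word -> C).
Proof. by rewrite /field_op adjoint_creationE creationE. Qed.

Lemma field_op_adjoint i : is_adjoint (field_op (hq := hq) i) (field_op (hq := hq) i).
Proof.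
rewrite /field_op adjoint_creationE creationE => x y.
rewrite !fctE (innerDl E) (innerDr E) annihilation_op_adjoint addrC; congr (_ + _).
by rewrite (inner_conj E) -annihilation_op_adjoint -(inner_conj E).
Qed.

End FockOperators.

(** * Tensor products of coordinate operators *)

Section TensorOperators.
Variables (R : realType) (d : nat) (q : R) (hq : -1 < q < 1).
Local Notation C := R[i].
Local Notation word := (seq 'I_d).
Local Notation rect := (@fock2_rect R d q).
Implicit Types (f g : word -> C) (h : word * word -> C) (T : (word -> C) -> word -> C).

Definition left_op T h : word * word -> C := fun w => T (fun u => h (u, w.2)) w.1.
Definition right_op T h : word * word -> C := fun w => T (fun v => h (w.1, v)) w.2.
Definition tensor_op T h := left_op T (right_op T h).

(** Factoring the Gram matrix of the second variable splits the form into one-variable forms of the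
    partial contractions [hz]. A bound for [T] on the Fock space then passes to [T] acting on the
    first tensor factor. *)
Lemma fock2_rect_factor N m (Z : finType) (A : Z -> m.-tuple 'I_d -> R) h :
  (forall u v, qgram q u v = \sum_z A z u * A z v) ->
  \sum_(n < N) gram_sum (fun u v : n.-tuple 'I_d * m.-tuple 'I_d =>
        qgram q u.1 v.1 * qgram q u.2 v.2)
      (fun u => h (tval u.1, tval u.2)) (fun v => h (tval v.1, tval v.2)) =
  \sum_z let hz := fun u => \sum_(v : m.-tuple 'I_d) h (u, tval v) * (A z v)%:C in
    fock_partial q N hz hz.
Proof.
move=> GA; rewrite /fock_partial exchange_big; apply: eq_bigr => n _ /=.
rewrite /gram_sum [RHS]exchange_big /=.
rewrite -(pair_bigA _ (fun (u : n.-tuple 'I_d) (v : m.-tuple 'I_d) =>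
  \sum_(w : n.-tuple 'I_d * m.-tuple 'I_d)
     h (tval u, tval v) * conjc (h (tval w.1, tval w.2)) *
     (qgram q u w.1 * qgram q v w.2)%:C)) /=.
apply: eq_bigr => u _; rewrite [RHS]exchange_big /=.
under [LHS]eq_bigr => v _ do
  rewrite -(pair_bigA _ (fun (u' : n.-tuple 'I_d) (v' : m.-tuple 'I_d) =>
     h (tval u, tval v) * conjc (h (tval u', tval v')) *
     (qgram q u u' * qgram q v v')%:C)) /=.
rewrite [LHS]exchange_big /=; apply: eq_bigr => u' _.
transitivity (\sum_(v : m.-tuple 'I_d) \sum_(v' : m.-tuple 'I_d) \sum_z
    h (tval u, tval v) * (A z v)%:C * conjc (h (tval u', tval v') * (A z v')%:C) *
    (qgram q u u')%:C).
  apply: eq_bigr => v _; apply: eq_bigr => v' _.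
  rewrite GA mulr_sumr rmorph_sum mulr_sumr; apply: eq_bigr => z _.
  by rewrite conjcM conjc_real !rmorphM /=; ring.
under [LHS]eq_bigr => v _ do rewrite exchange_big /=.
rewrite exchange_big /=; apply: eq_bigr => z _.
rewrite conjc_sum !mulr_suml; apply: eq_bigr => v _.
by rewrite mulr_sumr mulr_suml.
Qed.

Lemma fock2_rect_swap N M h :
  rect N M h h = rect M N (fun w => h (w.2, w.1)) (fun w => h (w.2, w.1)).
Proof.
rewrite /fock2_rect exchange_big; apply: eq_bigr => m _; apply: eq_bigr => n _.
have sw_bij : bijective (fun u : m.-tuple 'I_d * n.-tuple 'I_d => (u.2, u.1)).
  by exists (fun u => (u.2, u.1)); case.
rewrite /gram_sum (reindex _ (onW_bij _ sw_bij)); apply: eq_bigr => u _ /=.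
rewrite (reindex _ (onW_bij _ sw_bij)); apply: eq_bigr => v _ /=.
by rewrite [in RHS](mulrC (qgram _ _ _)).
Qed.

Section Bounds.
Variables (T : (word -> C) -> word -> C) (M : R) (k : nat).
Hypothesis M_ge0 : 0 <= M.
Hypothesis T_linear : forall a f g, T (a *: f + g) = a *: T f + T g.
Hypothesis T_bound : forall N f,
  fock_partial q N (T f) (T f) <= M%:C * fock_partial q (N + k) f f.

Lemma linear_coords_sum (I : Type) (r : seq I) (F : I -> word -> C) (a : I -> C) w :
  T (fun u => \sum_(v <- r) F v u * a v) w = \sum_(v <- r) T (F v) w * a v.
Proof.
have T0 : T 0 = 0.
  by have := T_linear (-1) 0 0; rewrite scaler0 addr0 scaleN1r addNr.
elim: r => [|v r IH].
  rewrite big_nil (_ : (fun u => _) = 0) ?T0 //.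
  by apply/funext => u; rewrite big_nil.
rewrite big_cons -IH (_ : (fun u => _) = a v *: F v + (fun u => \sum_(v <- r) F v u * a v)).
  by rewrite T_linear !fctE mulrC.
by apply/funext => u; rewrite big_cons !fctE mulrC.
Qed.

Lemma left_op_bound N L h :
  rect N L (left_op T h) (left_op T h) <= M%:C * rect (N + k) L h h.
Proof.
rewrite /fock2_rect exchange_big [X in _ <= _ * X]exchange_big /= mulr_sumr.
apply: ler_sum => m _; have [Z [A GA]] := @qgram_factorizable R d q hq m.
rewrite !(fock2_rect_factor _ _ GA) mulr_sumr; apply: ler_sum => z _ /=.
set hz := fun u => \sum_(v : m.-tuple 'I_d) h (u, tval v) * (A z v)%:C.
have -> : (fun u => \sum_(v : m.-tuple 'I_d) left_op T h (u, tval v) * (A z v)%:C) = T hz.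
  by apply/funext => u; rewrite linear_coords_sum.
exact: T_bound.
Qed.

Lemma right_op_bound N L h :
  rect N L (right_op T h) (right_op T h) <= M%:C * rect N (L + k) h h.
Proof.
rewrite fock2_rect_swap (fock2_rect_swap N).
exact: (left_op_bound L N (fun w => h (w.2, w.1))).
Qed.

(** Each one-sided action lengthens one side of the index rectangle by [k], so a square of side N +
    k results. *)
Lemma tensor_op_bound N h : fock2_form d hq N (tensor_op T h) (tensor_op T h) <=
  (M * M)%:C * fock2_form d hq (N + k) h h.
Proof.
apply: le_trans (left_op_bound N N _) _.
rewrite rmorphM -mulrA ler_wpM2l ?lecR //; exact: right_op_bound.
Qed.

Lemma tensor_op_linear a h h' :
  tensor_op T (a *: h + h') = a *: tensor_op T h + tensor_op T h'.
Proof.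
have rl : right_op T (a *: h + h') = a *: right_op T h + right_op T h'.
  apply/funext => w; have := T_linear a (fun v => h (w.1, v)) (fun v => h' (w.1, v)).
  by move/(congr1 (fun u => u w.2)).
rewrite /tensor_op rl; apply/funext => w.
have := T_linear a (fun u => right_op T h (u, w.2)) (fun u => right_op T h' (u, w.2)).
by move/(congr1 (fun u => u w.1)).
Qed.

Lemma tensor_op_tensor f g w :
  tensor_op T (fun w => f w.1 * g w.2) w = T f w.1 * T g w.2.
Proof.
have TZ (a : C) f' u : T (fun v => f' v * a) u = T f' u * a.
  have := linear_coords_sum [:: tt] (fun _ => f') (fun=> a) u; rewrite big_seq1 => <-.
  by congr (T _ _); apply/funext => v; rewrite big_seq1.
rewrite /tensor_op /left_op /right_op /= -[RHS]TZ; congr (T _ _).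
apply/funext => u; rewrite mulrC -[RHS]TZ; congr (T _ _).
by apply/funext => v; rewrite mulrC.
Qed.

End Bounds.

End TensorOperators.

(** * The operator X and its vacuum moments *)

Section XOperator.
Variables (R : realType) (d : nat) (q : R) (hq : -1 < q < 1).
Local Notation C := R[i].
Local Notation word := (seq 'I_d).
Local Notation Q := (q%:C : C).
Local Notation E2 := (fock2_coordinates d hq).
Local Notation Y i := (@field_op R d q hq i).
Local Notation X_sum := (@X_sum R d q hq).
Local Notation Omega := (tensor (@vacuum R d q hq) (@vacuum R d q hq)).

Let c := 4 * (1 - `|q|)^-1.

Let c_ge0 : 0 <= c.
Proof. by rewrite mulr_ge0 // ltW // create_bound_gt0. Qed.

Definition pair_op i : qfock2 d hq -> qfock2 d hq :=
  lift_operator (mulr_ge0 c_ge0 c_ge0)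
    (tensor_op_bound hq c_ge0 (@field_step_linear R d q i) (field_step_bound hq i)).

Lemma bounded_pair_op i : bounded_operator (pair_op i).
Proof. exact/(bounded_lift_operator E2)/tensor_op_linear/field_step_linear. Qed.

Lemma pair_op_tensor i x y : pair_op i (tensor x y) = tensor (Y i x) (Y i y).
Proof.
apply: coords_inj => w.
have -> : tensor (Y i x) (Y i y) w = Y i x w.1 * Y i y w.2 by [].
rewrite !field_opE; exact: (tensor_op_tensor (@field_step_linear R d q i)).
Qed.

Lemma tensor_field_opE i : tensor_operator (Y i) (Y i) = pair_op i.
Proof.
have : [set Z | bounded_operator Z /\
    forall x y, Z (tensor x y) = tensor (Y i x) (Y i y)]%classic
    (tensor_operator (Y i) (Y i)).
  by apply: xgetPex; exists (pair_op i); split; [apply: bounded_pair_op | apply: pair_op_tensor].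
move=> [bZ ZE]; apply/funext.
by apply: (bounded_operator_eq (E := E2) bZ (bounded_pair_op i)) => w; rewrite ZE pair_op_tensor.
Qed.

Lemma inner_tensor (x y x' y' : qfock d hq) :
  inner (tensor x y) (tensor x' y') = inner x x' * inner y y'.
Proof.
apply: (inner_eq E2); under eq_fun do rewrite /= fock2_partial_tensor.
by apply: ccvgM; apply: (inner_ccvg (fock_coordinates d hq)).
Qed.

Lemma pair_op_adjoint i : is_adjoint (pair_op i) (pair_op i).
Proof.
apply: (is_adjoint_basis (E := E2) (bounded_pair_op i) (bounded_pair_op i)) => v w.
by rewrite !pair_op_tensor !inner_tensor !field_op_adjoint.
Qed.

Lemma X_sumE : X_sum = \sum_(i < d) pair_op i.
Proof. by apply: eq_bigr => i _; apply: tensor_field_opE. Qed.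

Lemma bounded_X_sum : bounded_operator X_sum.
Proof. by rewrite X_sumE; apply: (bounded_operator_sum E2) => i; apply: bounded_pair_op. Qed.

Lemma X_sum_adjoint : is_adjoint X_sum X_sum.
Proof.
move=> x y; rewrite X_sumE !fct_sumE (inner_suml E2) (inner_sumr E2).
by apply: eq_bigr => i _; apply: pair_op_adjoint.
Qed.

Lemma inner_vacuum2 (x : qfock2 d hq) : inner x Omega = x ([::], [::]).
Proof.
apply: (inner_eq E2); apply: (@ccvg_shift _ _ _ 1).
rewrite (_ : (fun n => _) = (fun=> x ([::], [::]))); first exact: ccvg_cst.
apply/funext => N; rewrite addn1 /= /fock2_partial big_ord_recl big_ord_recl.
rewrite [X in _ + X + _]big1 ?addr0 => [|m _]; last first.
  rewrite /gram_sum big1 // => u _; rewrite big1 // => -[v v'] _ /=.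
  by case/tupleP: v' => ? ?; rewrite /= mulr0 conjc0 mulr0 mul0r.
rewrite [X in _ + X]big1 ?addr0 => [|n _]; last first.
  rewrite big1 // => m _; rewrite /gram_sum big1 // => u _; rewrite big1 // => -[v v'] _ /=.
  by case/tupleP: v => ? ?; rewrite /= mul0r conjc0 mulr0 mul0r.
have q0 (u v : 0.-tuple 'I_d) : qgram q u v = 1.
  rewrite qgramE (bigD1 1%g) //= big1 ?addr0 => [|t]; last first.
    by move/eqP; case; apply/permP => -[].
  rewrite tuple0 (tuple0 (act_tuple _ _)) eqxx mulr1.
  rewrite /inversions (_ : [set _ | _]%SET = finset.set0) ?cards0 ?expr0 //.
  by apply/setP => -[[]].
rewrite /gram_sum (bigD1 ([tuple], [tuple])) //= [X in _ + X]big1 ?addr0; last first.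
  by move=> [u u'] /eqP[]; rewrite (tuple0 u) (tuple0 u').
rewrite (bigD1 ([tuple], [tuple])) //= [X in _ + X]big1 ?addr0; last first.
  by move=> [u u'] /eqP[]; rewrite (tuple0 u) (tuple0 u').
rewrite !q0 mulr1 mulr1 [X in _ * X](_ : _ = 1) ?mulr1 //.
by apply: complex_eqP => /=; ring.
Qed.

Definition wick_vector (s : seq 'I_d) : word -> C :=
  foldr (@field_step _ Q 'I_d) (@wick_vacuum _ 'I_d) s.

(** Each application acts by the same Y_i on both factors, so both carry the same word; at the
    vacuum coordinate this produces the squares. *)
Lemma iter_X_sum k w : iter k X_sum Omega w =
  \sum_(s : k.-tuple 'I_d) wick_vector s w.1 * wick_vector s w.2.
Proof.
elim: k w => [|k IH] w.
  rewrite (big_pred1 [tuple]) => [/=|s]; last by rewrite /= (tuple0 s); apply/esym/eqP.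
  by case: w => [[|? ?] [|? ?]] /=; rewrite /wick_vacuum /= ?mulr0.
rewrite iterS; set x := iter k _ _.
have xE : coords x = (fun w => \sum_(s : k.-tuple 'I_d)
    wick_vector s w.1 * wick_vector s w.2) by apply/funext => u; apply: IH.
rewrite X_sumE fct_sumE.
have coords_sum (r : seq 'I_d) F : (\sum_(i <- r) F i : qfock2 d hq) w = \sum_(i <- r) F i w.
  by elim: r => [|i r IHr]; rewrite ?big_nil // !big_cons -IHr.
rewrite coords_sum sum_tuple_cons; apply: eq_bigr => i _ /=.
rewrite xE.
have fsum := linear_coords_sum (@field_step_linear R d q i).
rewrite /tensor_op /left_op /right_op /=.
transitivity (field_step Q i (fun u => \sum_(s : k.-tuple 'I_d)
    wick_vector s u * field_step Q i (wick_vector s) w.2) w.1).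
  congr (field_step _ _ _ _); apply/funext => u.
  rewrite [RHS](eq_bigr (fun s : k.-tuple 'I_d =>
    field_step Q i (wick_vector s) w.2 * wick_vector s u)) => [|s _]; last exact: mulrC.
  rewrite -fsum; congr (field_step _ _ _ _); apply/funext => v.
  by apply: eq_bigr => s _; apply: mulrC.
by rewrite fsum.
Qed.

Lemma vacuum_moment n : (0 < n)%N ->
  inner (iter n (@X_operator R d q hq) Omega) Omega = (Ptilde n d%:R q)%:C.
Proof.
move=> n0; rewrite inner_vacuum2 (_ : iter n _ _ = iter (2 * n) X_sum Omega); last first.
  by rewrite mulnC iterM.
rewrite iter_X_sum PtildeE // rmorph_sum.
transitivity (\sum_(s : {ffun 'I_(2 * n) -> 'I_d}) suffix_vector Q s 0 [::] ^+ 2).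
  pose h (s : {ffun 'I_(2 * n) -> 'I_d}) := [tuple s j | j < 2 * n].
  rewrite (reindex h) /=; last first.
    exists (fun t : (2 * n).-tuple 'I_d => [ffun j => tnth t j]) => [s _|t _].
      by apply/ffunP => j; rewrite ffunE tnth_mktuple.
    by apply: eq_from_tnth => j; rewrite tnth_mktuple ffunE.
  apply: eq_bigr => s _; rewrite expr2 /suffix_vector drop0.
  by rewrite (_ : tval (h s) = [seq s j | j <- enum 'I_(2 * n)]) //= val_ord_tuple.
rewrite sum_square_q_wick card_ord; apply: eq_bigr => P _.
rewrite rmorph_sum; apply: eq_bigr => P' _.
by rewrite rmorphM !rmorphXn rmorph_nat.
Qed.

End XOperator.

(** * The Hausdorff moment problem *)

Section HausdorffMoments.
Variables (R : realType) (D : nat -> nat -> R).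
Hypothesis D_rec : forall k j, D k j = D k j.+1 + D k.+1 j.
Hypothesis D_ge0 : forall k j, 0 <= D k j.
Hypothesis D00 : D 0 0 = 1.

(** [D k j] stands for the integral of x^k (1 - x)^j and [D_rec] for x + (1 - x) = 1; this is the
    N-th power of the latter, integrated against x^a (1 - x)^b. *)
Lemma hausdorff_binomial N a b :
  \sum_(i < N.+1) 'C(N, i)%:R * D (a + i) (b + (N - i)) = D a b.
Proof.
elim: N a b => [|N IH] a b; first by rewrite big_ord1 bin0 mul1r !addn0.
rewrite D_rec -(IH a b.+1) -(IH a.+1 b) big_ord_recl [in RHS]big_ord_recl -addrA.
rewrite !bin0 !mul1r !addn0 !subn0 addSnnS; congr (_ + _).
under eq_bigr => i _ do rewrite /= /bump /= add1n binS natrD mulrDl.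
rewrite big_split /= [X in X + _ = _]big_ord_recr /= bin_small // mul0r addr0.
congr (_ + _); apply: eq_bigr => i _; last by rewrite addSnnS subSS.
rewrite /bump /= add1n subSS; congr (_ * D _ _).
by have := ltn_ord i; lia.
Qed.

(* The value at [g] of the discrete measure with mass C(n,k) D k (n - k) at
   k/n; compare the Bernstein polynomials. *)
Definition bernstein n (g : R -> R) : R :=
  \sum_(k < n.+1) 'C(n, k)%:R * D k (n - k) * g (k%:R / n%:R).

Lemma bernstein_le n g h : (forall x, 0 <= x <= 1 -> g x <= h x) ->
  bernstein n g <= bernstein n h.
Proof.
move=> gh; apply: ler_sum => k _; rewrite ler_wpM2l ?mulr_ge0 //.
apply: gh; rewrite divr_ge0 //=; case: (ltnP 0 n) => [n0|]; last first.
  by rewrite leqn0 => /eqP n0; rewrite [n%:R](_ : _ = 0) ?invr0 ?mulr0 // n0.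
by rewrite ler_pdivrMr ?ltr0n // mul1r ler_nat -ltnS.
Qed.

Lemma bernstein_lin n a g h :
  bernstein n (fun x => a * g x + h x) = a * bernstein n g + bernstein n h.
Proof.
rewrite /bernstein mulr_sumr -big_split; apply: eq_bigr => k _ /=.
by rewrite mulrDr mulrCA.
Qed.

Lemma bernstein_sum n N (a : 'I_N -> R) (g : 'I_N -> R -> R) :
  bernstein n (fun x => \sum_i a i * g i x) = \sum_i a i * bernstein n (g i).
Proof.
rewrite /bernstein; under eq_bigr => k _ do rewrite mulr_sumr.
rewrite exchange_big; apply: eq_bigr => i _; rewrite mulr_sumr.
by apply: eq_bigr => k _; rewrite mulrCA.
Qed.

Lemma bernstein_cst n a : bernstein n (fun=> a) = a.
Proof.
rewrite /bernstein -mulr_suml [X in X * _](_ : _ = 1) ?mul1r //.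
by rewrite -[RHS]D00 -[RHS](hausdorff_binomial n 0 0).
Qed.

Lemma bernstein_dist n g h e : (forall x, 0 <= x <= 1 -> `|g x - h x| <= e) ->
  `|bernstein n g - bernstein n h| <= e.
Proof.
move=> gh.
have hg : bernstein n (fun x => g x - h x) = bernstein n g - bernstein n h.
  have := bernstein_lin n (-1) h g; rewrite mulN1r addrC => <-.
  by apply: eq_bigr => k _; rewrite mulN1r addrC.
rewrite -hg ler_norml; apply/andP; split.
  rewrite -(bernstein_cst n (- e)); apply: bernstein_le => x /gh.
  by rewrite ler_norml => /andP[].
rewrite -[X in _ <= X](bernstein_cst n e); apply: bernstein_le => x /gh.
by rewrite ler_norml => /andP[].
Qed.

(** Falling factorials, unlike powers, have exact moments: ['C(n, k)] k^_j / n^_j is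
    ['C(n - j, k - j)], zero for k < j, so [hausdorff_binomial] applies with exponent n - j. *)
Lemma bernstein_ffact n j : (j <= n)%N ->
  \sum_(k < n.+1) 'C(n, k)%:R * D k (n - k) * ((k ^_ j)%:R / (n ^_ j)%:R) = D j 0.
Proof.
move=> jn.
have nj0 : (n ^_ j)%:R != 0 :> R by rewrite pnatr_eq0 -lt0n ffact_gt0.
rewrite -(hausdorff_binomial (n - j) j 0).
have -> : (n.+1 = j + (n - j).+1)%N by lia.
rewrite big_split_ord /= big1 ?add0r => [|k _]; last by rewrite ffact_small ?mul0r ?mulr0.
apply: eq_bigr => k _; rewrite add0n.
have -> : (n - (j + k) = n - j - k)%N by lia.
rewrite mulrAC; congr (_ * _); apply: (mulIf nj0); rewrite mulrA mulfVK //.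
rewrite -!natrM; congr (_%:R).
have kn : (j + k <= n)%N by have := ltn_ord k; lia.
have E : ((j + k)`! * (n - (j + k))`! > 0)%N by rewrite muln_gt0 !fact_gt0.
apply/eqP; rewrite -(eqn_pmul2r (fact_gt0 (j + k - j))) -(eqn_pmul2r (fact_gt0 (n - (j + k)))).
rewrite -[X in (X * _)%N == _]mulnA ffact_fact ?leq_addr // -mulnA bin_fact //.
rewrite mulnAC -[in X in _ == X]mulnA.
have := bin_fact (_ : k <= n - j)%N => /(_ ltac:(lia)) B.
have -> : (j + k - j = k)%N by lia.
have -> : (n - (j + k) = n - j - k)%N by lia.
have := ffact_fact jn => F.
rewrite -F -B; apply/eqP; ring.
Qed.

(** The ratio is the product of (k - i)/(n - i) over i < j. Replacing these factors by k/n one at a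
    time costs at most i/n each, and j^2 + j <= (j + 1)^2 carries the induction. *)
Lemma ffact_ratio_dist n k j : (j <= n)%N -> (k <= n)%N -> (0 < n)%N ->
  `|(k%:R / n%:R) ^+ j - (k ^_ j)%:R / (n ^_ j)%:R| <= (j ^ 2)%:R / n%:R :> R.
Proof.
move=> jn kn n0; have n0' : 0 < n%:R :> R by rewrite ltr0n.
have x01 : 0 <= (k%:R / n%:R : R) <= 1.
  by rewrite divr_ge0 //= ler_pdivrMr // mul1r ler_nat.
have /andP[x0 x1] := x01.
elim: j jn => [|j IH] jn; first by rewrite expr0 !ffactn0 divr1 subrr normr0 divr_ge0.
have jn' := ltnW jn; have {}IH := IH jn'.
pose p : R := (k ^_ j)%:R / (n ^_ j)%:R.
have njgt : 0 < (n ^_ j)%:R :> R by rewrite ltr0n ffact_gt0.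
have p01 : 0 <= p <= 1.
  rewrite divr_ge0 //= ler_pdivrMr // mul1r ler_nat.
  by rewrite !ffact_prod; apply: leq_prod => i _; apply: leq_sub2r.
have /andP[p0 p1] := p01.
pose y : R := (k - j)%:R / (n - j)%:R.
have pE : (k ^_ j.+1)%:R / (n ^_ j.+1)%:R = p * y.
  by rewrite !ffactnSr !natrM invfM mulrACA.
have -> : (k%:R / n%:R) ^+ j.+1 - (k ^_ j.+1)%:R / (n ^_ j.+1)%:R =
    k%:R / n%:R * ((k%:R / n%:R) ^+ j - p) + p * (k%:R / n%:R - y).
  by rewrite pE exprS; ring.
apply: le_trans (ler_normD _ _) _.
apply: (@le_trans _ _ ((j ^ 2)%:R / n%:R + j%:R / n%:R)); last first.
  by rewrite -mulrDl ler_pM2r ?invr_gt0 // -natrD ler_nat; nia.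
apply: lerD; first by rewrite normrM (ger0_norm x0) -[X in _ <= X]mul1r ler_pM.
(* For k < j the subtraction in [y] truncates, but then [p] is 0. *)
case: (ltnP k j) => kj; first by rewrite /p ffact_small // mul0r mul0r normr0 divr_ge0.
rewrite normrM (ger0_norm p0) -[X in _ <= X]mul1r ler_pM //.
have nj : 0 < (n - j)%:R :> R by rewrite ltr0n subn_gt0.
have -> : k%:R / n%:R - y = j%:R / n%:R * ((n - k)%:R / (n - j)%:R).
  rewrite /y !natrB //; rewrite natrB // in nj.
  by field; rewrite !gt_eqF.
rewrite normrM !ger0_norm ?divr_ge0 // -[X in _ <= X]mulr1 ler_wpM2l ?divr_ge0 //.
by rewrite ler_pdivrMr // mul1r ler_nat leq_sub2l.
Qed.

Lemma bernstein_moment n j : (j <= n)%N -> (0 < n)%N ->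
  `|bernstein n (fun x => x ^+ j) - D j 0| <= (j ^ 2)%:R / n%:R.
Proof.
move=> jn n0; rewrite -(bernstein_ffact jn) -sumrB.
apply: le_trans (ler_norm_sum _ _ _) _.
rewrite -[X in _ <= X](bernstein_cst n); apply: ler_sum => k _.
rewrite -mulrBr normrM ger0_norm ?mulr_ge0 // ler_wpM2l ?mulr_ge0 //.
by apply: ffact_ratio_dist => //; rewrite -ltnS.
Qed.

End HausdorffMoments.

(** * Monomials as step functions, and limits along ultrafilters *)

Section StepApproximation.
Variable R : realType.
Implicit Types (x y a b t : R).

Lemma exprn_dist m x y : `|x| <= 1 -> `|y| <= 1 ->
  `|x ^+ m - y ^+ m| <= m%:R * `|x - y|.
Proof.
move=> x1 y1; elim: m => [|m IH]; first by rewrite !expr0 subrr normr0 mul0r.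
have -> : x ^+ m.+1 - y ^+ m.+1 = x * (x ^+ m - y ^+ m) + (x - y) * y ^+ m.
  by rewrite !exprS; ring.
apply: le_trans (ler_normD _ _) _; rewrite -natr1 [(_ + 1) * _]mulrDl mul1r; apply: lerD.
  by rewrite normrM -[X in _ <= X]mul1r ler_pM.
by rewrite normrM -[X in _ <= X]mulr1 ler_pM // normrX exprn_ile1.
Qed.

Definition grid (N : nat) (i : nat) : R := i%:R / N%:R.

Lemma grid_leq N i j : (i <= j)%N -> grid N i <= grid N j.
Proof. by move=> ij; rewrite ler_wpM2r ?invr_ge0 // ler_nat. Qed.

Lemma gridN N : (0 < N)%N -> grid N N = 1.
Proof. by move=> N0; rewrite /grid divff // pnatr_eq0 -lt0n. Qed.

Lemma gridS N i : grid N i.+1 - grid N i = N%:R^-1.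
Proof. by rewrite /grid -mulrBl -natr1 addrAC subrr add0r mul1r. Qed.

Lemma grid_norm N i : (0 < N)%N -> (i <= N)%N -> `|grid N i| <= 1.
Proof. by move=> N0 iN; rewrite ger0_norm ?divr_ge0 // -(gridN N0) grid_leq. Qed.

Definition step x t : R := (x <= t)%R%:R.

(** Summation by parts: the bracket telescopes to the m-th power of the first grid point at or above
    [x]. Moments are thus expressed by values of the distribution function alone. The margin below 0
    is needed because F may jump at 0, so that ]0, 1] can miss mass. *)
Lemma step_approx (N m : nat) x : (0 < N)%N -> - N%:R^-1 < x <= 1 ->
  `|x ^+ m - (1 - \sum_(i < N) (grid N i.+1 ^+ m - grid N i ^+ m) * step x (grid N i))|
    <= m%:R / N%:R.
Proof.
move=> N0 /andP[x0 x1].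
have [i [iN xi ix]] : exists i, [/\ (i <= N)%N, x <= grid N i &
    forall j, (j < i)%N -> grid N j < x].
  have exi : exists i, x <= grid N i by exists N; rewrite gridN.
  have xi := ex_minnP exi; case: xi => i xi imin.
  exists i; split=> //; first by apply: imin; rewrite gridN.
  by move=> j ji; rewrite ltNge; apply/negP => /imin; rewrite leqNgt ji.
have stepE j : step x (grid N j) = (i <= j)%N%:R.
  rewrite /step; case: (leqP i j) => ij; last by rewrite leNgt ix.
  by rewrite (le_trans xi) ?grid_leq.
have -> : \sum_(j < N) (grid N j.+1 ^+ m - grid N j ^+ m) * step x (grid N j) =
    1 - grid N i ^+ m.
  under eq_bigr => j _ do rewrite stepE.
  rewrite -(big_mkord xpredT (fun j => (grid N j.+1 ^+ m - grid N j ^+ m) * (i <= j)%N%:R)).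
  rewrite (big_cat_nat (n := i)) //= big_nat_cond big1 ?add0r; last first.
    by move=> j /andP[/andP[_ ji] _]; rewrite leqNgt ji mulr0.
  rewrite big_nat_cond (eq_bigr (fun j => grid N j.+1 ^+ m - grid N j ^+ m)); last first.
    by move=> j /andP[/andP[ij _] _]; rewrite ij mulr1.
  by rewrite -big_nat_cond telescope_sumr // gridN // expr1n.
rewrite subKr.
have N1 : N%:R^-1 <= 1 :> R by rewrite invf_le1 ?ltr0n // ler1n.
apply: le_trans (exprn_dist _ _ _) _; rewrite ?grid_norm //.
  by rewrite ler_norml x1 andbT (le_trans _ (ltW x0)) // lerN2.
rewrite ler_wpM2l // distrC ger0_norm ?subr_ge0 //.
case: i xi {iN} ix {stepE} => [|i] xi ix.
  by rewrite /grid mul0r sub0r lerNl ltW.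
by rewrite -(gridS N i) lerB // ltW // ix.
Qed.

(** Compactness gives a cluster point, and for an ultrafilter a cluster point is a limit. One
    ultrafilter serves all the distribution values at once, in place of a diagonal extraction as in
    Helly's theorem. *)
Lemma ultra_cvg (U : set_system nat) (u : nat -> R) a b : UltraFilter U ->
  (forall n, a <= u n <= b) -> cvg (u n @[n --> U])%classic.
Proof.
move=> UU uab; have UP : ProperFilter U := ultra_proper.
have [p [_ pc]] := @segment_compact R a b (u @ U)%classic (fmap_proper_filter _ _)
  (filterS (fun n _ => uab n) (filterT : U setT)).
apply/cvg_ex; exists p => V pV.
have [//|nV] := in_ultra_setVsetC (u @^-1` V)%classic UU.
by have [x [nx /nx]] := pc (~` V)%classic V nV pV.
Qed.

End StepApproximation.

(** * Moments of a measure from its distribution function *)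

Section StieltjesMoments.
Variable R : realType.
Local Open Scope classical_set_scope.

(** The Stieltjes measure lives on [measurableTypeR R]; its image under this identity is a
    probability on [R]. *)
Let idB : measurableTypeR R -> R := idfun.

#[local] HB.instance Definition _ :=
  @isMeasurableFun.Build _ _ _ _ idB (@measurable_id _ _ setT).

Lemma probability_of_cdf (F : cumulativeBounded (0 : R) (1 : R)) :
  exists mu : probability R R, forall r, mu `]-oo, r] = (F r)%:E.
Proof.
pose P := [the probability (measurableTypeR R) R of lebesgue_stieltjes_measure F].
exists [the probability R R of distribution P (idB : {mfun _ >-> _})] => r.
exact: (cdf_lebesgue_stieltjes_id F r).
Qed.

Variable mu : probability R R.

Lemma integrable_finite (f : R -> R) : measurable_fun setT f ->
  (exists M : R, forall x, `|f x| <= M) -> mu.-integrable setT (EFin \o f).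
Proof.
move=> mf [M fM]; apply: measurable_bounded_integrable => //.
  by rewrite (le_lt_trans (probability_le1 mu _)) // ltry.
by exists M; split; [exact: num_real | move=> x Mx y _ /=; rewrite (le_trans (fM y)) // ltW].
Qed.

Lemma integrable_moment m : mu (~` `[-1, 1]) = 0%E ->
  mu.-integrable setT (EFin \o (fun x : R => x ^+ m)).
Proof.
move=> muA; have mf : measurable_fun setT (fun x : R => x ^+ m) by [].
pose A : set R := `[-1, 1%R].
have mA : measurable (~` A) by apply: measurableC; apply: measurable_itv.
apply/integrableP; split; first exact/measurable_EFinP.
rewrite (ge0_negligible_integral mA) //; last first.
  by apply: measurableT_comp => //; exact/measurable_EFinP.
rewrite (@le_lt_trans _ _ (\int[mu]_(x in setT `\` ~` A) 1)%E) //.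
  apply: ge0_le_integral => //.
  - exact: measurableD.
  - by apply: measurable_funTS; apply: measurableT_comp => //; exact/measurable_EFinP.
  - move=> x [_ /=]; rewrite notK /A /= in_itv /= => x11.
    by rewrite lee_fin normrX exprn_ile1 // ler_norml.
rewrite integral_cst; last exact: measurableD.
rewrite mul1e (le_lt_trans (probability_le1 mu _)) ?ltry //.
exact: measurableD.
Qed.

Lemma Rintegral_sum (I : Type) (r : seq I) (f : I -> R -> R) :
  (forall i, mu.-integrable setT (EFin \o f i)) ->
  mu.-integrable setT (EFin \o (fun x => \sum_(i <- r) f i x)) /\
  (\int[mu]_x (\sum_(i <- r) f i x) = \sum_(i <- r) \int[mu]_x f i x)%R.
Proof.
move=> intf; elim: r => [|i r [IH1 IH2]].
  rewrite big_nil; have -> : (fun x => \sum_(i <- [::]) f i x) = (fun=> 0 : R).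
    by apply/funext => x; rewrite big_nil.
  split; last by rewrite Rintegral_cst // mul0r.
  by apply: integrable_finite => //; exists 0 => x; rewrite normr0.
have -> : (fun x => \sum_(j <- i :: r) f j x) = (fun x => f i x + \sum_(j <- r) f j x).
  by apply/funext => x; rewrite big_cons.
rewrite big_cons -IH2; split; last by rewrite RintegralD.
by have := integrableD measurableT (intf i) IH1; apply: eq_integrable.
Qed.

Lemma step_indic t : (fun x : R => step x t) = \1_(`]-oo, t]).
Proof. by apply/funext => x; rewrite indicE /step mem_setE in_itv. Qed.

Lemma integrable_step t : mu.-integrable setT (EFin \o (fun x : R => step x t)).
Proof.
apply: integrable_finite; last first.
  by exists 1 => x; rewrite /step; case: (x <= t); rewrite ?normr1 ?normr0.
by rewrite step_indic; exact: measurable_indic.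
Qed.

Variable F : R -> R.
Hypothesis muF : forall r, mu `]-oo, r] = (F r)%:E.
Hypothesis F_lt0 : forall r, r < 0 -> F r = 0.
Hypothesis F1 : F 1 = 1.

Lemma null_outside e : 0 < e -> mu (~` `](- e), 1]) = 0%E.
Proof.
move=> e0; have mA : measurable `](- e), 1%R] by [].
rewrite probability_setC //.
have -> : `](- e), 1] = `]-oo, 1] `\` `]-oo, (- e)].
  apply/seteqP; split=> x /=; rewrite !in_itv /=.
    by move=> /andP[ex x1]; split=> //; apply/negP; rewrite -ltNge.
  by move=> [x1 /negP]; rewrite -ltNge x1 andbT.
rewrite measureD //; last by rewrite (le_lt_trans (probability_le1 mu _)) // ltry.
rewrite setIidr; last first.
  move=> x /=; rewrite !in_itv /= => xe; apply: le_trans xe _.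
  by rewrite lerNl (le_trans _ (ltW e0)) // oppr_le0.
transitivity (1 - ((F 1)%:E - (F (- e))%:E))%E; first by rewrite -!muF.
rewrite F1 F_lt0 ?oppr_lt0 //.
by rewrite sube0 subee.
Qed.

Lemma null_outside_unit : mu (~` `[-1, 1]) = 0%E.
Proof.
apply: (subset_measure0 _ _ _ (null_outside ltr01)).
- by apply: measurableC.
- by apply: measurableC.
- by apply: subsetC => x /=; rewrite !in_itv /= => /andP[/ltW -> ->].
Qed.

Lemma Rintegral_step t : (\int[mu]_x step x t = F t)%R.
Proof.
rewrite step_indic.
by rewrite -[F t]/(fine (F t)%:E) -muF /Rintegral integral_indic // setIT.
Qed.

Lemma moment_cdf_approx N m : (0 < N)%N ->
  (`|\int[mu]_x (x ^+ m) -
     (1 - \sum_(i < N) (grid R N i.+1 ^+ m - grid R N i ^+ m) * F (grid R N i))|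
    <= m%:R / N%:R)%R.
Proof.
move=> N0; pose a (i : 'I_N) := grid R N i.+1 ^+ m - grid R N i ^+ m.
pose g (x : R) := (\sum_(i < N) a i * step x (grid R N i))%R.
have intas i : mu.-integrable setT (EFin \o (fun x => a i * step x (grid R N i))).
  by have := integrableZl measurableT (a i) (integrable_step (grid R N i)); apply: eq_integrable.
have [intg intgE] := Rintegral_sum (index_enum 'I_N) intas.
have int1 : mu.-integrable setT (EFin \o (fun=> 1 : R)).
  by apply: integrable_finite => //; exists 1 => x; rewrite normr1.
have int1g : mu.-integrable setT (EFin \o (fun x => 1 - g x)).
  by have := integrableB measurableT int1 intg; apply: eq_integrable.
have gE : (\int[mu]_x (1 - g x) = 1 - \sum_(i < N) a i * F (grid R N i))%R.
  rewrite RintegralB //; congr (_ - _).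
    by rewrite Rintegral_cst // mul1r; exact: (congr1 fine (probability_setT mu)).
  rewrite intgE.
  apply: eq_bigr => i _; rewrite RintegralZl //; last exact: integrable_step.
  by rewrite Rintegral_step.
rewrite -gE -RintegralB //; last exact: (integrable_moment m null_outside_unit).
pose e : R := N%:R^-1; have e0 : 0 < e by rewrite invr_gt0 ltr0n.
pose A : set R := `](- e), 1%R].
have mA : measurable (~` A) by apply: measurableC; apply: measurable_itv.
have mA' : measurable (setT `\` ~` A) by apply: measurableD.
have muA : mu (~` A) = 0%E by apply: null_outside.
have intf : mu.-integrable setT (EFin \o (fun x => x ^+ m - (1 - g x))).
  have := integrableB measurableT (integrable_moment m null_outside_unit) int1g.
  exact: eq_integrable.
rewrite /Rintegral (negligible_integral mA) // -/(Rintegral _ _ _).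
have intfA : mu.-integrable (setT `\` ~` A) (EFin \o (fun x => x ^+ m - (1 - g x))).
  exact: integrableS intf.
apply: le_trans (le_normr_Rintegral _ _) _ => //.
have intc (c : R) : mu.-integrable (setT `\` ~` A) (EFin \o (fun=> c)).
  by apply: (@integrableS _ _ _ _ setT) => //; apply: integrable_finite => //; exists `|c|.
apply: (@le_trans _ _ (\int[mu]_(x in setT `\` ~` A) (m%:R / N%:R))%R).
  apply: le_Rintegral => //; first exact: integrable_norm.
  by move=> x [_ /=]; rewrite notK /A /= in_itv /=; apply: step_approx.
rewrite Rintegral_cst // -[X in _ <= X]mulr1 ler_wpM2l ?divr_ge0 //.
by rewrite -lee_fin fineK ?probability_le1 // fin_num_measure.
Qed.

End StieltjesMoments.

(** * Construction of the representing measure *)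

Section HausdorffMeasure.
Variables (R : realType) (D : nat -> nat -> R).
Hypothesis D_rec : forall k j, D k j = D k j.+1 + D k.+1 j.
Hypothesis D_ge0 : forall k j, 0 <= D k j.
Hypothesis D00 : D 0 0 = 1.
Local Open Scope classical_set_scope.
Local Notation grid := (grid R).

Lemma cvg_big_sum (T : Type) (U : set_system T) (N : nat) (u : 'I_N -> T -> R) (l : 'I_N -> R) :
  Filter U -> (forall i, u i x @[x --> U] --> l i) ->
  (\sum_i u i x)%R @[x --> U] --> (\sum_i l i)%R.
Proof.
move=> FU ul; elim: (index_enum _) => [|i r IH].
  under eq_fun do rewrite big_nil; rewrite big_nil; exact: cvg_cst.
under eq_fun do rewrite big_cons; rewrite big_cons; exact: cvgD.
Qed.

(* The distribution functions of the Bernstein measures converge along an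
   ultrafilter. *)
Lemma hausdorff_limit : exists F : R -> R,
  [/\ {homo F : s t / s <= t}, forall t, t < 0 -> F t = 0,
      forall t, 1 <= t -> F t = 1 &
      forall N m, (0 < N)%N ->
        `|D m 0 - (1 - \sum_(i < N) (grid N i.+1 ^+ m - grid N i ^+ m) * F (grid N i))|%R
          <= m%:R / N%:R].
Proof.
have [U [UU Uoo]] := @ultraFilterLemma nat \oo _.
have PU : ProperFilter U := @ultra_proper _ _ UU.
pose B n t := bernstein D n (fun x => step x t).
have step01 (x t : R) : 0 <= step x t <= 1.
  by rewrite /step; case: (x <= t); rewrite ?lexx ?ler01.
have B01 t n : 0 <= B n t <= 1.
  rewrite -[X in X <= B _ _](bernstein_cst D_rec D00 n 0) -(bernstein_cst D_rec D00 n 1).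
  by apply/andP; split; apply: (bernstein_le D_ge0) => x _; have /andP[] := step01 x t.
have Bcvg t : cvg (B n t @[n --> U]) := ultra_cvg UU (B01 t).
pose F t := lim (B n t @[n --> U]).
exists F; split=> [s t st|t t0|t t1|N m N0].
- apply: (ler_cvg_to (Bcvg s) (Bcvg t)); apply: nearW => n.
  apply: (bernstein_le D_ge0) => x _; rewrite /step ler_nat.
  by case: (leP x s) => xs //; rewrite (le_trans xs st).
- rewrite /F (_ : (fun n => B n t) = fun=> 0); first exact: lim_cst.
  apply/funext => n; rewrite -[RHS](bernstein_cst D_rec D00 n 0).
  apply/le_anti/andP; split; apply: (bernstein_le D_ge0) => x /andP[x0 x1];
    by rewrite /step (leNgt x t) (lt_le_trans t0 x0).
- rewrite /F (_ : (fun n => B n t) = fun=> 1); first exact: lim_cst.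
  apply/funext => n; rewrite -[RHS](bernstein_cst D_rec D00 n 1).
  apply/le_anti/andP; split; apply: (bernstein_le D_ge0) => x /andP[x0 x1];
    by rewrite /step (le_trans x1 t1).
pose a (i : 'I_N) : R := grid N i.+1 ^+ m - grid N i ^+ m.
pose M n := bernstein D n (fun x => x ^+ m).
have Mcvg : M n @[n --> U] --> D m 0.
  (* The ultrafilter refines [\oo], so ordinary convergence of the monomial moments carries over. *)
  apply: (cvg_trans (G := M n @[n --> \oo])); first exact: cvg_app.
  apply/cvgrPdist_le => e e0.
  near=> n; have n0 : (0 < n)%N by near: n; exact: nbhs_infty_gt.
  have mn : (m <= n)%N by near: n; exact: nbhs_infty_ge.
  rewrite distrC; apply: le_trans (bernstein_moment D_rec D_ge0 D00 mn n0) _.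
  rewrite ler_pdivrMr ?ltr0n // -ler_pdivrMl // mulrC.
  by near: n; exact: nbhs_infty_ger.
have Scvg : (\sum_i a i * B n (grid N i))%R @[n --> U] --> (\sum_i a i * F (grid N i))%R.
  by apply: cvg_big_sum => i; apply: cvgM; [exact: cvg_cst | exact: Bcvg].
have ncvg : `|M n - (1 - \sum_i a i * B n (grid N i))|%R @[n --> U] -->
    `|D m 0 - (1 - \sum_i a i * F (grid N i))|%R.
  by apply: cvg_norm; apply: cvgB => //; apply: cvgB => //; exact: cvg_cst.
(* The error m/N of [step_approx] does not depend on n, so it survives the limit. *)
rewrite -(cvg_lim (@Rhausdorff R) ncvg); apply: limr_le.
  by apply/cvg_ex; eexists; exact: ncvg.
apply: nearW => n; rewrite /M.
have -> : (1 - \sum_i a i * B n (grid N i))%R =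
    bernstein D n (fun x => 1 - \sum_(i < N) a i * step x (grid N i)).
  have := bernstein_lin D n (-1) (fun x => \sum_(i < N) a i * step x (grid N i)) (fun=> 1).
  rewrite bernstein_cst // bernstein_sum mulN1r addrC => <-.
  by congr (bernstein _ _ _); apply/funext => x; rewrite mulN1r addrC.
apply: bernstein_dist => // x /andP[x0 x1]; apply: step_approx => //.
by rewrite x1 andbT (lt_le_trans _ x0) // oppr_lt0 invr_gt0 ltr0n.
Unshelve. all: by end_near. Qed.

Lemma eq_of_dist (a b c : R) : (forall N, (0 < N)%N -> `|a - b| <= c / N%:R) -> a = b.
Proof.
move=> ab; apply/eqP; rewrite -subr_eq0 -normr_le0; apply/ler_addgt0Pl => e e0.
rewrite addr0; have [N Ne] : exists N, c / e < N%:R.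
  by exists (Num.truncn (c / e)).+1; rewrite truncnS_gt.
have N0 : 0 < N.+1%:R :> R by rewrite ltr0n.
apply: le_trans (ab N.+1 isT) _; rewrite ler_pdivrMr // -ler_pdivrMl // mulrC.
by rewrite (le_trans (ltW Ne)) // ler_nat.
Qed.

(** The ultrafilter limit F is monotone but perhaps not right-continuous; G t is the infimum of F
    over y > t. Passing from F to G at the grid points is harmless because G at a point is squeezed
    between F there and F at the next one. *)
Theorem hausdorff_moment : exists mu : probability R R,
  mu (~` `[-1, 1]) = 0%E /\ forall m, (\int[mu]_x (x ^+ m) = D m 0)%R.
Proof.
have [F [Fmono F0 F1 FD]] := hausdorff_limit.
have Fge0 t : 0 <= F t.
  case: (ltP t 0) => t0; first by rewrite F0.
  have t1 : t - (t + 1) < 0 by lra.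
  by rewrite -(F0 _ t1) Fmono //; lra.
pose S t := [set F y | y in `]t, +oo[].
have Slb t : has_lbound (S t) by exists 0 => _ [y _ <-].
have S0 t : S t !=set0 by exists (F (t + 1)), (t + 1) => //; rewrite /= in_itv /= andbT; lra.
pose G t := inf (S t).
have FG t : F t <= G t.
  by apply: lb_le_inf => // _ [y /= ty <-]; move: ty; rewrite in_itv /= andbT => /ltW/Fmono.
have GF t y : t < y -> G t <= F y.
  by move=> ty; apply: ge_inf => //; exists y => //; rewrite /= in_itv /= ty.
have Gmono : {homo G : s t / s <= t}.
  move=> s t st; apply: lb_le_inf => // _ [y /= ty <-]; apply: GF.
  by move: ty; rewrite in_itv /= andbT; apply: le_lt_trans.
have Grc x : G y @[y --> x^'+] --> G x.
  apply/cvgrPdist_le => e e0.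
  have [_ [y /= xy <-] Fy] := inf_adherent e0 (conj (S0 x) (Slb x)).
  have {}xy : x < y by move: xy; rewrite in_itv /= andbT.
  near=> z; have xz : x < z by [].
  have zy : z < y by near: z; exact: nbhs_right_lt.
  rewrite distrC ger0_norm ?subr_ge0 ?(Gmono _ _ (ltW xz)) // lerBlDl.
  exact: ltW (le_lt_trans (GF _ _ zy) Fy).
have G0 t : t < 0 -> G t = 0.
  move=> t0; apply/le_anti; rewrite (le_trans (Fge0 t)) // andbT.
  have h : t < t / 2 by lra.
  by rewrite (le_trans (GF _ _ h)) // F0 //; lra.
have G1 t : 1 <= t -> G t = 1.
  move=> t1; apply/le_anti; rewrite -[X in _ && (X <= _)](F1 t t1) FG andbT.
  have h : t < t + 1 by lra.
  by rewrite (le_trans (GF _ _ h)) // F1 //; lra.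
have Gny : G t @[t --> -oo] --> (0 : R).
  apply: cvg_near_cst; near=> t; apply: G0; near: t; exact: nbhs_ninfty_lt.
have Gpy : G t @[t --> +oo] --> (1 : R).
  apply: cvg_near_cst; near=> t; apply: G1; near: t; exact: nbhs_pinfty_ge.
pose mc := isCumulative.Build R _ R G Gmono Grc.
pose mb := isCumulativeBounded.Build R 0 1 G Gny Gpy.
pose G' : cumulativeBounded (0 : R) (1 : R) := HB.pack G mc mb.
have [mu muG] := probability_of_cdf G'.
exists mu; split; first exact: null_outside_unit muG G0 (G1 1 (lexx 1)).
(* Three errors of m/N: the grid sum of G against the moment of [mu], that of F against [D m 0], and
   the two sums against each other. *)
move=> m; apply: (@eq_of_dist _ _ (3 * m%:R)) => N N0.
have H1 := moment_cdf_approx muG G0 (G1 1 (lexx 1)) m N0.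
have H2 := FD N m N0.
pose a (i : 'I_N) : R := grid N i.+1 ^+ m - grid N i ^+ m.
have N0' : 0 < N%:R :> R by rewrite ltr0n.
have aN i : 0 <= a i <= m%:R / N%:R.
  have ii := grid_leq R N (leqnSn i); have g0 : 0 <= grid N i by rewrite divr_ge0.
  apply/andP; split; first by rewrite subr_ge0 lerXn2r ?nnegrE // (le_trans g0).
  have iN := ltn_ord i.
  apply: le_trans (ler_norm _) _.
  apply: le_trans (exprn_dist m (grid_norm R N0 iN) (grid_norm R N0 (ltnW iN))) _.
  by rewrite gridS ger0_norm.
have H3 : `|\sum_(i < N) a i * G (grid N i) - \sum_(i < N) a i * F (grid N i)|%R <= m%:R / N%:R.
  rewrite -sumrB ger0_norm; last first.
    apply: sumr_ge0 => i _; have /andP[a0 _] := aN i.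
    by rewrite -mulrBr; apply: mulr_ge0 => //; rewrite subr_ge0 FG.
  (* Each coefficient is at most m/N, and the increments of F telescope to at most 1. *)
  apply: (@le_trans _ _ (\sum_(i < N) m%:R / N%:R * (F (grid N i.+1) - F (grid N i)))%R).
    apply: ler_sum => i _; have /andP[a0 a1] := aN i.
    rewrite -mulrBr; apply: ler_pM => //; first by rewrite subr_ge0 FG.
    by rewrite lerB // GF // -subr_gt0 gridS invr_gt0.
  rewrite -mulr_sumr -(big_mkord xpredT (fun i => F (grid N i.+1) - F (grid N i))).
  rewrite telescope_sumr // -[X in _ <= X]mulr1 ler_wpM2l ?divr_ge0 //.
  by rewrite gridN // F1 // lerBlDr lerDl.
rewrite -mulrA; move: H1 H2 H3; rewrite -/a.
set SG := (\sum_(i < N) a i * G _)%R; set SF := (\sum_(i < N) a i * F _)%R.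
move: (m%:R / N%:R) => c; rewrite !ler_norml => /andP[? ?] /andP[? ?] /andP[? ?].
by apply/andP; split; lra.
Unshelve. all: by end_near. Qed.

End HausdorffMeasure.

(** * Moments of the square of a selfadjoint operator *)

Section SpectralMeasure.
Variable R : realType.

Lemma hausdorff_moment_scaled (D : nat -> nat -> R) (M : R) : 0 < M ->
  (forall k j, D k j = D k j.+1 + D k.+1 j) -> (forall k j, 0 <= D k j) -> D 0 0 = 1 ->
  exists mu : probability R R,
    compactly_supported mu /\ forall n, \int[mu]_x (x ^+ n) = M ^+ n * D n 0.
Proof.
move=> M0 D_rec D_ge0 D00.
have [mu [mu0 muD]] := hausdorff_moment D_rec D_ge0 D00.
have mX : measurable_fun [set: R] (fun x : R => M * x) by exact: mulrl_measurable.
pose X : {mfun R >-> R} := HB.pack (fun x : R => M * x) (isMeasurableFun.Build _ _ _ _ _ mX).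
exists [the probability R R of distribution mu X]; split.
  exists `[- M, M]%classic; first exact: segment_compact.
  rewrite -[RHS]mu0 /distribution /= /pushforward; congr (mu _).
  have XM x : (- M <= M * x <= M) = (-1 <= x <= 1).
    have -> : (M * x <= M) = (x <= 1) by rewrite -[X in _ <= X]mulr1 ler_pM2l.
    by have -> : (- M <= M * x) = (-1 <= x) by rewrite -[- M]mulrN1 ler_pM2l.
  by apply/seteqP; split=> x /=; rewrite !in_itv /= XM.
move=> n; have intX : mu.-integrable setT (EFin \o (fun x : R => x ^+ n)).
  exact: integrable_moment.
rewrite /Rintegral (@integral_distribution _ _ _ _ _ mu X (EFin \o (fun x => x ^+ n))).
- rewrite -muD -RintegralZl //.
  by congr fine; apply: eq_integral => x _; rewrite /= exprMn.
- by apply/measurable_EFinP.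
- have := integrableZl measurableT (M ^+ n) intX; apply: eq_integrable => // x _.
  by rewrite /= exprMn.
Qed.

Variables (W : Type) (K : graded_form R W) (E : coordinate_system K).
Local Notation H := (hilbert_sum K).

Theorem square_moments (S : H -> H) (Omega : H) :
  bounded_operator S -> is_adjoint S S -> inner Omega Omega = 1 ->
  exists mu : probability R R, compactly_supported mu /\
    forall n, \int[mu]_x (x ^+ n) = complex.Re (inner (iter n (S \o S) Omega) Omega).
Proof.
move=> bS aS O1.
have [M0 M00 SM] := bounded_operator_ge0 bS.
(* The square of the bound [M0] makes [U] positive; adding 1 allows division by [M] even if [M0] is
   0. *)
pose M := M0 ^+ 2 + 1; have M_gt0 : 0 < M by rewrite ltr_wpDl // exprn_ge0.
pose T x := M^-1%:C *: S (S x); pose U x := x - T x.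
have SD x y : S (x + y) = S x + S y := bounded_operatorD x y bS.
have SZ a x : S (a *: x) = a *: S x := bounded_operatorZ a x bS.
have SB x y : S (x - y) = S x - S y by rewrite SD -scaleN1r SZ scaleN1r.
have UB x y : U (x - y) = U x - U y.
  by rewrite /U /T !SB scalerBr !opprD !opprK addrACA.
have UZ a x : U (a *: x) = a *: U x.
  by rewrite /U /T !SZ scalerBr !scalerA [a * _]mulrC.
have US x : U (S x) = S (U x) by rewrite /U /T SB SZ.
have aU x y : inner (U x) y = inner x (U y).
  by rewrite /U /T (innerBl E) (innerBr E) (innerZl E) (innerZr E) conjc_real !aS.
have aI (A : H -> H) n x y : (forall x y, inner (A x) y = inner x (A y)) ->
    inner (iter n A x) y = inner x (iter n A y).
  by move=> aA; elim: n x y => // n IH x y; rewrite iterS aA IH -iterSr.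
have IUB j x y : iter j U (x - y) = iter j U x - iter j U y.
  by elim: j => // j IH; rewrite !iterS IH UB.
have IUZ j a x : iter j U (a *: x) = a *: iter j U x.
  by elim: j => // j IH; rewrite !iterS IH UZ.
have IUS j k x : iter j U (iter k S x) = iter k S (iter j U x).
  have IU y : iter j U (S y) = S (iter j U y) by elim: j => // j IH; rewrite !iterS IH US.
  by elim: k => // k IH; rewrite !iterS IU IH.
have IT k x : iter k T x = (M^-1 ^+ k)%:C *: iter k (S \o S) x.
  elim: k => [|k IH]; first by rewrite scale1r.
  by rewrite !iterS IH /T !SZ scalerA -rmorphM -exprS.
(* Half of the powers move to the right. With w the vector so obtained, even j leaves the squared
   norm of w, and odd j leaves that of w minus 1/M times that of S w. *)
have U_ge0 j v : 0 <= complex.Re (inner (iter j U v) v).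
  rewrite -(odd_double_half j) -addnn addnCA iterD aI // iterD.
  set w := iter _ U v; case: (odd j); last by apply: ge0_Re; apply: (inner_ge0 E).
  rewrite [iter _ _ w]/(U w) /U (innerBl E) /T (innerZl E) aS.
  have -> : complex.Re (inner w w - M^-1%:C * inner (S w) (S w)) =
      hnorm w ^+ 2 - M^-1 * hnorm (S w) ^+ 2.
    by rewrite !(innerxx E) -rmorphM -rmorphB.
  rewrite subr_ge0 ler_pdivrMl //.
  apply: (@le_trans _ _ (M0 ^+ 2 * hnorm w ^+ 2)).
    by rewrite -exprMn ler_pXn2r ?nnegrE ?mulr_ge0 ?hnorm_ge0.
  by rewrite ler_wpM2r ?exprn_ge0 ?hnorm_ge0 // lerDl.
pose D k j := complex.Re (inner (iter j U (iter k T Omega)) Omega).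
have [] := @hausdorff_moment_scaled D M M_gt0.
- move=> k j; rewrite /D iterSr -ReD -(innerDl E) /U IUB iterS.
  by rewrite -/(U _) subrK.
(* Up to the factor M^-k, T^k is S^k S^k. As S commutes with [U], one S^k moves to the right and
   [U_ge0] applies to the vector S^k Omega. *)
- move=> k j; rewrite /D IT IUZ (innerZl E).
  have -> : iter k (S \o S) Omega = iter k S (iter k S Omega).
    by rewrite -iterD addnn -muln2 iterM.
  rewrite IUS aI // Re_realM mulr_ge0 ?exprn_ge0 ?invr_ge0 ?(ltW M_gt0) //.
- by rewrite [D 0 0]/(complex.Re (inner Omega Omega)) O1.
move=> mu [cmu muD]; exists mu; split=> // n.
have -> : \int[mu]_x (x ^+ n) = M ^+ n * complex.Re (inner (iter n T Omega) Omega) by rewrite muD.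
rewrite IT (innerZl E) Re_realM.
by rewrite mulrA -exprMn divff ?gt_eqF // expr1n mul1r.
Qed.

End SpectralMeasure.

Theorem corollary1p9 (R : realType) (d : nat) (q : R)
    (hd : (0 < d)%N) (hq : -1 < q < 1) :
  exists mu : probability R R,
    [/\ compactly_supported mu,
        forall n : nat, (0 < n)%N ->
          \int[mu]_x (x ^+ n) = Ptilde n d%:R q &
        is_distribution (@vacuum_state2 R d q hq) (@X_operator R d q hq) mu].
Proof.
have bS := @bounded_X_sum R d q hq; have aS := @X_sum_adjoint R d q hq.
set Omega := tensor (@vacuum R d q hq) (@vacuum R d q hq).
have Omega1 : inner Omega Omega = 1 by rewrite inner_vacuum2 /= mul1r.
have [mu [cmu muM]] := square_moments (fock2_coordinates d hq) bS aS Omega1.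
have moment n : (0 < n)%N -> \int[mu]_x (x ^+ n) = Ptilde n d%:R q.
  by move=> n0; rewrite muM -/(@X_operator R d q hq) vacuum_moment.
exists mu; split=> //; split=> // [|x y|n n0].
- exact: (bounded_operator_comp bS bS).
- by rewrite /X_operator /= !aS.
- by rewrite /vacuum_state2 /vector_state vacuum_moment // moment.
Qed.
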